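(* Let $v$ be a flow on a connected compact surface $S$. Then $v$ is Poisson stable if and only if $v$ is recurrent and either $\mathrm{LD}(v)=\emptyset$ or $\mathrm{Cl}(v)=\emptyset$.
   Context: A surface is a two-dimensional paracompact manifold, possibly with boundary. A flow is a continuous $\mathbb{R}$-action $v$ on $S$ with orbits $O(x)$. Let $\omega(x)=\bigcap_{n\in\mathbb{R}}\overline{\{v_t(x)\mid t>n\}}$, $\alpha(x)=\bigcap_{n\in\mathbb{R}}\overline{\{v_t(x)\mid t<n\}}$. A point $x$ is recurrent if $x\in\omega(x)\cup\alpha(x)$ and Poisson stable if $x\in\omega(x)\cap\alpha(x)$; the flow is recurrent (resp. Poisson stable) if every point is. A point is singular if fixed by all $v_t$, periodic if non-singular and $v_T(x)=x$ for some $T>0$, closed if singular or periodic; $\mathrm{Cl}(v)$ is the set of closed points. An orbit is locally dense if its closure has nonempty interior; $\mathrm{LD}(v)$ is the union of non-closed locally dense orbits. *)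

(* Defs.v *)
From HB Require Import structures.
From mathcomp Require Import all_boot all_order all_algebra.
From mathcomp Require Import all_classical all_reals all_analysis.
From mathcomp Require Import Rstruct Rstruct_topology.
Set Implicit Arguments. Unset Strict Implicit. Unset Printing Implicit Defensive.
Import Order.TTheory GRing.Theory Num.Theory.
Local Open Scope classical_set_scope.
Local Open Scope ring_scope.

Notation RR := Rdefinitions.R.

Definition half_plane : set (RR * RR) := [set p | 0 <= p.2].

Definition open_in_half_plane (V : set (RR * RR)) : Prop :=
  exists W : set (RR * RR), open W /\ V = W `&` half_plane.

Definition locally_half_euclidean2 (T : topologicalType) : Prop :=
  forall x : T, exists (U : set T) (V : set (RR * RR))
    (f : T -> RR * RR) (g : RR * RR -> T),
    [/\ open U, U x, open_in_half_plane V,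
        [/\ f @` U `<=` V, g @` V `<=` U,
            (forall y, U y -> g (f y) = y) & (forall p, V p -> f (g p) = p)]
      & {within U, continuous f} /\ {within V, continuous g}].

Definition paracompact (T : topologicalType) : Prop :=
  forall (I : Type) (U : I -> set T),
    (forall i, open (U i)) -> \bigcup_i U i = [set: T] ->
    exists (J : Type) (W : J -> set T),
      [/\ (forall j, open (W j)), \bigcup_j W j = [set: T],
          (forall j, exists i, W j `<=` U i)
        & (forall x : T, exists N, nbhs x N /\
              finite_set [set j | W j `&` N !=set0])].

Definition is_surface (T : topologicalType) : Prop :=
  [/\ hausdorff_space T, paracompact T & locally_half_euclidean2 T].

Definition is_flow (T : topologicalType) (v : RR -> T -> T) : Prop :=
  [/\ (forall x, v 0 x = x),
      (forall s t x, v (s + t) x = v s (v t x))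
    & continuous (fun p : RR * T => v p.1 p.2)].

Definition orbit (T : topologicalType) (v : RR -> T -> T) (x : T) : set T :=
  [set v t x | t in [set: RR]].

Definition omega_limit (T : topologicalType) (v : RR -> T -> T) (x : T) : set T :=
  \bigcap_(n in [set: RR]) closure [set v t x | t in [set t | n < t]].

Definition alpha_limit (T : topologicalType) (v : RR -> T -> T) (x : T) : set T :=
  \bigcap_(n in [set: RR]) closure [set v t x | t in [set t | t < n]].

Definition recurrent_point (T : topologicalType) (v : RR -> T -> T) (x : T) : Prop :=
  (omega_limit v x `|` alpha_limit v x) x.

Definition Poisson_stable_point (T : topologicalType) (v : RR -> T -> T) (x : T) : Prop :=
  (omega_limit v x `&` alpha_limit v x) x.

Definition recurrent_flow (T : topologicalType) (v : RR -> T -> T) : Prop :=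
  forall x, recurrent_point v x.

Definition Poisson_stable_flow (T : topologicalType) (v : RR -> T -> T) : Prop :=
  forall x, Poisson_stable_point v x.

Definition singular_point (T : topologicalType) (v : RR -> T -> T) (x : T) : Prop :=
  forall t, v t x = x.

Definition periodic_point (T : topologicalType) (v : RR -> T -> T) (x : T) : Prop :=
  ~ singular_point v x /\ exists per : RR, 0 < per /\ v per x = x.

Definition closed_point (T : topologicalType) (v : RR -> T -> T) (x : T) : Prop :=
  singular_point v x \/ periodic_point v x.

Definition Cl (T : topologicalType) (v : RR -> T -> T) : set T :=
  [set x | closed_point v x].

Definition locally_dense_orbit (T : topologicalType) (v : RR -> T -> T) (x : T) : Prop :=
  (interior (closure (orbit v x))) !=set0.

Definition LD (T : topologicalType) (v : RR -> T -> T) : set T :=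
  \bigcup_(x in [set x | ~ closed_point v x /\ locally_dense_orbit v x]) orbit v x.

(* Main.v *)
(** Two-fold coverings of the surface are encoded by families of local
    Z/2-valued functions whose differences are locally constant; by
    compactness there are finitely many classes.  They replace the Jordan
    curve theorem: near a non-singular interior point of the surface they give
    a local cross-section of the flow cutting every small disc in two, hence
    linearly ordered like an interval; and an orbit that crosses one of two
    disjoint closed curves of the same class twice must cross the other one in
    between.

    Poisson stable flows: if a point is not closed, its orbit hits an ordered
    section three times, the saturation of the interval between the outer hits
    is open and compact, so it is the whole surface and no orbit is closed.

    Recurrent flows: a non-closed orbit is locally dense.  Otherwise infinitely
    many gaps between the hits on a section contain points [y] outside the
    orbit closure.  Each gap and the orbit arc joining its ends form a closed
    curve.  For infinitely many gaps these curves have the same class for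
    arbitrarily long initial orbit arcs, so that one bounded arc of the
    recurrent orbit of a single [y] crosses infinitely many disjoint gaps,
    which is absurd.  Hence without locally dense orbits every point is closed,
    and without closed points every minimal set is open, so the flow is minimal. *)
Require Import Defs.
From mathcomp Require Import all_boot all_order all_algebra.
From mathcomp Require Import all_classical all_reals all_analysis.
From mathcomp Require Import Rstruct Rstruct_topology lra ring.
Set Implicit Arguments. Unset Strict Implicit. Unset Printing Implicit Defensive.
Import Order.TTheory GRing.Theory Num.Theory numFieldNormedType.Exports.
Local Open Scope classical_set_scope.
Local Open Scope ring_scope.

(** * Systems of local Z/2-valued functions *)

(** The flow is only continuous, so a section is at first a bare level set with no known local
    structure. That it is a curve is read off from the Z/2-cohomology of a punctured disc: it is
    non-zero, so a point cuts the section into at least two pieces, and of rank one, so into at most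
    two; an argument on continua turns this into a linear order. Coefficients in Z/2 also make
    orientation irrelevant: the closed curve over a gap may be one-sided or fail to separate the
    surface, and the parity of crossings still makes sense. For two curves to be compared, neither
    orbit arc may run through the other gap. Both gaps are therefore cut down by all hits up to a
    common time [n]. This time depends on the pair of gaps, and the class of a curve depends on the
    time; an ultrafilter on [n] assigns one class to each gap. *)

Lemma locally_constant_connected (X : topologicalType) (A : set X) (b : X -> bool) :
  connected A ->
  (forall x, A x -> \forall y \near x, A y -> b y = b x) ->
  forall x y, A x -> A y -> b x = b y.
Proof.
move=> cA bA x y Ax Ay.
suff E : A `&` [set z | b z = b x] = A.
  by have [_ ->] : (A `&` [set z | b z = b x]) y by rewrite E.
apply: cA; first by exists x.
- exists (interior [set z | A z -> b z = b x]); first exact: open_interior.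
  apply/seteqP; split => [z [Az bz]|z [Az bz]]; split => //.
    by move: (bA z Az) => /=; apply: filterS => u h Au; rewrite h.
  by move/nbhs_singleton: bz; apply.
- exists (~` interior [set z | A z -> b z <> b x]).
    exact/open_closedC/open_interior.
  apply/seteqP; split => [z [Az bz]|z [Az bz]]; split => //.
    by move=> /nbhs_singleton /(_ Az).
  apply: contrapT => nbz; apply: bz.
  by move: (bA z Az) => /=; apply: filterS => u h Au; rewrite h.
Qed.

Lemma connected_segment (a b : RR) : connected [set t : RR | a <= t <= b].
Proof.
apply/connected_intervalP => x y /andP[ax xb] /andP[ay yb] z /andP[xz zy].
by rewrite /= (le_trans ax xz) (le_trans zy yb).
Qed.

(* A torsor under the locally constant functions to Z/2, given by local
   trivialisations: the values of two charts differ by a locally constant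
   function.  Two-fold covering spaces are encoded in this way. *)
Record sys (T : topologicalType) := Sys {
  sidx : Type;
  sdom : sidx -> set T;
  slab : sidx -> T -> bool }.

Definition good (T : topologicalType) (D : sys T) (A : set T) : Prop :=
  [/\ forall i : sidx D, open (sdom i),
      forall (i j : sidx D) x, sdom i x -> sdom j x ->
        \forall y \near x, slab i y (+) slab j y = slab i x (+) slab j x
    & forall x, A x -> exists i : sidx D, sdom i x].

(** Sections of the pull-back of the two-fold covering along [F]: in each chart they differ from the
    label by a locally constant function. A map [F], rather than a subset of [T], is allowed so that
    sections can be lifted along homotopies and along the flow. *)
Definition compat_at (T : topologicalType) (D : sys T) (X : topologicalType)
    (F : X -> T) (A : set X) (w : X -> bool) (x : X) : Prop :=
  forall i : sidx D, sdom i (F x) ->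
    \forall y \near x, A y -> w y (+) slab i (F y) = w x (+) slab i (F x).

Definition compat (T : topologicalType) (D : sys T) (X : topologicalType)
    (F : X -> T) (A : set X) (w : X -> bool) : Prop :=
  forall x, A x -> compat_at D F A w x.

Definition triv (T : topologicalType) (D : sys T) (A : set T) : Prop :=
  exists w, compat D id A w.

(** Continuity relative to [A] at one point, as a pull-back of neighbourhoods. *)
Definition cwithin (X T : topologicalType) (F : X -> T) (A : set X) (x : X) :=
  forall G, nbhs (F x) G -> \forall y \near x, A y -> G (F y).

Section systems.
Variables (T : topologicalType) (D : sys T) (B : set T).
Hypothesis gD : good D B.

(** Two charts differ by a locally constant function where both are defined, so a single chart
    around [F x] decides. *)
Lemma compat_at1 (X : topologicalType) (F : X -> T) (A : set X) w x
    (i : sidx D) : cwithin F A x -> sdom i (F x) ->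
  (\forall y \near x, A y -> w y (+) slab i (F y) = w x (+) slab i (F x)) ->
  compat_at D F A w x.
Proof.
move=> cF ix wi j jx; have [_ ij _] := gD.
have := cF _ (ij _ _ _ ix jx); apply: filterS2 wi => y wy fy Ay.
have := fy Ay; have := wy Ay => /=.
by case: (w y); case: (w x); case: (slab i _); case: (slab i _);
  case: (slab j _); case: (slab j _).
Qed.

Lemma compat_eq (X : topologicalType) (F : X -> T) (A : set X) w w' :
  (forall x, A x -> B (F x)) ->
  connected A -> compat D F A w -> compat D F A w' ->
  forall x y, A x -> A y -> w x (+) w' x = w y (+) w' y.
Proof.
move=> AB cA cw cw' x y Ax Ay.
apply: (locally_constant_connected (b := fun z => w z (+) w' z) cA) => // z Az.
have [_ _ /(_ _ (AB _ Az)) [i iz]] := gD.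
have := cw' z Az i iz; have := cw z Az i iz.
apply: filterS2 => u /= h h' Au; move: (h Au) (h' Au).
by case: (w u); case: (w z); case: (slab i _); case: (slab i _); case: (w' _); case: (w' _).
Qed.

Lemma compatS (X : topologicalType) (F : X -> T) (A A' : set X) w :
  A' `<=` A -> compat D F A w -> compat D F A' w.
Proof.
move=> sA cw x A'x i ix; have := cw x (sA _ A'x) i ix.
by apply: filterS => y h A'y; apply: h; apply: sA.
Qed.

Lemma compat_comp (X Y : topologicalType) (F : X -> T) (k : Y -> X)
    (A : set X) (A' : set Y) w :
  (forall y, A' y -> A (k y)) -> (forall y, A' y -> cwithin k A' y) ->
  compat D F A w -> compat D (F \o k) A' (w \o k).
Proof.
move=> kA ck cw y A'y i iy; have := ck y A'y _ (cw (k y) (kA _ A'y) i iy).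
by apply: filterS => z h A'z; apply: h => //; apply: kA.
Qed.

Lemma compat_addC (X : topologicalType) (F : X -> T) (A : set X) w c :
  compat D F A w -> compat D F A (fun x => w x (+) c).
Proof.
move=> cw x Ax i ix; have := cw x Ax i ix; apply: filterS => y h Ay.
by move: (h Ay); case: (w y); case: (w x); case: (slab i _); case: (slab i _); case: c.
Qed.

Lemma compat_ext (X : topologicalType) (F F' : X -> T) (A : set X) w w' :
  (forall x, A x -> F x = F' x) -> (forall x, A x -> w x = w' x) ->
  compat D F A w -> compat D F' A w'.
Proof.
move=> eF ew cw x Ax i; rewrite -eF // -ew // => ix.
by have := cw x Ax i ix; apply: filterS => y h Ay; rewrite -eF // -ew // h.
Qed.

Lemma compat_glue (X : topologicalType) (F : X -> T) (A A' : set X) w w' :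
  (forall x, A x -> \forall y \near x, A' y -> A y) ->
  (forall x, A' x -> \forall y \near x, A y -> A' y) ->
  (forall x, A x -> A' x -> w x = w' x) ->
  compat D F A w -> compat D F A' w' ->
  compat D F (A `|` A') (fun x => if `[< A x >] then w x else w' x).
Proof.
move=> oA oA' ww' cw cw' x; have [Ax _|nAx [//|A'x]] := pselect (A x).
  move=> i ix; have := cw x Ax i ix; have := oA x Ax.
  apply: filterS2 => y AA' h AU; have Ay : A y by case: AU => // /AA'.
  by rewrite !asboolT // h.
move=> i ix; have := cw' x A'x i ix; have := oA' x A'x.
apply: filterS2 => y AA' h AU; have A'y : A' y by case: AU => // /AA'.
rewrite (asboolF nAx); case: asboolP => [Ay|_]; last exact: h.
by rewrite ww' // h.
Qed.

End systems.

(** * Lifting of sections along intervals *)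

Section product_lemma.
Variables (T : topologicalType) (D : sys T) (B : set T).
Hypothesis gD : good D B.
Variables (X : topologicalType) (F : X * RR -> T) (E : set (X * RR)).
Variable w0 : X -> bool.
Hypothesis EB : forall z, E z -> B (F z).
Hypothesis cF : forall z, E z -> cwithin F E z.
Hypothesis E_down : forall x t s, E (x, t) -> 0 <= s <= t -> E (x, s).
Hypothesis E_ge0 : forall x t, E (x, t) -> 0 <= t.
Hypothesis cw0 : compat D (fun x => F (x, 0)) [set x | E (x, 0)] w0.

Let upto (G : set X) (r : RR) := E `&` [set z | G z.1 /\ z.2 <= r].

Let lifts (G : set X) (r : RR) (w : X * RR -> bool) :=
  compat D F (upto G r) w /\ forall x, E (x, 0) -> w (x, 0) = w0 x.

Lemma lifts_eq G r w G' r' w' : lifts G r w -> lifts G' r' w' ->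
  forall x t, E (x, t) -> G x -> G' x -> t <= r -> t <= r' -> w (x, t) = w' (x, t).
Proof.
move=> [cw iw] [cw' iw'] x t Ext Gx G'x tr tr'.
have ge0 := E_ge0 Ext.
pose A := [set s : RR | 0 <= s <= t].
have cpl (s : RR) : cwithin (fun s : RR => (x, s)) A s.
  move=> H; case=> [[P Q]] /= [P1 Q1] sub.
  apply: filterS Q1 => s' Qs' _; apply: sub; split => //=.
  exact: nbhs_singleton P1.
have := @compat_eq _ D B gD _ (F \o (fun s : RR => (x, s))) A
  (w \o (fun s : RR => (x, s))) (w' \o (fun s : RR => (x, s))).
move=> /(_ _ _ _ _ 0 t); rewrite /= iw ?iw'; last 2 first.
- by apply: E_down Ext _; rewrite lexx.
- by apply: E_down Ext _; rewrite lexx.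
rewrite addbb => H; have : false = w (x, t) (+) w' (x, t).
  apply: H => //=.
  - by move=> s As; apply/EB/E_down/As.
  - exact: connected_segment.
  - apply: compat_comp cw => // s As; split => /=; first exact: E_down Ext As.
    by split => //; case/andP: As => _ /le_trans; apply.
  - apply: compat_comp cw' => // s As; split => /=; first exact: E_down Ext As.
    by split => //; case/andP: As => _ /le_trans; apply.
  - by rewrite /A /= lexx.
  - by rewrite /A /= lexx ge0.
by case: (w _); case: (w' _).
Qed.

Lemma lifts_step x s : E (x, s) -> exists2 e : RR, 0 < e &
  forall G r w, nbhs x G -> 0 <= r -> s - e < r <= s -> lifts G r w ->
  exists G' w', nbhs x G' /\ lifts G' (s + e) w'.
Proof.
move=> Exs; have [oD ij /(_ _ (EB Exs)) [i ix]] := gD.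
have := cF Exs (open_nbhs_nbhs (conj (oD i) ix)) => -[[P Q]] /= [Px Qs] sub.
move/nbhs_ballP: Qs => [d /= d0 Qd].
have d20 : 0 < d / 2 by lra.
exists (d / 2) => // G r w Gx r0 /andP[r1 r2] [cw iw].
(* Above height [r] the difference between section and label in chart [i] is frozen at its value at
   [(z.1, r)]. *)
exists (G `&` P), (fun z => if z.2 <= r then w z else
  slab i (F z) (+) (w (z.1, r) (+) slab i (F (z.1, r)))).
split; first exact: filterI.
split; last by move=> y Ey; rewrite /= r0 iw.
have inU y t : E (y, t) -> P y -> s - d < t < s + d -> sdom i (F (y, t)).
  move=> Ey Py td; apply: sub => //; split => //=; apply: Qd.
  by rewrite /ball /= ltr_norml; apply/andP; split; lra.
have Er y t : E (y, t) -> r <= t -> E (y, r).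
  by move=> Ey rt; apply: E_down Ey _; rewrite r0.
pose lv y := w (y, r) (+) slab i (F (y, r)).
have lvN y : E (y, r) -> G y -> P y ->
    \forall z \near (y, r), upto G r z -> w z (+) slab i (F z) = lv y.
  move=> Ey Gy Py; apply: (cw (y, r)); first by split.
  by apply: inU => //; lra.
have lvN1 y : E (y, r) -> G y -> P y ->
    \forall u \near y, E (u, r) -> G u -> lv u = lv y.
  move=> Ey Gy Py; have [[P1 Q1] /= [P1y Q1r] sub1] := lvN y Ey Gy Py.
  apply: filterS P1y => u P1u Eu Gu; apply: (sub1 (u, r)).
    by split => //=; exact: nbhs_singleton Q1r.
  by split.
move=> [y t] [Ey [[Gy Py] /= tt]] .
have lift1 (H : set X) : nbhs y H -> \forall z \near (y, t), H z.1.
  move=> Hy; exists (H, setT) => /=; first by split => //; exact: filterT.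
  by move=> [u q] [].
have [tr|rt] := ltP t r.
  move=> j jy; have := cw (y, t) (conj Ey (conj Gy (ltW tr))) j jy.
  have : \forall z \near (y, t), z.2 < r.
    exists (setT, [set q | q < r]) => /=.
      by split; [exact: filterT | exact: lt_nbhsl].
    by move=> [u q] [].
  apply: filterS2 => -[u q] /= qr h [Eu [[Gu Pu] /= qq]].
  rewrite (ltW qr) (ltW tr); apply: h.
  by split => //; split => //; exact: ltW.
have Eyr := Er _ _ Ey rt.
apply: (@compat_at1 _ D B gD _ _ _ _ _ i).
- move=> H /(cF Ey); apply: filterS => z h [Ez _]; exact: h.
- by apply: inU => //; lra.
have [req|trne] := eqVneq t r.
  rewrite {}req in Ey tt lift1 rt *.
  have N2 := lift1 _ (lvN1 y Eyr Gy Py).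
  have := lvN y Eyr Gy Py; apply: filterS2 N2 => -[u q] /= h1 h2.
  move=> [Eu [[Gu Pu] /= qq]]; rewrite lexx.
  have [qr|rq] := leP q r.
    by rewrite h2.
  rewrite addbC addKb; apply: h1 => //; apply: Er Eu _; exact: ltW.
have {trne}rt : r < t by rewrite lt_neqAle eq_sym trne.
have N2 := lift1 _ (lvN1 y Eyr Gy Py).
have : \forall z \near (y, t), r < z.2.
  exists (setT, [set q | r < q]) => /=.
    by split; [exact: filterT | exact: lt_nbhsr].
  by move=> [u q] [].
apply: filterS2 N2 => -[u q] /= h1 rq [Eu [[Gu Pu] /= qq]].
rewrite leNgt rq leNgt rt /= ![slab i _ (+) _]addbC.
by rewrite -!addbA !addbb !addbF; apply: h1 => //; apply: Er Eu _; exact: ltW.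
Qed.

Lemma lifts_near x t : E (x, t) ->
  exists G r w, [/\ nbhs x G, t < r & lifts G r w].
Proof.
move=> Ext; have t0 := E_ge0 Ext; apply: contrapT => nL.
pose L := [set r : RR | 0 <= r /\ exists G w, nbhs x G /\ lifts G r w].
have L0 : L 0.
  split; rewrite ?lexx //; exists setT, (fun z => w0 z.1); split; first exact: filterT.
  split => //.
  have E0 z : upto setT 0 z -> z.2 = 0.
    by case: z => y r [/E_ge0 r0 [_ /= r1]]; apply/eqP; rewrite eq_le r1.
  apply: (@compat_ext _ D _ ((fun x => F (x, 0)) \o fst) F _ (w0 \o fst)) => //.
    by move=> -[y r] /E0 /= ->.
  apply: compat_comp cw0.
    by move=> -[y r] z; have := E0 _ z; case: z => Ez _ /= r0; rewrite -r0.
  move=> -[y r] _ H Hy; exists (H, setT) => /=.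
    by split => //; exact: filterT.
  by move=> [u q] [].
have Lt r : L r -> r <= t.
  move=> [r0 [G [w [Gx lw]]]]; rewrite leNgt; apply/negP => tr.
  by apply: nL; exists G, r, w.
have hsL : has_sup L by split; [exists 0 | exists t].
have s0 : 0 <= sup L by apply: sup_upper_bound.
have st : sup L <= t by apply: ge_sup => //; exists 0.
have Exs : E (x, sup L) by apply: E_down Ext _; rewrite s0.
have [e e0 step] := lifts_step Exs.
have [r [r0 [G [w [Gx lw]]]] er] := sup_adherent e0 hsL.
have rs : r <= sup L.
  by apply: sup_upper_bound => //; split => //; exists G, w.
have [|G' [w' [G'x lw']]] := step G r w Gx r0 _ lw; first by rewrite er.
have : sup L + e <= sup L.
  apply: sup_upper_bound => //; split; first by lra.
  by exists G', w'.
lra.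
Qed.

(** Homotopy lifting for two-fold coverings. The fibres of [E] may vary with [x] as long as they are
    intervals from 0, which covers slit squares and flow boxes without half of a fibre. Each point
    uses its own local lift; uniqueness along the fibre makes neighbouring choices agree. *)
Lemma product_lift : exists w : X * RR -> bool,
  compat D F E w /\ forall x, E (x, 0) -> w (x, 0) = w0 x.
Proof.
have L z : exists w : X * RR -> bool, E z ->
    exists G r, [/\ nbhs z.1 G, z.2 < r & lifts G r w].
  have [Ez|] := pselect (E z); last by exists (fun=> true).
  have [G [r [w [Gx tr lw]]]] : exists G r w, [/\ nbhs z.1 G, z.2 < r & lifts G r w].
    by case: z Ez => x t; exact: lifts_near.
  by exists w => _; exists G, r.
have {L}[W HW] := choice L.
exists (fun z => W z z); split.
  move=> [x t] Ext i ix; have [G [r [/= Gx tr lw]]] := HW _ Ext.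
  have xt : upto G r (x, t).
    by split => //; split => /=; [exact: nbhs_singleton Gx | exact: ltW].
  have := lw.1 _ xt i ix.
  have : \forall z \near (x, t), G z.1 /\ z.2 < r.
    by exists (G, [set q | q < r]) => /=; first by split => //; exact: lt_nbhsl.
  apply: filterS2 => -[y s] /= [Gy sr] h Eys.
  have [G' [r' [/= G'y sr' lw']]] := HW _ Eys.
  have -> : W (y, s) (y, s) = W (x, t) (y, s).
    apply: (lifts_eq lw' lw Eys) => //; try exact: ltW.
    exact: nbhs_singleton G'y.
  by apply: h; split => //; split => //=; exact: ltW.
move=> x Ex0; have [G [r [/= Gx tr lw]]] := HW _ Ex0.
exact: lw.2.
Qed.

End product_lemma.

(** * Rectangle charts *)

Lemma cwithin_continuous (X T : topologicalType) (F : X -> T) (A : set X) x :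
  {for x, continuous F} -> cwithin F A x.
Proof.
move=> cF G Gx; have : nbhs x (F @^-1` G) by exact: cF.
by apply: filterS => y Gy _.
Qed.

Lemma cwithinS (X T : topologicalType) (F : X -> T) (A A' : set X) x :
  A' `<=` A -> cwithin F A x -> cwithin F A' x.
Proof.
by move=> sA cF G /cF; apply: filterS => y h /sA /h.
Qed.

Lemma cwithin_comp (X Y T : topologicalType) (F : X -> T) (k : Y -> X)
    (A : set X) (A' : set Y) y :
  (forall y, A' y -> A (k y)) ->
  cwithin k A' y -> cwithin F A (k y) -> cwithin (F \o k) A' y.
Proof.
by move=> kA ck cF G /cF /ck; apply: filterS => z h A'z; apply: (h A'z); apply: kA.
Qed.

Lemma contC (X Y : topologicalType) (c : Y) (x : X) :
  {for x, continuous (fun _ : X => c)}.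
Proof. exact: cst_continuous. Qed.

Lemma contI (X : topologicalType) (x : X) : {for x, continuous (fun u : X => u)}.
Proof. by move=> ?. Qed.

(* The topology of [RR] is that of [RR^o]; the library's lemmas on normed
   modules apply only after this cast. *)
Lemma contD (X : topologicalType) (f g : X -> RR) x : {for x, continuous f} ->
  {for x, continuous g} -> {for x, continuous (fun u => f u + g u : RR)}.
Proof. exact: (@continuousD RR RR^o X f g x). Qed.

Lemma contN (X : topologicalType) (f : X -> RR) x : {for x, continuous f} ->
  {for x, continuous (fun u => - f u : RR)}.
Proof. exact: (@continuousN RR RR^o X f x). Qed.

Lemma contM (X : topologicalType) (f g : X -> RR) x : {for x, continuous f} ->
  {for x, continuous g} -> {for x, continuous (fun u => f u * g u : RR)}.
Proof. exact: (@continuousM RR X f g x). Qed.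

Lemma contP (X Y Z : topologicalType) (f : X -> Y) (g : X -> Z) x :
  {for x, continuous f} -> {for x, continuous g} ->
  {for x, continuous (fun u => (f u, g u))}.
Proof. by move=> cf cg; apply: cvg_pair. Qed.

Lemma pair_continuous (X Y Z : topologicalType) (k : X -> Y * Z) (x : X) :
  {for x, continuous (fun u => (k u).1)} ->
  {for x, continuous (fun u => (k u).2)} -> {for x, continuous k}.
Proof.
move=> h1 h2.
have -> : k = (fun u => ((k u).1, (k u).2)) by apply/funext => u; case: (k u).
exact: contP.
Qed.

Ltac cont := repeat first [exact: contC | exact: contI | exact: cvg_fst
  | exact: cvg_snd | apply: contD | apply: contN | apply: contM ].

Lemma star_connected (A : set (RR * RR)) (c : RR * RR) :
  A c ->
  (forall z (t : RR), A z -> 0 <= t <= 1 ->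
     A (c.1 + t * (z.1 - c.1), c.2 + t * (z.2 - c.2))) ->
  connected A.
Proof.
move=> Ac st.
pose ray (z : RR * RR) (t : RR) : RR * RR := (c.1 + t * (z.1 - c.1), c.2 + t * (z.2 - c.2)).
have cray z : continuous (ray z).
  by move=> t; apply: pair_continuous => /=; cont.
have -> : A = \bigcup_(z in A) ray z @` [set t : RR | 0 <= t <= 1].
  apply/seteqP; split => [z Az|_ [z Az [t tI <-]]]; last exact: st.
  exists z => //; exists 1; first by rewrite /= ler01 lexx.
  by case: z {Az} => z1 z2; rewrite /ray /= !mul1r !subrKC.
apply: bigcup_connected.
  exists c => z Az; exists 0; first by rewrite /= lexx ler01.
  by rewrite /ray !mul0r !addr0; case: (c).
move=> z Az; apply: connected_continuous_connected.
  exact: connected_segment.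
exact: continuous_subspaceT.
Qed.

Lemma near_fst (X Y : topologicalType) (x : X * Y) (H : set X) :
  nbhs x.1 H -> \forall z \near x, H z.1.
Proof.
move=> Hx; exists (H, setT) => /=; first by split => //; exact: filterT.
by move=> [u q] [].
Qed.

Lemma near_snd (X Y : topologicalType) (x : X * Y) (H : set Y) :
  nbhs x.2 H -> \forall z \near x, H z.2.
Proof.
move=> Hx; exists (setT, H) => /=; first by split => //; exact: filterT.
by move=> [u q] [].
Qed.

Section planar_lifts.
Variables (T : topologicalType) (D : sys T) (B : set T).
Hypothesis gD : good D B.

(** Two liftings: along the bottom edge, seen as an interval over the single point [c], and then
    along the verticals. *)
Lemma region_lift (g : RR * RR -> T) (a b c : RR) (E : set (RR * RR)) :
  a <= b ->
  (forall z, E z -> B (g z)) -> (forall z, E z -> cwithin g E z) ->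
  (forall z, E z -> a <= z.1 <= b /\ c <= z.2) ->
  (forall x t s, E (x, t) -> c <= s <= t -> E (x, s)) ->
  (forall x, a <= x <= b -> E (x, c)) ->
  exists w, compat D g E w.
Proof.
move=> ab EB cg Ebnd Edown Ec.
pose E1 := [set z : RR * RR | z.1 = c /\ 0 <= z.2 <= b - a].
pose k1 (z : RR * RR) : RR * RR := (a + z.2, z.1).
have ck1 : continuous k1.
  by move=> z; apply: pair_continuous => /=; cont.
have E1E z : E1 z -> E (k1 z).
  by case: z => y t [/= -> /andP[t0 tb]]; apply: Ec => /=; apply/andP; split; lra.
have [|||||w1 [cw1 _]] := @product_lift T D B gD RR (g \o k1) E1 (fun=> false).
- by move=> z /E1E /EB.
- move=> z E1z; apply: (@cwithin_comp _ _ _ g k1 E) => //; last exact/cg/E1E.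
  exact/cwithin_continuous/ck1.
- move=> x t s [/= -> /andP[t0 tb]] /andP[s0 st]; split => //.
  by rewrite s0 (le_trans st tb).
- by move=> x t [_ /andP[]].
- move=> x [/= xc _] i ix; apply: filterS (filterT) => y _ [/= yc _].
  by rewrite /k1 /= xc yc.
pose k2 (x : RR) : RR * RR := (c, x - a).
have cw2 : compat D (fun x => g (x, c)) [set x | a <= x <= b] (w1 \o k2).
  apply: (@compat_ext _ D _ ((g \o k1) \o k2) _ _ (w1 \o k2)) => //.
    by move=> x _; rewrite /k1 /= subrKC.
  apply: compat_comp cw1.
    by move=> x /andP[ax xb]; split => //=; apply/andP; split; lra.
  by move=> x _; apply: cwithin_continuous; apply: pair_continuous => /=; cont.
pose k3 (z : RR * RR) : RR * RR := (z.1, c + z.2).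
have ck3 : continuous k3.
  by move=> z; apply: pair_continuous => /=; cont.
have [|||||w [cw _]] := @product_lift T D B gD RR (g \o k3) (k3 @^-1` E) (w1 \o k2).
- by move=> z /EB.
- move=> z Ez; apply: (@cwithin_comp _ _ _ g k3 E) => //; last exact: cg.
  exact/cwithin_continuous/ck3.
- move=> x t s Ext /andP[s0 st]; rewrite /preimage /k3 /=.
  by apply: Edown Ext _; rewrite /=; apply/andP; split; lra.
- by move=> x t /Ebnd [_ /=]; rewrite lerDl.
- apply: (@compat_ext _ D _ (fun x => g (x, c)) _ _ (w1 \o k2)) => //.
    by move=> x _; rewrite /k3 /= addr0.
  apply: compatS cw2 => x; rewrite /preimage /k3 /= addr0 => /Ebnd [].
  by [].
pose k4 (z : RR * RR) : RR * RR := (z.1, z.2 - c).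
exists (w \o k4); apply: (@compat_ext _ D _ ((g \o k3) \o k4) _ _ (w \o k4)) => //.
  by move=> z _; rewrite /k3 /= subrKC; case: z.
apply: compat_comp cw.
  by move=> z; rewrite /preimage /k3 /k4 /= subrKC; case: z.
by move=> z _; apply: cwithin_continuous; apply: pair_continuous => /=; cont.
Qed.

Lemma region_lift_down (g : RR * RR -> T) (a b c : RR) (E : set (RR * RR)) :
  a <= b ->
  (forall z, E z -> B (g z)) -> (forall z, E z -> cwithin g E z) ->
  (forall z, E z -> a <= z.1 <= b /\ z.2 <= c) ->
  (forall x t s, E (x, t) -> t <= s <= c -> E (x, s)) ->
  (forall x, a <= x <= b -> E (x, c)) ->
  exists w, compat D g E w.
Proof.
move=> ab EB cg Ebnd Eup Ec.
pose k (z : RR * RR) : RR * RR := (z.1, - z.2).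
have kk z : k (k z) = z by case: z => x y; rewrite /k /= opprK.
have ck : continuous k.
  by move=> z; apply: pair_continuous => /=; cont.
have [||||||w cw] := @region_lift (g \o k) a b (- c) (k @^-1` E).
- exact: ab.
- by move=> z /EB.
- move=> z Ez; apply: (@cwithin_comp _ _ _ g k E) => //; last exact: cg.
  exact/cwithin_continuous/ck.
- move=> z /Ebnd [h1 h2]; split => //; move: h2 => /=; lra.
- move=> x t s Ext /andP[s0 st]; rewrite /preimage /k /=.
  by apply: Eup Ext _; apply/andP; split => /=; lra.
- by move=> x /Ec; rewrite /preimage /k /= opprK.
exists (w \o k); apply: (@compat_ext _ D _ ((g \o k) \o k) _ _ (w \o k)) => //.
  by move=> z _ /=; rewrite kk.
apply: compat_comp cw; first by move=> z; rewrite /preimage /= kk.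
by move=> z _; exact/cwithin_continuous/ck.
Qed.

Lemma triv_transfer (X : topologicalType) (g : X -> T) (f : T -> X)
    (A : set X) (C : set T) w :
  (forall y, C y -> A (f y)) -> (forall y, C y -> g (f y) = y) ->
  (forall y, C y -> cwithin f C y) -> compat D g A w -> triv D C.
Proof.
move=> fA gf cf cw; exists (w \o f).
apply: (@compat_ext _ D _ (g \o f) _ _ (w \o f)) => //.
exact: compat_comp cw.
Qed.

End planar_lifts.

Definition rect (a b c d : RR) : set (RR * RR) :=
  [set z | a <= z.1 <= b /\ c <= z.2 <= d].

Record rect_chart (T : topologicalType) (C : set T) (f : T -> RR * RR)
    (g : RR * RR -> T) (a b c d : RR) : Prop := RectChart {
  rc_f : forall y, C y -> rect a b c d (f y);
  rc_g : forall z, rect a b c d z -> C (g z);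
  rc_fK : forall y, C y -> g (f y) = y;
  rc_gK : forall z, rect a b c d z -> f (g z) = z;
  rc_cf : forall y, C y -> cwithin f C y;
  rc_cg : forall z, rect a b c d z -> cwithin g (rect a b c d) z }.

Lemma rect_connected a b c d : a <= b -> c <= d -> connected (rect a b c d).
Proof.
move=> ab cd; apply: (@star_connected _ (a, c)).
  by split; rewrite /= lexx.
move=> [x y] t [/= /andP[xa xb] /andP[ya yb]] /andP[t0 t1].
by split => /=; apply/andP; split; nra.
Qed.

Lemma image_connected_cwithin (X T : topologicalType) (g : X -> T) (A : set X) :
  (forall z, A z -> cwithin g A z) -> connected A -> connected (g @` A).
Proof.
move=> cg cA; apply: connected_continuous_connected => //.
by apply/subspace_continuousP => z Az; exact: cg.
Qed.

(** Connected, with vanishing first cohomology with coefficients in Z/2. *)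
Definition simply (T : topologicalType) (C : set T) : Prop :=
  connected C /\ forall D : sys T, good D C -> triv D C.

Lemma rect_chart_simply (T : topologicalType) (C : set T) f g a b c d :
  a <= b -> c <= d -> rect_chart C f g a b c d -> simply C.
Proof.
move=> ab cd ch; split.
  have -> : C = g @` rect a b c d.
    apply/seteqP; split => [y Cy|_ [z Rz <-]]; last exact: rc_g ch _ Rz.
    by exists (f y); [exact: rc_f ch _ Cy | exact: rc_fK ch _ Cy].
  apply: image_connected_cwithin; last exact: rect_connected.
  exact: rc_cg ch.
move=> D gD.
have [||||||w cw] := @region_lift T D C gD g a b c (rect a b c d) => //.
- exact: rc_g ch.
- exact: rc_cg ch.
- by move=> z [h1 /andP[h2 _]].
- move=> x t s [/= h1 /andP[h2 h3]] /andP[h4 h5]; split => //=.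
  by rewrite h4 (le_trans h5 h3).
- by move=> x h; split => //=; rewrite lexx.
apply: triv_transfer cw; [exact: rc_f ch | exact: rc_fK ch | exact: rc_cf ch].
Qed.

Definition is_chart (T : topologicalType) (U : set T) (V : set (RR * RR))
    (f : T -> RR * RR) (g : RR * RR -> T) : Prop :=
  [/\ open U, open_in_half_plane V,
        [/\ f @` U `<=` V, g @` V `<=` U,
            (forall y, U y -> g (f y) = y) & (forall p, V p -> f (g p) = p)]
      & {within U, continuous f} /\ {within V, continuous g}].

Definition interior_pt (T : topologicalType) (x : T) : Prop :=
  exists U V f g, [/\ @is_chart T U V f g, U x & 0 < (f x).2].

Lemma chart_continuous (T : topologicalType) U V f g x :
  @is_chart T U V f g -> U x -> {for x, continuous f}.
Proof.
move=> [oU _ _ [cf _]] Ux; move: cf; rewrite continuous_open_subspace // => cf.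
by apply: cf; exact/mem_set.
Qed.

Lemma interior_pt_near (T : topologicalType) (x : T) :
  interior_pt x -> \forall y \near x, interior_pt y.
Proof.
move=> [U [V [f [g [ch Ux fx]]]]]; have [oU _ _ _] := ch.
have cf := chart_continuous ch Ux.
have : \forall y \near x, 0 < (f y).2.
  have h : nbhs (f x).2 [set q : RR | 0 < q] by exact: lt_nbhsr.
  exact: cf _ (near_snd h).
apply: filterS2 (open_nbhs_nbhs (conj oU Ux)) => y Uy fy.
by exists U, V, f, g.
Qed.

Lemma near_rect (x : RR * RR) (P : set (RR * RR)) : nbhs x P ->
  exists2 r : RR, 0 < r & forall r', 0 <= r' <= r ->
    rect (x.1 - r') (x.1 + r') (x.2 - r') (x.2 + r') `<=` P.
Proof.
move=> [[P1 P2] /= [/nbhs_ballP[r1 /= r10 h1] /nbhs_ballP[r2 /= r20 h2]] sub].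
have rm : 0 < Num.min r1 r2 by rewrite lt_min r10.
exists (Num.min r1 r2 / 2) => [|r' /andP[r'0 r'1] z [/andP[z1 z2] /andP[z3 z4]]].
  by rewrite divr_gt0.
have m1 : Num.min r1 r2 <= r1 by rewrite ge_min lexx.
have m2 : Num.min r1 r2 <= r2 by rewrite ge_min lexx orbT.
apply: sub; split; [apply: h1 | apply: h2];
  by rewrite /ball /= ltr_norml; apply/andP; split; lra.
Qed.

Lemma chart_rect (T : topologicalType) U V f g x (O : set T) :
  @is_chart T U V f g -> U x -> nbhs x O ->
  exists2 r : RR, 0 < r & forall r', 0 < r' <= r ->
    let c := Num.max 0 ((f x).2 - r') in
    exists C : set T, [/\ nbhs x C, C `<=` O, C `<=` U &
      rect_chart C f g ((f x).1 - r') ((f x).1 + r') c ((f x).2 + r')].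
Proof.
move=> ch Ux Ox; have [oU [W [oW VW]] [fU gV fK gK] [_ cg]] := ch.
have cf := chart_continuous ch Ux.
have Vfx : V (f x) by apply: fU; exists x.
have Wfx : W (f x) by move: Vfx; rewrite VW => -[].
have fx0 : 0 <= (f x).2 by move: Vfx; rewrite VW => -[].
have cg' z : V z -> cwithin g V z.
  by move=> Vz; move/subspace_continuousP: cg => /(_ z Vz).
have Ogf : nbhs (g (f x)) O by rewrite fK.
have [r r0 hr] := near_rect (filterI (open_nbhs_nbhs (conj oW Wfx)) (cg' _ Vfx O Ogf)).
exists r => // r' /andP[r'0 r'r] c.
have c1 : 0 <= c by rewrite le_max lexx.
have c2 : (f x).2 - r' <= c by rewrite le_max lexx orbT.
have c3 : c <= (f x).2 by rewrite ge_max fx0 /=; lra.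
pose R := rect ((f x).1 - r') ((f x).1 + r') c ((f x).2 + r').
have RV z : R z -> V z /\ O (g z).
  move=> [h1 /andP[h2 h3]].
  have [] := hr r' _ z.
  - by rewrite (ltW r'0).
  - by split => //; rewrite h3 (le_trans c2 h2).
  move=> Wz Oz; have Vz : V z by rewrite VW; split => //; exact: le_trans c1 h2.
  by split => //; exact: Oz.
exists (U `&` f @^-1` R); split.
- apply: filterI; first exact: open_nbhs_nbhs.
  have N1 : \forall y \near x, `|(f y).1 - (f x).1| < r'.
    have h : nbhs (f x).1 [set q : RR | `|q - (f x).1| < r'].
      by apply/nbhs_ballP; exists r' => //= q; rewrite /ball /= distrC.
    exact: cf _ (near_fst h).
  have N2 : \forall y \near x, `|(f y).2 - (f x).2| < r'.
    have h : nbhs (f x).2 [set q : RR | `|q - (f x).2| < r'].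
      by apply/nbhs_ballP; exists r' => //= q; rewrite /ball /= distrC.
    exact: cf _ (near_snd h).
  apply: filterS3 N1 N2 (open_nbhs_nbhs (conj oU Ux)) => y.
  rewrite !ltr_norml => /andP[h1 h2] /andP[h3 h4] Uy.
  have [_ fy0] : (W `&` half_plane) (f y) by rewrite -VW; apply: fU; exists y.
  split; first by apply/andP; split; lra.
  by rewrite /c ge_max fy0 /=; apply/andP; split; lra.
- by move=> y [Uy /RV [_]]; rewrite fK.
- by move=> y [].
- split.
  + by move=> y [].
  + move=> z Rz; have [Vz _] := RV z Rz; split; first by apply: gV; exists z.
    by rewrite /preimage /= gK.
  + by move=> y [/fK].
  + by move=> z /RV [/gK].
  + move=> y [Uy _]; apply: cwithin_continuous; exact: chart_continuous ch Uy.
  + by move=> z /RV [Vz _]; apply: cwithinS (cg' z Vz) => u /RV [].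
Qed.

Lemma simply_nbhs (T : topologicalType) : locally_half_euclidean2 T ->
  forall (x : T) (O : set T), nbhs x O ->
  exists C, [/\ nbhs x C, C `<=` O & simply C].
Proof.
move=> lT x O Ox; have [U [V [f [g [oU Ux oV h1 h2]]]]] := lT x.
have ch : is_chart U V f g by [].
have [r r0 /(_ r)] := chart_rect ch Ux Ox.
rewrite r0 lexx => /(_ isT) [C [Cx CO _ rc]]; exists C; split => //.
have fx0 : 0 <= (f x).2.
  have : V (f x) by case: h1 => fU _ _ _; apply: fU; exists x.
  by case: oV => W [_ ->] [].
apply: rect_chart_simply rc; first by lra.
by rewrite ge_max; apply/andP; split; lra.
Qed.

(** * Punctured squares *)

(** The sum of two cohomology classes; as signs do not matter in Z/2, its triviality means that the
    two classes agree. *)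
Definition sumsys (T : topologicalType) (D1 D2 : sys T) : sys T :=
  @Sys T (sidx D1 * sidx D2)%type (fun i => sdom i.1 `&` sdom i.2)
    (fun i x => slab i.1 x (+) slab i.2 x).

Lemma compat_sum (T X : topologicalType) (D1 D2 : sys T) (F : X -> T) A w1 w2 :
  compat D1 F A w1 -> compat D2 F A w2 ->
  compat (sumsys D1 D2) F A (fun x => w1 x (+) w2 x).
Proof.
move=> c1 c2 x Ax [i j] [/= ix jx].
apply: filterS2 (c1 x Ax i ix) (c2 x Ax j jx) => y h1 h2 Ay.
move: (h1 Ay) (h2 Ay).
by do 4! case: (slab _ _); case: (w1 _); case: (w1 _); case: (w2 _); case: (w2 _).
Qed.

(** Small punctured neighbourhoods carry at most one non-zero class; this bounds the number of sides
    of a point in a section from above. *)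
Definition planar_pt (T : topologicalType) (x : T) : Prop :=
  forall O, nbhs x O -> exists C, [/\ nbhs x C, C `<=` O &
    forall D1 D2, good D1 (C `\ x) -> good D2 (C `\ x) ->
      [\/ triv D1 (C `\ x), triv D2 (C `\ x) | triv (sumsys D1 D2) (C `\ x)]].

(** A class near [x] that survives in all smaller punctured neighbourhoods, like the winding number
    mod 2; it bounds the number of sides from below. *)
Definition winding_pt (T : topologicalType) (x : T) : Prop :=
  exists C Z, [/\ nbhs x C, good Z (C `\ x) &
    forall O, nbhs x O -> O `<=` C -> ~ triv Z (O `\ x)].

Section punctured_square.
Variables (T : topologicalType) (C : set T) (f : T -> RR * RR)
  (g : RR * RR -> T) (a0 b0 r : RR).
Hypothesis r0 : 0 < r.
Hypothesis rc : rect_chart C f g (a0 - r) (a0 + r) (b0 - r) (b0 + r).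
Let R := rect (a0 - r) (a0 + r) (b0 - r) (b0 + r).
Let q := g (a0, b0).
Let E1 := R `&` [set z | z.1 != a0 \/ z.2 < b0].
Let E2 := R `&` [set z | b0 < z.2].

Let Rc : R (a0, b0).
Proof. by have rp := r0; split => /=; apply/andP; split; lra. Qed.

Let g_neq z : R z -> z != (a0, b0) -> g z <> q.
Proof.
move=> Rz /eqP zn gz; apply: zn.
by rewrite -(rc_gK rc Rz) gz /q (rc_gK rc Rc).
Qed.

Let E1q z : E1 z -> (C `\ q) (g z).
Proof.
move=> [Rz h]; split; first exact: rc_g rc _ Rz.
apply: g_neq => //; apply/eqP => zE; move: h; rewrite zE /= eqxx.
by case=> //; rewrite ltxx.
Qed.

Let E2q z : E2 z -> (C `\ q) (g z).
Proof.
move=> [Rz h]; split; first exact: rc_g rc _ Rz.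
apply: g_neq => //; apply/eqP => zE; move: h; rewrite zE /=.
by rewrite ltxx.
Qed.

(** [E1] is the square slit from the centre upwards and [E2] its open upper half. They overlap in a
    left and a right quarter, on each of which two lifts differ by a constant. The left constant is
    normalised away; the remaining one, [m], is the monodromy around the puncture. *)
Lemma slit_lifts (D : sys T) : good D (C `\ q) ->
  exists w1 w2 m, [/\ compat D g E1 w1, compat D g E2 w2 &
    forall z, E1 z -> E2 z -> w1 z (+) w2 z = (a0 < z.1) && m].
Proof.
move=> gD; have rp := r0.
have [||||||w1 cw1] := @region_lift T D _ gD g (a0 - r) (a0 + r) (b0 - r) E1.
- by lra.
- exact: E1q.
- by move=> z [Rz _]; apply: cwithinS (rc_cg rc Rz) => u [].
- by move=> z [[h1 /andP[h2 _]] _].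
- move=> x t s [[/= h1 /andP[h2 h3]] h4] /andP[h5 h6]; split.
    by split => //=; rewrite h5 (le_trans h6 h3).
  case: h4 => /= h4; [by left | right; exact: le_lt_trans h6 h4].
- move=> x h; split; first by split => //=; apply/andP; split; lra.
  by right => /=; lra.
have [||||||w2 cw2] := @region_lift_down T D _ gD g (a0 - r) (a0 + r) (b0 + r) E2.
- by lra.
- exact: E2q.
- by move=> z [Rz _]; apply: cwithinS (rc_cg rc Rz) => u [].
- by move=> z [[h1 /andP[_ h2]] _].
- move=> x t s [[/= h1 /andP[h2 h3]] h4] /andP[h5 h6]; split.
    by split => //=; rewrite h6 (le_trans h2 h5).
  exact: lt_le_trans h4 h5.
- move=> x h; split; first by split => //=; apply/andP; split; lra.
  by move=> /=; lra.
pose d z := w1 z (+) w2 z.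
have side (e : RR) (A := E2 `&` [set z | 0 < e * (z.1 - a0)]) : e = 1 \/ e = -1 ->
    forall z, A z -> d z = d (a0 + e * r, b0 + r).
  move=> e1 z Az; have e2 : e * e = 1 by case: e1 => ->; rewrite ?mulr1 ?mulrN1 ?opprK.
  have AE1 : A `<=` E1.
    move=> u [[Ru u1] u2]; split => //; left; apply/eqP => ua.
    by move: u2; rewrite /= ua subrr mulr0 ltxx.
  have e3 : - 1 <= e <= 1 by case: e1 => ->; apply/andP; split; lra.
  have Ac : A (a0 + e * r, b0 + r).
    split; last by rewrite /= addrAC subrr add0r mulrA e2 mul1r.
    split; last by move=> /=; lra.
    by case/andP: e3 => e3 e4; split => /=; apply/andP; split; nra.
  apply: (@compat_eq _ D _ gD _ g A) => //.
  - by move=> u [/E2q].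
  - apply: (@star_connected _ (a0 + e * r, b0 + r)) => //.
    move=> [x y] t [[[/= /andP[x1 x2] /andP[y1 y2]] y3] /= xe] /andP[t0 t1].
    case/andP: e3 => e3 e4.
    split; first split; first by split => /=; apply/andP; split; nra.
      by move=> /=; nra.
    move=> /=.
    have -> : e * (a0 + e * r + t * (x - (a0 + e * r)) - a0) =
      (e * e) * r * (1 - t) + t * (e * (x - a0)) by ring.
    rewrite e2 mul1r; have [->|t1'] := eqVneq t 1; first by rewrite subrr mulr0 add0r mul1r.
    have : 0 < 1 - t by rewrite subr_gt0 lt_neqAle t1'.
    by move=> ?; apply: ltr_wpDr; [apply: mulr_ge0 => //; exact: ltW | exact: mulr_gt0].
  - exact: compatS AE1 cw1.
  - by apply: compatS cw2 => u [].
pose c := d (a0 + -1 * r, b0 + r).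
exists w1, (fun z => w2 z (+) c), (d (a0 + 1 * r, b0 + r) (+) c); split => //.
  exact: compat_addC.
move=> z [Rz h1] E2z; rewrite addbA -/(d z).
case: (ltgtP a0 z.1) => h /=.
- by rewrite (side 1) //; [left | split => //=; lra].
- by rewrite (side (-1)) ?addbb //; [right | split => //=; lra].
- exfalso; case: h1 => /= h1; first by move: h1; rewrite -h eqxx.
  by case: E2z => _ /= h2; lra.
Qed.

Lemma slit_triv (D : sys T) w1 w2 :
  compat D g E1 w1 -> compat D g E2 w2 ->
  (forall z, E1 z -> E2 z -> w1 z = w2 z) -> triv D (C `\ q).
Proof.
move=> c1 c2 e12.
have := @compat_glue _ D _ g E1 E2 w1 w2.
move=> /(_ _ _ e12 c1 c2) H.
apply: (@triv_transfer _ D _ g f (E1 `|` E2)); last apply: H.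
- move=> y [Cy yq]; have Ry := rc_f rc Cy.
  have yn : f y <> (a0, b0) by move=> fy; apply: yq; rewrite /= /q -fy (rc_fK rc Cy).
  case: (f y) Ry yn => z1 z2 Rz zn.
  have [z1a|z1a] := eqVneq z1 a0; last by left; split => //=; left.
  have [h|h|h] := ltgtP z2 b0.
  + by left; split => //; right.
  + by right; split.
  + by case: zn; rewrite z1a h.
- by move=> y [Cy _]; exact: rc_fK rc _ Cy.
- by move=> y [Cy _]; apply: cwithinS (rc_cf rc Cy) => u [].
- move=> z [Rz [h|h]].
    have h' : nbhs z.1 [set u : RR | u != a0] by apply: open_nbhs_nbhs; split => //; exact: open_neq.
    by apply: filterS (near_fst h') => u hu [Ru _]; split => //; left.
  have h' : nbhs z.2 [set u : RR | u < b0] by exact: lt_nbhsl.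
  by apply: filterS (near_snd h') => u hu [Ru _]; split => //; right.
- move=> z [Rz h].
  have h' : nbhs z.2 [set u : RR | b0 < u] by exact: lt_nbhsr.
  by apply: filterS (near_snd h') => u hu [Ru _]; split.
Qed.

(** The monodromy in Z/2 decides: if it is non-zero for both systems, it cancels in the sum. *)
Lemma punctured_square_class D1 D2 : good D1 (C `\ q) -> good D2 (C `\ q) ->
  [\/ triv D1 (C `\ q), triv D2 (C `\ q) | triv (sumsys D1 D2) (C `\ q)].
Proof.
move=> g1 g2.
have [w1 [w2 [m [c1 c2 e]]]] := slit_lifts g1.
have [w1' [w2' [m' [c1' c2' e']]]] := slit_lifts g2.
have flat w w' (z : RR * RR) : w (+) w' = (a0 < z.1) && false -> w = w'.
  by rewrite andbF; case: w; case: w'.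
case: m e => e; last first.
  by apply: Or31; apply: slit_triv c1 c2 _ => z h1 h2; exact: flat (e z h1 h2).
case: m' e' => e'; last first.
  by apply: Or32; apply: slit_triv c1' c2' _ => z h1 h2; exact: flat (e' z h1 h2).
apply: Or33; apply: slit_triv (compat_sum c1 c1') (compat_sum c2 c2') _ => z h1 h2.
move: (e z h1 h2) (e' z h1 h2); case: (a0 < z.1);
  by case: (w1 _); case: (w1' _); case: (w2 _); case: (w2' _).
Qed.

(** The connected double covering of the punctured disc: two discs, slit downwards and upwards,
    glued with a flip on the right half of the overlap. Only differences of labels have to be
    locally constant, so the flip is simply written into the label of one chart. *)
Definition winding_sys : sys T := @Sys T bool
  (fun i => interior C `&` [set y | (f y).1 != a0 \/
     (if i then b0 < (f y).2 else (f y).2 < b0)])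
  (fun i y => i && (a0 < (f y).1)).

Lemma winding_good : good winding_sys (interior C `\ q).
Proof.
have cf y : interior C y -> {for y, continuous f}.
  move=> iy G Gy; have Cy : C y := nbhs_singleton iy.
  by apply: filterS2 iy (rc_cf rc Cy Gy) => u Cu h; exact: h.
have N1 y : interior C y -> (f y).1 != a0 ->
    \forall u \near y, (f u).1 != a0 /\ (a0 < (f u).1) = (a0 < (f y).1).
  move=> iy ya; have [h|h|h] := ltgtP (f y).1 a0; last by rewrite h eqxx in ya.
    have h' : nbhs (f y).1 [set u : RR | u < a0] by exact: lt_nbhsl.
    have N : \forall u \near y, (f u).1 < a0 by exact: cf y iy _ (near_fst h').
    by apply: filterS N => u hu; rewrite lt_eqF // ltNge ltW //.
  have h' : nbhs (f y).1 [set u : RR | a0 < u] by exact: lt_nbhsr.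
  have N : \forall u \near y, a0 < (f u).1 by exact: cf y iy _ (near_fst h').
  by apply: filterS N => u hu; rewrite gt_eqF // hu.
split => /=.
- move=> i; rewrite openE => y [iy h]; have ii := nbhs_interior iy.
  case: h => h.
    by apply: filterS2 ii (N1 y iy h) => u iu [hu _]; split => //; left.
  case: i h => h.
    have h' : nbhs (f y).2 [set u : RR | b0 < u] by exact: lt_nbhsr.
    have N : \forall u \near y, b0 < (f u).2 by exact: cf y iy _ (near_snd h').
    by apply: filterS2 ii N => u iu hu; split => //; right.
  have h' : nbhs (f y).2 [set u : RR | u < b0] by exact: lt_nbhsl.
  have N : \forall u \near y, (f u).2 < b0 by exact: cf y iy _ (near_snd h').
  by apply: filterS2 ii N => u iu hu; split => //; right.
- move=> i j y [iy h1] [_ h2]; have [->|ij] := eqVneq i j.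
    by apply: filterS filterT => u _; rewrite !addbb.
  have ya : (f y).1 != a0.
    case: h1 => // h1; case: h2 => // h2; exfalso.
    by case: i j ij h1 h2 => -[] //= _; lra.
  by apply: filterS (N1 y iy ya) => u [_ ->].
- move=> y [iy yq]; have Cy : C y := nbhs_singleton iy.
  have yn : f y <> (a0, b0) by move=> fy; apply: yq; rewrite /= /q -fy (rc_fK rc Cy).
  have [ya|ya] := eqVneq (f y).1 a0; last by exists true; split => //; left.
  have [h|h|h] := ltgtP (f y).2 b0.
  + by exists false; split => //; right.
  + by exists true; split => //; right.
  + by case: yn; rewrite -ya -h; case: (f y).
Qed.

(** The points [(a0 - e, b0)] and [(a0 + e, b0)] are connected both above and below the puncture; a
    section would have different values at them by the first way and equal values by the second. *)
Lemma winding_nontriv O : nbhs q O -> O `<=` interior C -> ~ triv winding_sys (O `\ q).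
Proof.
move=> Oq OC [w cw]; have rp := r0.
have := rc_cg rc Rc Oq => /near_rect [k k0 /(_ (Num.min k r))] /=.
set e := Num.min k r => He.
have e0 : 0 < e by rewrite lt_min k0.
have ek : e <= k by rewrite ge_min lexx.
have er : e <= r by rewrite ge_min lexx orbT.
have {}He : rect (a0 - e) (a0 + e) (b0 - e) (b0 + e) `<=` [set z | R z /\ O (g z)].
  move=> z Rz; have Rz' : R z.
    by case: Rz => /andP[h1 h2] /andP[h3 h4]; split; apply/andP; split; lra.
  by split => //; apply: He => //; rewrite ek (ltW e0).
pose A (b : bool) := [set z : RR * RR |
  rect (a0 - e) (a0 + e) (b0 - e) (b0 + e) z /\
  (z.1 != a0 \/ (if b then b0 < z.2 else z.2 < b0))].
pose s (b : bool) : RR := if b then 1 else -1.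
have s1 b : s b = 1 \/ s b = -1 by case: b; [left | right].
have cA b : connected (A b).
  apply: (@star_connected _ (a0, b0 + s b * e)).
    split; first by split => /=; case: (s1 b) => sb; rewrite ?sb; apply/andP; split; lra.
    by right; case: b => /=; lra.
  move=> [x y] t [[/= /andP[x1 x2] /andP[y1 y2]] h] /andP[t0 t1]; split.
    by split => /=; case: (s1 b) => sb; rewrite ?sb; apply/andP; split; nra.
  have [->|tn] := eqVneq t 0.
    by rewrite /= !mul0r !addr0; right; case: (b) => /=; lra.
  have tp : 0 < t by rewrite lt_neqAle eq_sym tn.
  case: h => [h|h].
    left; rewrite /= -subr_eq0 addrAC subrr add0r mulf_neq0 // subr_eq0 //.
  by right; case: b h => /=; rewrite /s => h; nra.
have AO b z : A b z -> (O `\ q) (g z) /\ sdom (s := winding_sys) b (g z).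
  move=> [/He [Rz Oz] h]; split.
    split => //; apply: g_neq => //; apply/eqP => ze; move: h; rewrite ze /= eqxx.
    by case=> //; case: b; rewrite ltxx.
  by split; [exact: OC | rewrite /= (rc_gK rc Rz)].
have LC b z : A b z -> \forall y \near z, A b y ->
    w (g y) (+) (b && (a0 < y.1)) = w (g z) (+) (b && (a0 < z.1)).
  move=> Az; have [Oz dz] := AO b z Az; have [/He [Rz _] _] := Az.
  have h := cw _ Oz b dz.
  have cg : cwithin g (A b) z by apply: cwithinS (rc_cg rc Rz) => u [/He []].
  apply: filterS (cg _ h) => y hy Ay.
  have [Oy _] := AO b y Ay; have [/He [Ry _] _] := Ay.
  by have := hy Ay Oy; rewrite /= (rc_gK rc Ry) (rc_gK rc Rz).
have eqA b z z' : A b z -> A b z' ->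
    w (g z) (+) (b && (a0 < z.1)) = w (g z') (+) (b && (a0 < z'.1)).
  exact: (locally_constant_connected (b := fun z => w (g z) (+) (b && (a0 < z.1))) (cA b) (LC b)).
have Ap b : A b (a0 + e, b0).
  by split; [split => /=; apply/andP; split; lra | left => /=; apply/eqP; lra].
have Am b : A b (a0 - e, b0).
  by split; [split => /=; apply/andP; split; lra | left => /=; apply/eqP; lra].
have := eqA true _ _ (Ap _) (Am _); have := eqA false _ _ (Ap _) (Am _).
rewrite /= ltrDl e0 !addbF => ->.
rewrite (_ : a0 < a0 - e = false); last by apply/negbTE; rewrite -leNgt; lra.
by case: (w _).
Qed.

End punctured_square.

Lemma interior_chart (T : topologicalType) (x : T) (O : set T) : interior_pt x ->
  nbhs x O -> exists C f g a0 b0 r, [/\ 0 < r, nbhs x C, C `<=` O, g (a0, b0) = x &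
    rect_chart C f g (a0 - r) (a0 + r) (b0 - r) (b0 + r)].
Proof.
move=> [U [V [f [g [ch Ux fx]]]]] Ox.
have [r r0 /(_ (Num.min r (f x).2))] := chart_rect ch Ux Ox.
set r' := Num.min r _.
have r'0 : 0 < r' by rewrite lt_min r0.
have h1 : r' <= r by rewrite ge_min lexx.
have h2 : r' <= (f x).2 by rewrite ge_min lexx orbT.
rewrite r'0 h1 => /(_ isT) [C [Cx CO CU rc]].
exists C, f, g, (f x).1, (f x).2, r'; split => //.
  by rewrite -surjective_pairing; have [_ _ [_ _ fK _] _] := ch; exact: fK.
by rewrite max_r // ?subr_ge0 // in rc.
Qed.

Lemma interior_planar (T : topologicalType) (x : T) : interior_pt x -> planar_pt x.
Proof.
move=> ix O Ox; have [C [f [g [a0 [b0 [r [r0 Cx CO gx rc]]]]]]] := interior_chart ix Ox.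
exists C; split => // D1 D2; rewrite -gx; exact: (punctured_square_class r0 rc).
Qed.

Lemma interior_winding (T : topologicalType) (x : T) : interior_pt x -> winding_pt x.
Proof.
move=> ix; have [C [f [g [a0 [b0 [r [r0 Cx _ gx rc]]]]]]] := interior_chart ix (filterT : nbhs x setT).
exists (interior C), (winding_sys C f a0 b0); rewrite -gx; split.
- by rewrite gx; exact: nbhs_interior.
- exact: (winding_good rc).
- exact: (winding_nontriv r0 rc).
Qed.

(** * Local sections of a flow *)

Definition seg (a b : RR) : set RR := [set t | a <= t <= b].

Lemma seg_compact (a b : RR) : compact (seg a b).
Proof.
have -> : seg a b = `[a, b]%classic by apply/seteqP; split => t /=; rewrite in_itv.
exact: segment_compact.
Qed.

Lemma tube (X Y : topologicalType) (K : set Y) (P : X -> Y -> Prop) (x : X) :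
  compact K ->
  (forall t, K t -> \forall z \near (x, t), P z.1 z.2) ->
  \forall y \near x, forall t, K t -> P y t.
Proof.
move=> /compact_near_coveringP cK HP.
have H t : K t -> \forall t' \near t & y \near x, P y t'.
  move=> /HP [[A B] /= [Ax Bt] sub]; exists (B, A) => //= -[t' y] [/= h1 h2].
  by apply: (sub (y, t')); split.
exact: (cK X (nbhs x) (fun y t => P y t) _ H).
Qed.

Lemma near_dist (x d : RR) : 0 < d -> \forall y \near x, `|y - x| < d.
Proof. by move=> d0; apply/nbhs_ballP; exists d => //= y; rewrite /ball /= distrC. Qed.

Lemma real_continuousP (X : topologicalType) (f : X -> RR) x :
  (forall d : RR, 0 < d -> \forall y \near x, `|f y - f x| <= d) ->
  {for x, continuous f}.
Proof.
move=> H G /nbhs_ballP [d /= d0 sub].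
have : nbhs x (f @^-1` G).
  apply: filterS (H (d / 2) _); last by lra.
  move=> y h; apply: sub; rewrite /ball /= distrC; lra.
by [].
Qed.

Section flow.
Variables (T : topologicalType) (v : RR -> T -> T).
Hypothesis flv : is_flow v.

Lemma flow0 x : v 0 x = x. Proof. by case: flv. Qed.
Lemma flowD s t x : v (s + t) x = v s (v t x). Proof. by case: flv. Qed.
Lemma flowK t x : v (- t) (v t x) = x.
Proof. by rewrite -flowD addNr flow0. Qed.
Lemma flowNK t x : v t (v (- t) x) = x.
Proof. by rewrite -flowD subrr flow0. Qed.
Lemma flowC s t x : v s (v t x) = v t (v s x).
Proof. by rewrite -!flowD addrC. Qed.
Lemma flow_inj t x y : v t x = v t y -> x = y.
Proof. by move=> h; rewrite -(flowK t x) h flowK. Qed.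

Lemma contV (X : topologicalType) (f : X -> RR) (k : X -> T) x :
  {for x, continuous f} -> {for x, continuous k} ->
  {for x, continuous (fun u => v (f u) (k u))}.
Proof.
move=> cf ck; have [_ _ cv] := flv.
have cP := contP cf ck.
move=> G Gx; have h := cv (f x, k x) G Gx.
exact: cP _ h.
Qed.

Lemma flow_continuous t : continuous (v t).
Proof. by move=> x; apply: (contV (f := fun=> t) (k := id)); cont. Qed.

Lemma flow_near2 (x : T) (t : RR) G : nbhs (v t x) G ->
  \forall z \near (x, t), G (v z.2 z.1).
Proof.
move=> h.
have : {for (x, t), continuous (fun z : T * RR => v z.2 z.1)}.
  by apply: contV; cont.
by move=> /(_ G h).
Qed.

Lemma nonclosed_inj x : ~ closed_point v x -> forall s t, v s x = v t x -> s = t.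
Proof.
move=> ncl s t vst; apply/eqP; apply: contraPT vst => st vst; apply: ncl.
wlog lt_st : s t st vst / s < t.
  move=> H; case: (ltgtP s t) => // h; [exact: (H s t)| |by rewrite h eqxx in st].
  by apply: (H t s) => //; rewrite eq_sym.
have [sg|nsg] := pselect (singular_point v x); [by left | right; split => //].
exists (t - s); split; first by rewrite subr_gt0.
by rewrite addrC flowD -vst flowK.
Qed.

Lemma closed_point_flow t x : closed_point v (v t x) -> closed_point v x.
Proof.
have sg : singular_point v (v t x) -> singular_point v x.
  by move=> h s; apply: (@flow_inj t); rewrite flowC h.
case=> [/sg|[nsg [p [p0 vp]]]]; [by left | right; split].
  by move=> h; apply: nsg => s; rewrite flowC h.
by exists p; split => //; apply: (@flow_inj t); rewrite flowC.
Qed.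

End flow.

Section local_section.
Variables (T : topologicalType) (v : RR -> T -> T).
Hypothesis flv : is_flow v.
Hypothesis hT : hausdorff_space T.
Hypothesis cT : compact [set: T].

Lemma urysohn_points (A B : set T) : closed A -> closed B -> A `&` B = set0 ->
  exists f : T -> RR, [/\ continuous f, forall x, 0 <= f x <= 1,
    forall x, A x -> f x = 0 & forall x, B x -> f x = 1].
Proof.
move=> clA clB AB.
have nT : normal_space T := compact_normal hT cT.
have sep : @uniform_separator T A B by apply: normal_uniform_separator.
exists (Urysohn A B); split.
- exact: Urysohn_continuous.
- move=> x; have : range (@Urysohn T RR A B) (Urysohn A B x) by exists x.
  by move=> /Urysohn_range; rewrite /= in_itv.
- by move=> x Ax; apply: (Urysohn_sub0 sep); exists x.
- by move=> x Bx; apply: (Urysohn_sub1 sep); exists x.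
Qed.

Variable p : T.
Hypothesis nsp : ~ singular_point v p.

Let moving : exists2 s : RR, 0 < s & v s p <> p.
Proof.
have [t vt] : exists t, v t p <> p by apply/existsNP.
have [h|h|h] := ltgtP t 0.
- exists (- t); first by lra.
  by move=> h'; apply: vt; rewrite -{1}h' flowNK.
- by exists t.
- by case: vt; rewrite h flow0.
Qed.

(* Maximising [phi (v r y) - lam r] over a window of times [r] whose ends do
   not matter gives a function that grows at the constant speed [lam] along
   the flow. *)
Lemma local_section : exists (theta : T -> RR) (W : set T) (e : RR),
  [/\ continuous theta, open W, W p, theta p = 0 & 0 < e /\
   forall y t, W y -> `|t| <= e -> theta (v t y) = theta y + t].
Proof.
have [s s0 vs] := moving.
have cl1 (x : T) : closed [set x] by apply: compact_closed hT _; exact: compact_set1.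
have [phi [cphi phi01 phiA phiB]] :
    exists f : T -> RR, [/\ continuous f, forall x, 0 <= f x <= 1,
    forall x, ([set p] `|` [set v (s + s) p]) x -> f x = 0 &
    forall x, [set v s p] x -> f x = 1].
  apply: urysohn_points => //; first exact: closedU.
  apply/seteqP; split => // x [[-> /= h|-> /= h] //]; first exact: vs.
  by apply: vs; apply: (@flow_inj _ _ flv s); rewrite -flowD.
(* Since [lam * s = 1/8], near [p] the value of [psi] at time [s] exceeds [3/4 - 1/8], whereas near
   both ends of the window it stays below [1/4 + 1/16]. *)
pose lam : RR := 8^-1 / s.
have ls : lam * s = 8^-1 by rewrite /lam divfK // gt_eqF.
have lam0 : 0 < lam by rewrite divr_gt0 // invr_gt0.
pose psi y r := phi (v r y) - lam * r.
pose S y := [set psi y r | r in seg 0 (s + s)].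
have hS y : has_sup (S y).
  split; first by exists (psi y 0), 0 => //=; apply/andP; split; lra.
  exists 1 => _ [r /andP[r0 _] <-]; rewrite /psi.
  by have /andP[_] := phi01 (v r y); have := mulr_ge0 (ltW lam0) r0; lra.
pose m y := sup (S y).
have mub y r : 0 <= r <= s + s -> psi y r <= m y.
  by move=> h; apply: sup_upper_bound => //; exists r.
have mlub y M : (forall r, 0 <= r <= s + s -> psi y r <= M) -> m y <= M.
  move=> h; apply: ge_sup; first by case: (hS y).
  by move=> _ [r hr <-]; exact: h.
have cpv y r : {for (y, r), continuous (fun z : T * RR => phi (v z.2 z.1))}.
  move=> G Gx; have h := cphi (v r y) G Gx.
  have := flow_near2 flv h; by [].
have cm : continuous m.
  move=> y; apply: real_continuousP => d d0.
  have : \forall y' \near y, forall r, seg 0 (s + s) r ->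
      `|phi (v r y') - phi (v r y)| < d.
    apply: tube; first exact: seg_compact.
    move=> r _.
    have c2 : {for (y, r), continuous (fun z : T * RR => phi (v z.2 z.1) - phi (v z.2 y))}.
      apply: contD; first exact: cpv.
      apply: contN.
      have c3 : {for (y, r), continuous (fun z : T * RR => v z.2 y)}.
        by apply: (contV flv); cont.
      move=> G Gx; have h := cphi (v r y) G Gx; exact: c3 _ h.
    have N : \forall z \near (y, r), `|phi (v z.2 z.1) - phi (v z.2 y)
        - (phi (v r y) - phi (v r y))| < d by exact: c2 _ (near_dist _ d0).
    by apply: filterS N => z; rewrite subrr subr0.
  apply: filterS => y' hy'; rewrite ler_norml; apply/andP; split.
    suff : m y <= m y' + d by lra.
    apply: mlub => r hr; have := mub y' r hr; have := hy' r hr.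
    by rewrite ltr_norml /psi => /andP[]; lra.
  suff : m y' <= m y + d by lra.
  apply: mlub => r hr; have := mub y r hr; have := hy' r hr.
  by rewrite ltr_norml /psi => /andP[]; lra.
have low t : t = 0 \/ t = s + s -> exists2 e : RR, 0 < e &
    \forall y \near p, forall r, `|r| <= e -> phi (v (t + r) y) < 4^-1.
  move=> t0.
  have pt : phi (v t p) = 0.
    by apply: phiA; case: t0 => ->; [left; rewrite flow0 | right].
  have := near_dist 0 (_ : 0 < 4^-1 :> RR) => /(_ _) h.
  have {}h : \forall u \near phi (v t p), `|u - 0| < 4^-1.
    by rewrite pt; apply: h; rewrite invr_gt0.
  have [[A B] /= [Ap Bt] sub] := cpv p t _ h.
  move/nbhs_ballP: Bt => [d /= d0 Bd]; exists (d / 2); first by lra.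
  apply: filterS Ap => y Ay r hr.
  have Btr : B (t + r).
    by apply: Bd; rewrite /ball /= opprD addrA subrr add0r normrN; lra.
  by have := sub (y, t + r) (conj Ay Btr); rewrite /= subr0 ltr_norml => /andP[].
have [e1 e10 low1] := low 0 (or_introl erefl).
have [e2 e20 low2] := low (s + s) (or_intror erefl).
have high : \forall y \near p, 3 / 4 < phi (v s y).
  have h : nbhs (phi (v s p)) [set u : RR | 3 / 4 < u].
    by rewrite phiB //; apply: lt_nbhsr; lra.
  have h2 := cphi (v s p) _ h.
  exact: (@flow_continuous _ _ flv s) _ h2.
pose e := Num.min (s / 2) (Num.min e1 e2).
have e0 : 0 < e by rewrite !lt_min e10 e20 !andbT; lra.
have [es ee1 ee2] : [/\ e <= s / 2, e <= e1 & e <= e2].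
  by split; rewrite !ge_min lexx ?orbT.
pose W := interior [set y | (forall r, `|r| <= e1 -> phi (v (0 + r) y) < 4^-1) /\
  (forall r, `|r| <= e2 -> phi (v (s + s + r) y) < 4^-1) /\ 3 / 4 < phi (v s y)].
have oW : open W := open_interior _.
have Wp : W p by apply: filterS3 low1 low2 high => y h1 h2 h3; split.
have sW y : W y -> _ := @interior_subset _ _ y.
exists (fun y => (m y - m p) / lam), W, e; split => //.
- move=> y; apply: (@contM T (fun y => m y - m p : RR) (fun=> lam^-1)); last by cont.
  by apply: (@contD T m (fun=> - m p)); [exact: cm | cont].
- by rewrite subrr mul0r.
split => // y t Wy te; have [l1 [l2 hi]] := sW _ Wy.
have lams : 0 < lam * s by rewrite mulr_gt0.
have le8 : lam * e <= 16^-1.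
  apply: le_trans (_ : lam * (s / 2) <= _); first by rewrite ler_wpM2l // ltW.
  by rewrite mulrA ls; lra.
have psis : 3 / 4 - 8^-1 < psi y s by rewrite /psi ls; lra.
(* Times within [e] of the ends of the window lose against time [s], so moving the window by [t]
   does not change the supremum. *)
have win r : - e <= r <= e \/ s + s - e <= r <= s + s + e -> psi y r <= psi y s.
  rewrite /psi ls => -[] /andP[r1 r2].
    have := l1 r; rewrite add0r => /(_ _) h.
    have {}h : phi (v r y) < 4^-1 by apply: h; rewrite ler_norml; apply/andP; split; lra.
    have : lam * (- e) <= lam * r by rewrite ler_wpM2l // ltW.
    by rewrite mulrN; lra.
  have := l2 (r - (s + s)); rewrite subrKC => /(_ _) h.
  have {}h : phi (v r y) < 4^-1 by apply: h; rewrite ler_norml; apply/andP; split; lra.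
  have : 0 <= lam * r by rewrite mulr_ge0 ?(ltW lam0) //; lra.
  lra.
have /andP[t1 t2] : - e <= t <= e by rewrite -ler_norml.
suff -> : m (v t y) = m y + lam * t.
  by rewrite -addrA addrCA addrC mulrDl [lam * t]mulrC mulfK // gt_eqF.
have psiv r : psi (v t y) r = psi y (r + t) + lam * t.
  by rewrite /psi -flowD // mulrDr; ring.
have mid r : - e <= r <= s + s + e -> psi y r <= m y.
  move=> /andP[r1 r2].
  have ss : psi y s <= m y by apply: mub; apply/andP; split; lra.
  have [h|h] := leP 0 r; last first.
    by apply: le_trans (win r _) ss; left; apply/andP; split; lra.
  have [h'|h'] := leP r (s + s); first by apply: mub; rewrite h.
  by apply: le_trans (win r _) ss; right; apply/andP; split; lra.
apply/eqP; rewrite eq_le; apply/andP; split.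
  apply: mlub => r /andP[r1 r2]; rewrite psiv lerD2r; apply: mid.
  by apply/andP; split; lra.
suff : m y <= m (v t y) - lam * t by lra.
have mv r : t <= r <= s + s + t -> psi y r <= m (v t y) - lam * t.
  move=> /andP[r1 r2]; have := mub (v t y) (r - t).
  rewrite psiv subrK => H; suff : psi y r + lam * t <= m (v t y) by lra.
  by apply: H; apply/andP; split; lra.
apply: mlub => r /andP[r1 r2].
have ss : psi y s <= m (v t y) - lam * t by apply: mv; apply/andP; split; lra.
have [h|h] := leP t r; last first.
  by apply: le_trans (win r _) ss; left; apply/andP; split; lra.
have [h'|h'] := leP r (s + s + t); first by apply: mv; rewrite h.
by apply: le_trans (win r _) ss; right; apply/andP; split; lra.
Qed.

End local_section.

(** * Flow boxes *)

(* [lra] fails on hypotheses that are equations between sets. *)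
Ltac rlra := repeat match goal with H : @eq (set _) _ _ |- _ => clear H end; lra.

Lemma connected_bool (X : topologicalType) (A : set X) :
  (forall u : X -> bool, (forall x, A x -> \forall y \near x, A y -> u y = u x) ->
     forall x y, A x -> A y -> u x = u y) -> connected A.
Proof.
move=> H B [b Bb] [C oC BC] [K cK BK].
have := H (fun z => `[< B z >]) => /(_ _ b).
have BA : B `<=` A by rewrite BC => z [].
move=> h; apply/seteqP; split => // z Az.
suff : `[< B b >] = `[< B z >] by rewrite (asboolT Bb) => /esym /asboolP.
apply: h => //; last exact: BA.
move=> x Ax; have [Bx|nBx] := pselect (B x).
  have Cx : C x by move: Bx; rewrite BC => -[].
  apply: filterS (open_nbhs_nbhs (conj oC Cx)) => y Cy Ay.
  by rewrite !asboolT // BC.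
have nKx : (~` K) x by move=> Kx; apply: nBx; rewrite BK.
have oK : open (~` K) by exact: closed_openC.
apply: filterS (open_nbhs_nbhs (conj oK nKx)) => y nKy Ay.
by rewrite !asboolF // BK => -[].
Qed.

Lemma compat_const (T : topologicalType) (D : sys T) (O S : set T) w (i : sidx D) :
  compat D id O w -> connected S -> S `<=` O -> S `<=` sdom i ->
  forall x y, S x -> S y -> w x (+) slab i x = w y (+) slab i y.
Proof.
move=> cw cS SO Si x y Sx Sy.
apply: (locally_constant_connected (b := fun z => w z (+) slab i z) cS) => // z Sz.
by apply: filterS (cw z (SO _ Sz) i (Si _ Sz)) => u h Su; apply: h; exact: SO.
Qed.

Lemma goodS (T : topologicalType) (D : sys T) (A A' : set T) :
  A' `<=` A -> good D A -> good D A'.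
Proof. by move=> sA [h1 h2 h3]; split => // x /sA; exact: h3. Qed.

Lemma image_connected (X T : topologicalType) (g : X -> T) (A : set X) :
  continuous g -> connected A -> connected (g @` A).
Proof.
by move=> cg cA; apply: image_connected_cwithin => // z _; exact/cwithin_continuous/cg.
Qed.

Record fbox (T : topologicalType) (v : RR -> T -> T) (theta : T -> RR)
    (W : set T) (e : RR) : Prop := FBox {
  fb_cont : continuous theta;
  fb_open : open W;
  fb_gt0 : 0 < e;
  fb_eq : forall y t, W y -> `|t| <= e -> theta (v t y) = theta y + t }.

Section boxes.
Variables (T : topologicalType) (v : RR -> T -> T).
Hypothesis flv : is_flow v.
Hypothesis hT : hausdorff_space T.
Hypothesis lT : locally_half_euclidean2 T.
Variables (theta : T -> RR) (W : set T) (e : RR).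
Hypothesis fb : fbox v theta W e.

Definition xsect : set T := [set y | W y /\ theta y = 0].
Definition fproj (y : T) : T := v (- theta y) y.
Definition box (V : set T) : set T := [set y | `|theta y| < e /\ V (fproj y)].
(** Relatively open subsets of the section, expressed by openness of the flow box over them, because
    the arguments about them take place in boxes of the surface. *)
Definition ropen (V : set T) : Prop := V `<=` xsect /\ open (box V).

Local Notation N := xsect.

Lemma theta_flow x t : N x -> `|t| <= e -> theta (v t x) = t.
Proof. by move=> [Wx x0] te; rewrite (fb_eq fb) // x0 add0r. Qed.

Lemma fproj_flow x t : N x -> `|t| <= e -> fproj (v t x) = x.
Proof. by move=> Nx te; rewrite /fproj theta_flow // flowK. Qed.

Lemma fprojK y : v (theta y) (fproj y) = y.
Proof. exact: flowNK. Qed.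

Lemma fproj_id x : N x -> fproj x = x.
Proof. by move=> [_ x0]; rewrite /fproj x0 oppr0 flow0. Qed.

Lemma xsect_inj x y t : N x -> N y -> `|t| <= e -> v t x = y -> t = 0.
Proof. by move=> Nx [_ y0] te vy; move: y0; rewrite -vy theta_flow. Qed.

Lemma fproj_continuous : continuous fproj.
Proof.
move=> y; apply: (contV flv (f := fun u => - theta u) (k := fun u => u)); last by cont.
by apply: contN; exact: fb_cont fb y.
Qed.

Lemma box_flow (V : set T) x t : V `<=` N -> V x -> `|t| < e -> box V (v t x).
Proof.
move=> VN Vx te; have Nx := VN _ Vx.
by rewrite /box /= theta_flow ?fproj_flow // ltW.
Qed.

Lemma box_id (V : set T) x : V `<=` N -> V x -> box V x.
Proof.
move=> VN Vx; rewrite -(flow0 flv x); apply: box_flow => //.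
by rewrite normr0 (fb_gt0 fb).
Qed.

Lemma box_xsect (V : set T) x : box V x -> N x -> V x.
Proof. by move=> [_ +] Nx; rewrite fproj_id. Qed.

Lemma theta_lt_open (a b : RR) : open [set y | a < theta y < b].
Proof.
rewrite openE => y /andP[h1 h2].
have N1 : \forall u \near y, a < theta u.
  have h : nbhs (theta y) [set q : RR | a < q] by exact: lt_nbhsr.
  exact: fb_cont fb y _ h.
have N2 : \forall u \near y, theta u < b.
  have h : nbhs (theta y) [set q : RR | q < b] by exact: lt_nbhsl.
  exact: fb_cont fb y _ h.
by apply: filterS2 N1 N2 => u h3 h4; rewrite /= h3.
Qed.

Lemma fproj_open G : open G -> open (fproj @^-1` G).
Proof. by have /continuousP := fproj_continuous; exact. Qed.

Lemma xsect_ropen : ropen N.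
Proof.
split => //.
have -> : box N = [set y | - e < theta y < e] `&` fproj @^-1` W.
  apply/seteqP; split => y; rewrite /box /= ltr_norml; first by move=> [? []].
  move=> [h Wp]; split => //; split => //.
  have := @fb_eq _ _ _ _ _ fb (fproj y) (theta y) Wp.
  rewrite fprojK => /(_ _) H; have := H _; rewrite ler_norml.
  by case/andP: h => /ltW -> /ltW -> /(_ isT); lra.
by apply: openI; [exact: theta_lt_open | exact/fproj_open/(fb_open fb)].
Qed.

Lemma ropenI V G : ropen V -> open G -> ropen (V `&` G).
Proof.
move=> [VN oV] oG; split; first by move=> x [/VN].
have -> : box (V `&` G) = box V `&` fproj @^-1` G.
  by apply/seteqP; split => y; [move=> [h1 [h2 h3]] | move=> [[h1 h2] h3]].
by apply: openI => //; exact: fproj_open.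
Qed.

Lemma ropen_local V : (forall x, V x -> exists V', [/\ ropen V', V' x & V' `<=` V]) ->
  ropen V.
Proof.
move=> H; split; first by move=> x /H [V' [[V'N _] /V'N]].
rewrite openE => y [h /H [V' [[V'N oV'] V'y V'V]]].
have by' : box V' y by [].
by apply: filterS (open_nbhs_nbhs (conj oV' by')) => u [h1 /V'V].
Qed.

Lemma ropen_near V x : ropen V -> V x -> \forall y \near x, N y -> V y.
Proof.
move=> [VN oV] Vx; have h := box_id VN Vx.
by apply: filterS (open_nbhs_nbhs (conj oV h)) => y /box_xsect.
Qed.

Lemma ropenP V V' : ropen V -> V' `<=` V ->
  (forall x, V' x -> \forall y \near x, V y -> V' y) -> ropen V'.
Proof.
move=> rV sV H; apply: ropen_local => x V'x.
pose G := interior [set y | V y -> V' y].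
exists (V `&` G); split.
- by apply: ropenI => //; exact: open_interior.
- by split; [exact: sV | exact: H].
- by move=> y [Vy /interior_subset]; apply.
Qed.

Lemma ropenU V V' : ropen V -> ropen V' -> ropen (V `|` V').
Proof.
move=> rV rV'; apply: ropen_local => x [Vx|V'x]; [exists V | exists V'].
  by split => // y Vy; left.
by split => // y Vy; right.
Qed.

Lemma ropenD1 V p : ropen V -> ropen (V `\ p).
Proof.
move=> rV; have -> : V `\ p = V `&` ~` [set p] by [].
by apply: ropenI => //; apply: closed_openC; apply: compact_closed => //; exact: compact_set1.
Qed.

(** The section inherits local connectedness from the surface: a small connected neighbourhood
    projects along the flow to a connected part of the section. *)
Lemma ropen_component V G x : ropen V -> V x -> nbhs x G ->
  exists V', [/\ ropen V', V' x, connected V', V' `<=` V & V' `<=` G].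
Proof.
move=> rV Vx Gx; pose U := V `&` interior G.
have rU : ropen U by apply: ropenI => //; exact: open_interior.
have Ux : U x by split.
exists (connected_component U x); split.
- apply: ropen_local => z cz.
  have Uz : U z by exact: connected_component_sub cz.
  have bz := box_id rU.1 Uz.
  have [C [Cz CU [cC _]]] := simply_nbhs lT (open_nbhs_nbhs (conj rU.2 bz)).
  exists (U `&` interior C); split; first by apply: ropenI => //; exact: open_interior.
    by split.
  move=> y [Uy /interior_subset Cy].
  have := @connected_component_max _ U (fproj @` C) z.
  rewrite -(fproj_id (rU.1 _ Uz)) => /(_ _ _ _) H.
  apply: (connected_component_trans cz); rewrite -(fproj_id (rU.1 _ Uz)).
  rewrite -(fproj_id (rU.1 _ Uy)); apply: H.
  + by exists z => //; exact: nbhs_singleton Cz.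
  + by move=> _ [u /CU [_ Uu] <-].
  + exact: (image_connected fproj_continuous).
  + by exists y.
- exact: connected_component_refl.
- exact: component_connected.
- by move=> z /connected_component_sub [].
- by move=> z /connected_component_sub [_ /interior_subset].
Qed.

(** Otherwise [A] would be open and closed in the connected set [V]. *)
Lemma side_adherent (V A A' : set T) p b :
  V `<=` N -> connected V -> V p -> ropen A -> ropen A' -> A `&` A' = set0 ->
  V `\ p = A `|` A' -> A b -> forall G, nbhs p G -> exists2 a, A a & G a.
Proof.
move=> VN cV Vp rA rA' dA eA Ab G Gp; apply: contrapT => nG.
have nAp : ~ A p.
  move=> Ap; have [_ h] : (V `\ p) p by rewrite eA; left.
  exact: h.
have Vb : V b by have [] : (V `\ p) b by rewrite eA; left.
suff : `[< A b >] = `[< A p >] by rewrite asboolT // asboolF.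
apply: (locally_constant_connected (b := fun z => `[< A z >]) cV) => // x Vx.
have [Ax|nAx] := pselect (A x).
  by apply: filterS (ropen_near rA Ax) => y h /VN /h Ay; rewrite !asboolT.
have [A'x|nA'x] := pselect (A' x).
  apply: filterS (ropen_near rA' A'x) => y h /VN /h A'y; rewrite !asboolF //.
  by move=> Ay; have : (A `&` A') y by []; rewrite dA.
have xp : x = p.
  by apply: contrapT => xp; have : (V `\ p) x by []; rewrite eA => -[].
rewrite xp; apply: filterS Gp => y Gy _; rewrite !asboolF // => Ay.
by apply: nG; exists y.
Qed.

(** The winding class belonging to a partition of [V \ p] into [A] and the rest: passing the fibre
    of [p] below the section from one part to the other flips, passing it above does not. *)
Definition tip (V A : set T) (p : T) : sys T := @Sys T bool
  (fun i => box V `&` [set y | if i then fproj y <> p \/ 0 < theta y else theta y < 0])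
  (fun i y => ~~ i && `[< A (fproj y) >]).

Lemma fproj_neq_open p : open [set y | fproj y <> p].
Proof.
have -> : [set y | fproj y <> p] = fproj @^-1` (~` [set p]) by [].
by apply: fproj_open; apply: closed_openC; apply: compact_closed => //; exact: compact_set1.
Qed.

Lemma box_label (A A' : set T) y : ropen A -> ropen A' -> A `&` A' = set0 ->
  box (A `|` A') y -> \forall u \near y, `[< A (fproj u) >] = `[< A (fproj y) >].
Proof.
move=> [_ rA] [_ rA'] dA [h [Ay|A'y]].
  have by' : box A y by [].
  by apply: filterS (open_nbhs_nbhs (conj rA by')) => u [_ Au]; rewrite !asboolT.
have by' : box A' y by [].
have nA z : A' z -> ~ A z by move=> A'z Az; have : (A `&` A') z by []; rewrite dA.
apply: filterS (open_nbhs_nbhs (conj rA' by')) => u [_ A'u].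
by rewrite !asboolF //; exact: nA.
Qed.

Lemma tip_good V A A' p : ropen V -> ropen A -> ropen A' -> A `&` A' = set0 ->
  V `\ p = A `|` A' -> good (tip V A p) (box V `\ p).
Proof.
move=> rV rA rA' dA eA.
have o1 (a : RR) : open [set y | a < theta y].
  rewrite openE => y h.
  have h' : nbhs (theta y) [set q : RR | a < q] by exact: lt_nbhsr.
  exact: fb_cont fb y _ h'.
have o2 (a : RR) : open [set y | theta y < a].
  rewrite openE => y h.
  have h' : nbhs (theta y) [set q : RR | q < a] by exact: lt_nbhsl.
  exact: fb_cont fb y _ h'.
split => /=.
- move=> i; apply: openI; first exact: rV.2.
  case: i; last exact: o2.
  by apply: openU; [exact: fproj_neq_open | exact: o1].
- move=> i j y [[h Vy] h1] [_ h2]; have [->|ij] := eqVneq i j.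
    by apply: filterS filterT => u _; rewrite !addbb.
  have yp : fproj y <> p.
    case: i ij h1 => ij h1; case: j ij h2 => // _ /= h2.
      by case: h1 => // h1; exfalso; rlra.
    by case: h2 => // h2; exfalso; move: h1 => /= h1; rlra.
  have by' : box (A `|` A') y by split => //; rewrite -eA.
  by apply: filterS (box_label rA rA' dA by') => u ->.
- move=> y [[h Vy] yp]; have [h1|h1|h1] := ltgtP (theta y) 0.
  + by exists false; split.
  + by exists true; split => //; right.
  + exists true; split => //; left => py; apply: yp.
    by rewrite /= -py /fproj h1 oppr0 flow0.
Qed.

Lemma stay_near (p : T) (O : set T) : nbhs p O -> exists h : RR, [/\ 0 < h, h < e &
  \forall x \near p, forall t, seg (- h) h t -> O x /\ O (v t x)].
Proof.
move=> Op.
have h0 : nbhs (v 0 p) O by rewrite flow0.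
have [[A B] /= [Ap B0] sub] := flow_near2 flv h0.
move/nbhs_ballP: B0 => [d /= d0 Bd]; have e0 := fb_gt0 fb.
exists (Num.min (d / 2) (e / 2)).
have h1 : Num.min (d / 2) (e / 2) <= d / 2 by rewrite ge_min lexx.
have h2 : Num.min (d / 2) (e / 2) <= e / 2 by rewrite ge_min lexx orbT.
split; [by rewrite lt_min; apply/andP; split; rlra | by rlra |].
apply: filterS2 Ap Op => x Ax Ox t /andP[t1 t2]; split => //.
apply: (sub (x, t)); split => //=; apply: Bd.
by rewrite /ball /= sub0r normrN ltr_norml; apply/andP; split; rlra.
Qed.

Lemma fiber_connected x (a b : RR) : connected [set v t x | t in seg a b].
Proof.
apply: image_connected; last exact: connected_segment.
by move=> t; apply: (contV flv); cont.
Qed.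

(** The loop up over [a], across above [p], down over [b] and back below [p] has monodromy 1. The
    connected neighbourhood [V'] of [p], moved by the flow to heights [h] and [- h], makes the two
    passages across the fibre of [p]. *)
Lemma tip_nontriv V A A' p a0 b0 O : ropen V -> connected V -> V p ->
  ropen A -> ropen A' -> A `&` A' = set0 -> V `\ p = A `|` A' -> A a0 -> A' b0 ->
  nbhs p O -> O `<=` box V -> ~ triv (tip V A p) (O `\ p).
Proof.
move=> rV cV Vp rA rA' dA eA Aa0 A'b0 Op OV [w cw].
have [h [h0 he /nbhs_interior Hh]] := stay_near Op.
have [V' [rV' V'p cV' V'V V'h]] := ropen_component rV Vp Hh.
have stay x t : V' x -> seg (- h) h t -> O (v t x).
  by move=> /V'h /interior_subset h1 /h1 [].
have VN := rV.1; have V'N := rV'.1.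
have [a Aa V'a] := side_adherent VN cV Vp rA rA' dA eA Aa0 (ropen_near rV' V'p).
have dA' : A' `&` A = set0 by rewrite setIC.
have eA' : V `\ p = A' `|` A by rewrite setUC.
have [b A'b V'b] := side_adherent VN cV Vp rA' rA dA' eA' A'b0 (ropen_near rV' V'p).
have {}V'a : V' a by exact/V'a/rA.1.
have {}V'b : V' b by exact/V'b/rA'.1.
have np x : A x \/ A' x -> x <> p.
  by move=> h1; have [] : (V `\ p) x by rewrite eA.
have nh : `|- h| <= e by rewrite normrN gtr0_norm // ltW.
have nh' : `|h| <= e by rewrite gtr0_norm // ltW.
have ss t : seg (- h) h t -> `|t| <= e.
  by move=> /andP[t1 t2]; rewrite ler_norml; apply/andP; split; rlra.
have sh : seg (- h) h h by apply/andP; split; rlra.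
have sNh : seg (- h) h (- h) by apply/andP; split; rlra.
have up x : V' x -> x <> p -> w (v (- h) x) = w (v h x).
  move=> V'x xp; have Nx := V'N _ V'x.
  have := compat_const (i := true : sidx (tip V A p)) cw (fiber_connected (x := x) (a := - h) (b := h)).
  rewrite /= => /(_ _ _ (v (- h) x) (v h x)); rewrite !addbF; apply.
  + move=> _ [t ts <-]; split; first exact: stay.
    by move=> /= vt; apply: xp; rewrite -(fproj_flow Nx (ss _ ts)) vt fproj_id //; exact: VN.
  + move=> _ [t ts <-]; split; first by apply: OV; exact: stay.
    by left; rewrite fproj_flow //; exact: ss.
  + by exists (- h).
  + by exists h.
have top : w (v h a) = w (v h b).
  have := compat_const (i := true : sidx (tip V A p)) cw (image_connected (@flow_continuous _ _ flv h) cV').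
  rewrite /= => /(_ _ _ (v h a) (v h b)); rewrite !addbF; apply.
  + move=> _ [x V'x <-]; split; first exact: stay.
    move=> /= vt; have := theta_flow (V'N _ V'x) nh'; rewrite vt.
    by have [_ ->] := VN _ Vp; rlra.
  + move=> _ [x V'x <-]; split; first by apply: OV; exact: stay.
    by right; rewrite theta_flow //; exact: V'N.
  + by exists a.
  + by exists b.
have bot : w (v (- h) a) (+) true = w (v (- h) b).
  have := compat_const (i := false : sidx (tip V A p)) cw (image_connected (@flow_continuous _ _ flv (- h)) cV').
  rewrite /= => /(_ _ _ (v (- h) a) (v (- h) b)).
  rewrite !fproj_flow //; try exact: V'N.
  rewrite (asboolT Aa) asboolF ?addbF; last first.
    by move=> Ab; have : (A `&` A') b by []; rewrite dA.
  apply.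
  + move=> _ [x V'x <-]; split; first exact: stay.
    move=> /= vt; have := theta_flow (V'N _ V'x) nh; rewrite vt.
    by have [_ ->] := VN _ Vp; rlra.
  + move=> _ [x V'x <-]; split; first by apply: OV; exact: stay.
    by rewrite /= theta_flow //; [rlra | exact: V'N].
  + by exists a.
  + by exists b.
move: bot; rewrite (up a) ?(up b) ?top //; [by case: (w _) | |].
  by apply: np; right.
by apply: np; left.
Qed.

(** Three parts would yield three non-zero classes: those of [A1] and [A2], and their sum, which is
    the class of the union. *)
Lemma cut_at_most2 V A1 A2 A3 p : planar_pt p -> ropen V -> connected V -> V p ->
  ropen A1 -> ropen A2 -> ropen A3 ->
  A1 `&` A2 = set0 -> A1 `&` A3 = set0 -> A2 `&` A3 = set0 ->
  V `\ p = A1 `|` A2 `|` A3 -> A1 !=set0 -> A2 !=set0 -> A3 !=set0 -> False.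
Proof.
move=> pp rV cV Vp r1 r2 r3 d12 d13 d23 eA [x1 A1x] [x2 A2x] [x3 A3x].
have bp := box_id rV.1 Vp.
have [C [Cp CV H]] := pp _ (open_nbhs_nbhs (conj rV.2 bp)).
have CVp : C `\ p `<=` box V `\ p by move=> y [/CV].
have dU (X Y Z : set T) : X `&` Z = set0 -> Y `&` Z = set0 -> (X `|` Y) `&` Z = set0.
  by move=> h1 h2; rewrite setIUl h1 h2 setU0.
have e1 : V `\ p = A1 `|` (A2 `|` A3) by rewrite eA setUA.
have e2 : V `\ p = A2 `|` (A1 `|` A3) by rewrite eA setUA [A2 `|` A1]setUC.
have D1 : A1 `&` (A2 `|` A3) = set0 by rewrite setIC dU // setIC.
have D2 : A2 `&` (A1 `|` A3) = set0 by rewrite setIC dU // setIC.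
have D3 : (A1 `|` A2) `&` A3 = set0 by rewrite dU.
have r23 := ropenU r2 r3; have r13 := ropenU r1 r3; have r12 := ropenU r1 r2.
have [||t|t|t] := H (tip V A1 p) (tip V A2 p).
- by apply: goodS CVp (tip_good rV r1 r23 D1 e1).
- by apply: goodS CVp (tip_good rV r2 r13 D2 e2).
- by apply: (tip_nontriv rV cV Vp r1 r23 D1 e1 A1x _ Cp CV t); left; exact: A2x.
- by apply: (tip_nontriv rV cV Vp r2 r13 D2 e2 A2x _ Cp CV t); left; exact: A1x.
- apply: (tip_nontriv rV cV Vp r12 r3 D3 eA _ A3x Cp CV); first by left; exact: A1x.
  case: t => w cw; exists w => x Cx i ix.
  have := cw x Cx (i, i) (conj ix ix); apply: filterS => y h /h /=.
  have lab u : (~~ i && `[< A1 (fproj u) >]) (+) (~~ i && `[< A2 (fproj u) >]) =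
      ~~ i && `[< (A1 `|` A2) (fproj u) >].
    case: i {ix h} => //=.
    case: (asboolP (A1 _)) => a1; case: (asboolP (A2 _)) => a2 //=.
    + by have : (A1 `&` A2) (fproj u) by []; rewrite d12.
    + by rewrite asboolT //; left.
    + by rewrite asboolT //; right.
    + by rewrite asboolF // => -[].
  by rewrite !lab.
Qed.

End boxes.

(** * Cut points of a section *)

Lemma nbhsI (X : topologicalType) (x : X) (A B : set X) :
  nbhs x A -> nbhs x B -> nbhs x (A `&` B).
Proof. exact: filterI. Qed.

Section cuts.
Variables (T : topologicalType) (v : RR -> T -> T).
Hypothesis flv : is_flow v.
Hypothesis hT : hausdorff_space T.
Hypothesis lT : locally_half_euclidean2 T.
Variables (theta : T -> RR) (W : set T) (e : RR).
Hypothesis fb : fbox v theta W e.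

Local Notation N := (xsect theta W).
Local Notation fproj := (fproj v theta).
Local Notation box := (box v theta e).
Local Notation ropen := (ropen v theta W e).

Definition cuts (V A A' : set T) (p : T) : Prop :=
  [/\ ropen A, ropen A', A `&` A' = set0, V `\ p = A `|` A' & A !=set0 /\ A' !=set0].

Lemma uncut_constant V p : ropen V -> ~ (exists A A', cuts V A A' p) ->
  forall u : T -> bool,
  (forall x, (V `\ p) x -> \forall y \near x, (V `\ p) y -> u y = u x) ->
  forall x y, (V `\ p) x -> (V `\ p) y -> u x = u y.
Proof.
move=> rV nc u lcu x y Vx Vy; apply/eqP; apply: contra_notT nc => uxy.
have rVp := ropenD1 flv hT fb p rV.
pose A b := (V `\ p) `&` [set z | u z = b].
have rA b : ropen (A b).
  apply: (ropenP flv fb rVp) => [z []//|z [Vz uz]].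
  by apply: filterS (lcu z Vz) => y' h Vy'; split => //; rewrite /= h.
exists (A (u x)), (A (u y)); split => //.
- by apply/seteqP; split => // z [[_ /= h1] [_ /= h2]]; rewrite -h1 h2 eqxx in uxy.
- apply/seteqP; split => [z Vz|z [[]|[]]//].
  have [h|h] := eqVneq (u z) (u x); first by left; split.
  right; split => //=; move: h uxy.
  by case: (u z); case: (u x); case: (u y).
- by split; [exists x | exists y].
Qed.

(** The winding class is trivialised from above, down the fibres and through the section off the
    fibre of [p], and from below, up to the section. The two trivialisations differ by a locally
    constant function on [V' \ p]. If no connected neighbourhood of [p] in the section were cut by
    [p], this function would be constant and the class trivial around [p]. *)
Lemma cut_at_least2 V p : winding_pt p -> ropen V -> V p ->
  exists V' A A', [/\ ropen V', connected V', V' p, V' `<=` V & cuts V' A A' p].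
Proof.
move=> [C [Z [Cp gZ nZ]]] rV Vp; apply: contrapT => nH.
have Np := rV.1 _ Vp.
have bp := box_id flv fb rV.1 Vp.
have Op := nbhsI (nbhs_interior Cp) (open_nbhs_nbhs (conj rV.2 bp)).
have [h [h0 he Hh]] := stay_near flv fb Op.
have nh' : `|h| <= e by rewrite gtr0_norm // ltW.
have nh : `|- h| <= e by rewrite normrN.
have onp : open (~` [set p]).
  by apply: closed_openC; apply: compact_closed hT _; exact: compact_set1.
have small t : `|t| <= e -> t != 0 -> seg (- h) h t ->
    exists O, [/\ nbhs (v t p) O, O `<=` C `\ p & simply O].
  move=> te t0 ts.
  have [[Ct _] _] : (interior C `&` box V) (v t p) /\ True.
    by split => //; have [] := nbhs_singleton Hh t ts.
  have np : (~` [set p]) (v t p).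
    by move=> /= vt; move/eqP: t0; apply; apply: (xsect_inj fb Np Np te vt).
  have [Q [Qt QC sQ]] := simply_nbhs lT
    (nbhsI (Ct : nbhs _ C) (open_nbhs_nbhs (conj onp np))).
  by exists Q; split => // y /QC [].
have sh : seg (- h) h h by apply/andP; split; lra.
have sNh : seg (- h) h (- h) by apply/andP; split; lra.
have [|Q1 [Q1p Q1C [_ tO1]]] := small h nh' _ sh; first by rewrite gt_eqF.
have [|Q2 [Q2p Q2C [_ tO2]]] := small (- h) nh _ sNh; first by rewrite oppr_eq0 gt_eqF.
have {tO1}[w1 cw1] := tO1 Z (goodS Q1C gZ).
have {tO2}[w2 cw2] := tO2 Z (goodS Q2C gZ).
have N1 : nbhs p (v h @^-1` Q1) by exact: (flow_continuous flv (t := h)) Q1p.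
have N2 : nbhs p (v (- h) @^-1` Q2) by exact: (flow_continuous flv (t := - h)) Q2p.
have [V' [rV' V'p cV' V'V V'G]] := ropen_component flv lT fb rV Vp (nbhsI Hh (nbhsI N1 N2)).
have V'N := rV'.1.
have stay x t : V' x -> seg (- h) h t -> C (v t x).
  by move=> /V'G [h1 _] /h1 [_ [/interior_subset]].
have V'1 x : V' x -> Q1 (v h x) by move=> /V'G [_ []].
have V'2 x : V' x -> Q2 (v (- h) x) by move=> /V'G [_ []].
have uc : forall u : T -> bool,
  (forall x, (V' `\ p) x -> \forall y \near x, (V' `\ p) y -> u y = u x) ->
  forall x y, (V' `\ p) x -> (V' `\ p) y -> u x = u y.
  apply: uncut_constant => // -[A [A' cA]]; apply: nH.
  by exists V', A, A'.
have ss t : seg (- h) h t -> `|t| <= e.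
  by move=> /andP[t1 t2]; rewrite ler_norml; apply/andP; split; lra.
have vnp x t : V' x -> seg (- h) h t -> x <> p \/ t <> 0 -> v t x <> p.
  move=> V'x ts h1 vt.
  have t0 := xsect_inj fb (V'N _ V'x) Np (ss _ ts) vt.
  by case: h1 => // xp; apply: xp; rewrite -vt t0 flow0.
(* The second coordinate is the depth below height [h]; over [p] the descent ends just before [p]
   itself. *)
pose E1 := [set z : T * RR | V' z.1 /\ 0 <= z.2 <= h + h /\ (z.1 <> p \/ z.2 < h)].
pose F1 (z : T * RR) := v (h - z.2) z.1.
have cF1 : continuous F1.
  by move=> z; apply: (contV flv (f := fun z : T * RR => h - z.2) (k := fst)); cont.
have [|||||W1 [cW1 _]] := @product_lift T Z _ gZ T F1 E1 (w1 \o v h).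
- move=> [x t] [/= V'x [/andP[t0 t1] h1]].
  have ts : seg (- h) h (h - t) by apply/andP; split; lra.
  split; first exact: stay.
  by apply: vnp => //; case: h1 => h1; [left | right => h2; move: h1 h2 => /= h1 h2; lra].
- by move=> z _; exact/cwithin_continuous/cF1.
- move=> x t s [/= V'x [/andP[t0 t1] h1]] /andP[s0 st]; split => //=; split.
    by rewrite s0 (le_trans st t1).
  by case: h1 => h1; [left | right; exact: le_lt_trans st h1].
- by move=> x t [_ [/andP[]]].
- apply: (@compat_ext _ Z _ (id \o v h) _ _ (w1 \o v h)) => //.
    by move=> x _; rewrite /F1 /= subr0.
  apply: compat_comp cw1; first by move=> x [/V'1].
  by move=> x _; exact/cwithin_continuous/(flow_continuous flv).
pose E2 := [set z : T * RR | V' z.1 /\ 0 <= z.2 < h].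
pose F2 (z : T * RR) := v (z.2 - h) z.1.
have cF2 : continuous F2.
  by move=> z; apply: (contV flv (f := fun z : T * RR => z.2 - h) (k := fst)); cont.
have [|||||W2 [cW2 _]] := @product_lift T Z _ gZ T F2 E2 (w2 \o v (- h)).
- move=> [x t] [/= V'x /andP[t0 t1]].
  have ts : seg (- h) h (t - h) by apply/andP; split; lra.
  split; first exact: stay.
  by apply: vnp => //; right => h2; move: h2 => /= h2; lra.
- by move=> z _; exact/cwithin_continuous/cF2.
- move=> x t s [/= V'x /andP[t0 t1]] /andP[s0 st]; split => //=.
  by rewrite s0 (le_lt_trans st t1).
- by move=> x t [_ /andP[]].
- apply: (@compat_ext _ Z _ (id \o v (- h)) _ _ (w2 \o v (- h))) => //.
    by move=> x _; rewrite /F2 /= sub0r.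
  apply: compat_comp cw2; first by move=> x [/V'2].
  by move=> x _; exact/cwithin_continuous/(flow_continuous flv).
pose B' := box V' `&` [set y | - h < theta y < h].
have oB' : open B' by apply: openI; [exact: rV'.2 | exact: (theta_lt_open fb)].
have B'C y : B' y -> C y.
  move=> [[_ Vy] /andP[h1 h2]]; rewrite -(fprojK flv theta y); apply: stay => //.
  by apply/andP; split; exact: ltW.
have pc := fproj_continuous flv fb.
pose S1 := B' `&` [set y | fproj y <> p \/ 0 < theta y].
pose S2 := B' `&` [set y | theta y < 0].
pose k1 (y : T) := (fproj y, h - theta y).
pose k2 (y : T) := (fproj y, theta y + h).
have ck1 : continuous k1.
  move=> y; apply: pair_continuous => /=; first exact: pc.
  by apply: contD; cont; exact: fb_cont fb y.
have ck2 : continuous k2.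
  move=> y; apply: pair_continuous => /=; first exact: pc.
  by apply: contD; cont; exact: fb_cont fb y.
have c1 : compat Z id S1 (W1 \o k1).
  apply: (@compat_ext _ Z _ (F1 \o k1) _ _ (W1 \o k1)) => //.
    by move=> y _; rewrite /F1 /= subKr fprojK.
  apply: compat_comp cW1; last by move=> y _; exact/cwithin_continuous/ck1.
  move=> y [[[_ Vy] /andP[h1 h2]] h3]; split => //=; split.
    by apply/andP; split; lra.
  by case: h3 => h3; [left | right; lra].
have c2 : compat Z id S2 (W2 \o k2).
  apply: (@compat_ext _ Z _ (F2 \o k2) _ _ (W2 \o k2)) => //.
    by move=> y _; rewrite /F2 /= addrK fprojK.
  apply: compat_comp cW2; last by move=> y _; exact/cwithin_continuous/ck2.
  move=> y [[[_ Vy] /andP[h1 h2]] /= h3]; split => //=.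
  by apply/andP; split; lra.
pose d y := W1 (k1 y) (+) W2 (k2 y).
pose S12 := S1 `&` S2.
have S12C : forall y, S12 y -> (C `\ p) y.
  move=> y [[B'y _] [_ /= h1]]; split; first exact: B'C.
  by move=> /= yp; move: h1; rewrite yp; have [_ ->] := Np; rewrite ltxx.
have fibS x t : (V' `\ p) x -> - h < t < 0 -> S12 (v t x).
  move=> [V'x xp] /andP[t1 t2]; have Nx := V'N _ V'x.
  have te : `|t| < e by rewrite ltr_norml; apply/andP; split; lra.
  have bt := box_flow flv fb V'N V'x te.
  have tt : theta (v t x) = t by rewrite (theta_flow fb) // ltW.
  have B't : B' (v t x) by split => //; rewrite /= tt t1 /=; lra.
  split; split => //=; last by rewrite tt.
  by left; rewrite (fproj_flow flv fb) // ltW.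
have dcl y : S12 y -> \forall u \near y, S12 u -> d u = d y.
  move=> Sy; have [_ _ /(_ y (S12C y Sy)) [i iy]] := gZ.
  apply: filterS2 (c1 y Sy.1 i iy) (c2 y Sy.2 i iy) => u e1 e2 Su.
  move: (e1 Su.1) (e2 Su.2); rewrite /d /=.
  by case: (W1 _); case: (W1 _); case: (W2 _); case: (W2 _); do 2! case: (slab _ _).
have dfib x s t : (V' `\ p) x -> - h < s < 0 -> - h < t < 0 -> d (v s x) = d (v t x).
  move=> V'x hs ht.
  apply: (locally_constant_connected (b := fun r => d (v r x)) (A := [set r : RR | - h < r < 0])) => //.
    apply/connected_intervalP => a b /andP[a1 a2] /andP[b1 b2] c /andP[ac cb].
    by rewrite /= (lt_le_trans a1 ac) (le_lt_trans cb b2).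
  move=> r hr.
  have cr : {for r, continuous (fun r : RR => v r x)} by apply: (contV flv); cont.
  have N3 : \forall q \near r, S12 (v q x) -> d (v q x) = d (v r x).
    exact: cr _ (dcl _ (fibS _ _ V'x hr)).
  by apply: filterS N3 => q hq hq'; apply: hq; exact: fibS.
have hm : - h < - h / 2 < 0 by apply/andP; split; lra.
have [beta Hb] : exists beta, forall y, S12 y -> d y = beta.
  (* If [V'] is reduced to [p], the overlap is empty and any constant will do. *)
  have [[x1 Vx1]|none] := pselect (exists x, (V' `\ p) x); last first.
    exists true => y [[[[_ Vy] /andP[_ _]] h1] [_ /= h2]]; exfalso; apply: none.
    by exists (fproj y); split => //; case: h1 => //; lra.
  exists (d (v (- h / 2) x1)) => y [[[[_ Vy] /andP[t1 t2]] h1] [_ /= h2]].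
  have Vpy : (V' `\ p) (fproj y) by split => //; case: h1 => //; lra.
  rewrite -{1}(fprojK flv theta y) (dfib _ _ (- h / 2)) //; last by rewrite t1.
  apply: (uc (fun x => d (v (- h / 2) x))) => // x Vx.
  have N3 : \forall q \near x, S12 (v (- h / 2) q) -> d (v (- h / 2) q) = d (v (- h / 2) x).
    exact: (flow_continuous flv (t := - h / 2)) _ (dcl _ (fibS _ _ Vx hm)).
  by apply: filterS N3 => q hq Vq; apply: hq; exact: fibS.
apply: (nZ B').
- apply: open_nbhs_nbhs; split => //; split; first exact: (box_id flv fb V'N V'p).
  by rewrite /=; have [_ ->] := Np; apply/andP; split; lra.
- exact: B'C.
have o1 : open S1.
  apply: openI => //; apply: openU; first exact: (fproj_neq_open flv hT fb p).
  rewrite openE => y hy.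
  have h' : nbhs (theta y) [set q : RR | 0 < q] by exact: lt_nbhsr.
  exact: fb_cont fb y _ h'.
have o2 : open S2.
  apply: openI => //; rewrite openE => y hy.
  have h' : nbhs (theta y) [set q : RR | q < 0] by exact: lt_nbhsl.
  exact: fb_cont fb y _ h'.
have := @compat_glue _ Z T id S1 S2 (W1 \o k1) (fun y => W2 (k2 y) (+) beta).
move=> /(_ _ _ _ c1 (compat_addC beta c2)) H.
exists (fun x => if `[< S1 x >] then (W1 \o k1) x else W2 (k2 x) (+) beta).
apply: compatS (H _ _ _).
- move=> y [B'y yp]; have [t0|t0|t0] := ltgtP (theta y) 0.
  + by right; split.
  + by left; split => //; right.
  + left; split => //; left => py; apply: yp.
    by rewrite /= -(fprojK flv theta y) py t0 flow0.
- by move=> x S1x; apply: filterS (open_nbhs_nbhs (conj o1 S1x)) => y S1y _.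
- by move=> x S2x; apply: filterS (open_nbhs_nbhs (conj o2 S2x)) => y S2y _.
- move=> x S1x S2x; rewrite -(Hb x) // /d /=.
  by case: (W1 _); case: (W2 _).
Qed.

End cuts.

(** * Sections all of whose points have two sides *)

Definition side (T : topologicalType) (V : set T) (s : T -> T -> bool) x b :=
  (V `\ x) `&` [set y | s x y = b].

(** [s x] tells the two sides of [x] apart; which of them is called [true] is arbitrary at each
    point, and a coherent choice is made only when the order is built. *)
Record cut_space (T : topologicalType) (V : set T) (s : T -> T -> bool) : Prop := CutSpace {
  cs_conn : connected V;
  cs_lc : forall x, V x -> forall y, (V `\ x) y ->
    \forall z \near y, (V `\ x) z -> s x z = s x y;
  cs_acc : forall x, V x -> forall b G, nbhs x G -> exists2 y, side V s x b y & G y;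
  cs_side : forall x b, V x -> connected (side V s x b) }.

Section cut_spaces.
Variables (T : topologicalType) (v : RR -> T -> T).
Hypothesis flv : is_flow v.
Hypothesis hT : hausdorff_space T.
Hypothesis lT : locally_half_euclidean2 T.
Variables (theta : T -> RR) (W : set T) (e : RR).
Hypothesis fb : fbox v theta W e.

Local Notation N := (xsect theta W).
Local Notation fproj := (fproj v theta).
Local Notation box := (box v theta e).
Local Notation ropen := (ropen v theta W e).

(** The class dual to the fibre of [x]: a section of it is locally constant off that fibre and
    changes across it from [A] to the other local side. Over a [simply] set there is such a section,
    and it extends the local sides of [x] to global ones. *)
Definition jump (V V' A : set T) (x : T) : sys T := @Sys T bool
  (fun i => if i then box V `&` [set y | fproj y <> x] else box V')
  (fun i y => ~~ i && `[< A (fproj y) >]).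

Lemma jump_good V V' A A' x : ropen V -> ropen V' -> V' x -> cuts v theta W e V' A A' x ->
  good (jump V V' A x) (box V).
Proof.
move=> rV rV' V'x [rA rA' dA eA _]; split => /=.
- move=> [] /=; last exact: rV'.2.
  by apply: openI; [exact: rV.2 | exact: (fproj_neq_open flv hT fb)].
- move=> i j y h1 h2; have [->|ij] := eqVneq i j.
    by apply: filterS filterT => u _; rewrite !addbb.
  have [h3 h4] : fproj y <> x /\ box V' y by case: i j ij h1 h2 => -[] //= _ [] ? ? [].
  have by' : box (A `|` A') y.
    by case: h4 => h5 h6; split => //; rewrite -eA.
  by apply: filterS (box_label rA rA' dA by') => u ->.
- move=> y Vy; have [yx|yx] := pselect (fproj y = x); last by exists true.
  by exists false; split; [case: Vy | rewrite yx].
Qed.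

Lemma cut_function (V C V' A A' : set T) x V1 : ropen V -> C `<=` box V -> simply C ->
  ropen V1 -> V1 `<=` C -> V1 `<=` V -> V1 x ->
  ropen V' -> connected V' -> V' x -> cuts v theta W e V' A A' x ->
  exists s : T -> bool,
   (forall y, (V1 `\ x) y -> \forall z \near y, (V1 `\ x) z -> s z = s y) /\
   forall b G, nbhs x G -> exists2 y, ((V1 `\ x) `&` [set y | s y = b]) y & G y.
Proof.
move=> rV CV [_ sC] r1 V1C V1V V1x rV' cV' V'x cA.
have [rA rA' dA eA [[a0 Aa0] [b0 A'b0]]] := cA.
have [w cw] := sC _ (goodS CV (jump_good rV rV' V'x cA)).
exists w; split.
  move=> y [V1y yx].
  have := cw y (V1C _ V1y) true; rewrite /= !addbF => /(_ _) H.
  have Ny : N y by exact: r1.1.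
  have {}H : \forall z \near y, C z -> w z (+) false = w y.
    by apply: H; split; [exact/CV/V1C | rewrite /= (fproj_id flv Ny)].
  by apply: filterS H => z h [V1z _]; rewrite -h ?addbF //; exact: V1C.
have H : \forall z \near x, C z -> w z (+) `[< A (fproj z) >] = w x (+) `[< A (fproj x) >].
  by apply: (cw x (V1C _ V1x) false); exact: (box_id flv fb rV'.1).
have npx z : A z \/ A' z -> z <> x.
  by move=> h1; have [] : (V' `\ x) z by rewrite eA.
have nAx : ~ A x by move=> Ax; exact: (npx x (or_introl Ax)).
rewrite (fproj_id flv (r1.1 _ V1x)) (asboolF nAx) addbF in H.
have dA' : A' `&` A = set0 by rewrite setIC.
have eA' : V' `\ x = A' `|` A by rewrite setUC.
move=> b G Gx.
have G1 := nbhsI (nbhsI Gx H) (ropen_near flv fb r1 V1x).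
have [bw|bw] := eqVneq b (w x).
  have [y A'y [[Gy Hy] V1y]] := side_adherent flv fb rV'.1 cV' V'x rA' rA dA' eA' A'b0 G1.
  have {}V1y : V1 y by exact/V1y/rA'.1.
  exists y => //; split; first by split => //; apply: npx; right.
  have := Hy (V1C _ V1y); rewrite (fproj_id flv (r1.1 _ V1y)) asboolF ?addbF /=; first by rewrite bw.
  by move=> Ay; have : (A `&` A') y by []; rewrite dA.
have [y Ay [[Gy Hy] V1y]] := side_adherent flv fb rV'.1 cV' V'x rA rA' dA eA Aa0 G1.
have {}V1y : V1 y by exact/V1y/rA.1.
exists y => //; split; first by split => //; apply: npx; left.
have := Hy (V1C _ V1y); rewrite (fproj_id flv (r1.1 _ V1y)) asboolT //=.
by move: bw; case: b; case: (w x); case: (w y).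
Qed.

(** One [simply] neighbourhood [C] of [p] serves all points of [V], so all their sides are defined
    on the same set. A disconnected side would, together with the opposite side, give three
    parts. *)
Lemma cut_space_exists (p : T) (G : set T) : interior_pt p -> N p -> nbhs p G ->
  exists V s, [/\ ropen V, V p, V `<=` G, (forall x, V x -> interior_pt x) & cut_space V s].
Proof.
move=> ip Np Gp.
have G1 := nbhsI Gp (interior_pt_near ip).
have rN := xsect_ropen flv fb.
have [V0 [r0 V0p _ V0N V0G]] := ropen_component flv lT fb rN Np G1.
have bp := box_id flv fb r0.1 V0p.
have [C [Cp CV sC]] := simply_nbhs lT (open_nbhs_nbhs (conj r0.2 bp)).
have [V [rV Vp cV VV0 VC]] := ropen_component flv lT fb r0 V0p Cp.
have ex x : exists s : T -> bool, V x ->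
   (forall y, (V `\ x) y -> \forall z \near y, (V `\ x) z -> s z = s y) /\
   forall b G, nbhs x G -> exists2 y, ((V `\ x) `&` [set y | s y = b]) y & G y.
  have [Vx|nVx] := pselect (V x); last by exists (fun=> true).
  have ix : interior_pt x by have [] := V0G _ (VV0 _ Vx).
  have [V' [A [A' [rV' cV' V'x _ cA]]]] :=
    cut_at_least2 flv hT lT fb (interior_winding ix) r0 (VV0 _ Vx).
  have [s Hs] := cut_function r0 CV sC rV VC VV0 Vx rV' cV' V'x cA.
  by exists s.
have {ex}[s Hs] := choice ex.
exists V, s; split => //.
- by move=> x /VV0 /V0G [].
- by move=> x /VV0 /V0G [].
split => //.
- by move=> x Vx; have [] := Hs x Vx.
- by move=> x Vx b G'; have [_] := Hs x Vx; apply.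
- move=> x b Vx; have [lc acc] := Hs x Vx.
  have ix : interior_pt x by have [] := V0G _ (VV0 _ Vx).
  have rVx := ropenD1 flv hT fb x rV.
  apply: connected_bool => u lu y z [Vy sy] [Vz sz]; apply/eqP.
  apply: contraPT isT => uyz.
  pose A c := side V s x b `&` [set q | u q = c].
  have rA c : ropen (A c).
    apply: (ropenP flv fb rVx) => [q [[]]//|q [[Vq sq] uq]].
    apply: filterS2 (lc q Vq) (lu q (conj Vq sq)) => r h1 h2 Vr.
    have sr : side V s x b r by split => //; rewrite /= h1.
    by split => //; rewrite /= h2.
  have r3 : ropen (side V s x (~~ b)).
    apply: (ropenP flv fb rVx) => [q []//|q [Vq sq]].
    by apply: filterS (lc q Vq) => r h1 Vr; split => //; rewrite /= h1.
  have [q3 q3s _] := acc (~~ b) setT filterT.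
  exfalso; apply: (@cut_at_most2 _ _ flv hT lT _ _ _ fb V (A true) (A false)
    (side V s x (~~ b)) x (interior_planar ix)) => //.
  + by apply/seteqP; split => // q [[_ /= h1] [_ /= h2]]; rewrite h1 in h2.
  + apply/seteqP; split => // q [[[_ /= h1] _] [_ /= h2]].
    by move: h2; rewrite h1; case: (b).
  + apply/seteqP; split => // q [[[_ /= h1] _] [_ /= h2]].
    by move: h2; rewrite h1; case: (b).
  + apply/seteqP; split => [q Vq|q [[[[]]|[[]]]|[]]//].
    have [h|h] := eqVneq (s x q) b; last first.
      by right; split => //=; move: h; case: (s x q); case: (b).
    by left; case E : (u q); [left | right].
  + by case E : (u y); [exists y | exists z; split => //=; move: uyz; rewrite E; case: (u z)].
  + by case E : (u y); [exists z; split => //=; move: uyz; rewrite E; case: (u z) | exists y].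
  + by exists q3.
Qed.

End cut_spaces.

(** * Compactness tools *)

Lemma uncountable_itv (R : realType) : ~ countable (`]0, 1]%classic : set R).
Proof.
move=> /countable_lebesgue_measure0; rewrite lebesgue_measure_itv /= lte_fin ltr01.
by rewrite -EFinB subr0 => -[/eqP]; rewrite oner_eq0.
Qed.

Lemma zorn_minimal (T : Type) (P : set T -> Prop) (K0 : set T) : P K0 ->
  (forall F : set (set T), F !=set0 -> (forall K, F K -> P K /\ K `<=` K0) ->
     (forall K L, F K -> F L -> K `<=` L \/ L `<=` K) -> P (\bigcap_(K in F) K)) ->
  exists K, [/\ P K, K `<=` K0 & forall L, P L -> L `<=` K -> L = K].
Proof.
move=> PK0 chain.
pose X := {K : set T | P K /\ K `<=` K0}.
pose mk K (h : P K /\ K `<=` K0) : X := exist _ K h.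
pose R (K L : X) := `[< sval L `<=` sval K >].
have [||||K HK] := @Zorn X R.
- by move=> K; apply/asboolP.
- by move=> K L M /asboolP LK /asboolP KM; apply/asboolP; exact: subset_trans KM LK.
- move=> [K hK] [L hL] /asboolP /= h1 /asboolP /= h2.
  have KL : K = L by apply/seteqP; split.
  by subst L; congr exist; exact: Prop_irrelevance.
- move=> A totA; have [[K1 AK1]|none] := pselect (A !=set0); last first.
    by exists (mk K0 (conj PK0 (fun _ h => h))) => L AL; exfalso; apply: none; exists L.
  pose F := [set sval K | K in A].
  have FP : P (\bigcap_(K in F) K).
    apply: chain; first by exists (sval K1), K1.
      by move=> _ [K AK <-]; exact: (svalP K).
    move=> _ _ [K AK <-] [L AL <-].
    by have [/asboolP|/asboolP] := totA K L AK AL; [right | left].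
  have FK0 : \bigcap_(K in F) K `<=` K0.
    by move=> x Fx; have [_ h] := svalP K1; apply: h; apply: Fx; exists K1.
  exists (mk _ (conj FP FK0)) => L AL; apply/asboolP => /= x Fx.
  by apply: Fx; exists L.
exists (sval K); have [h1 h2] := svalP K; split => // L PL LK.
have LK0 : L `<=` K0 by exact: subset_trans LK h2.
by have <- : mk L (conj PL LK0) = K by apply: HK; apply/asboolP.
Qed.

Lemma finite_cover (T : topologicalType) (K : set T) (U : T -> set T) :
  compact K -> (forall x, K x -> nbhs x (U x)) ->
  exists l : seq T, (forall x, x \in l -> K x) /\
    forall y, K y -> exists2 x, x \in l & U x y.
Proof.
move=> /compact_near_coveringP cK KU.
pose F : set_system (seq T) := [set A | exists l0 : seq T, forall l : seq T, {subset l0 <= l} -> A l].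
have FF : Filter F.
  split; first by exists [::].
  - move=> A B [l1 h1] [l2 h2]; exists (l1 ++ l2) => l sl; split.
      by apply: h1 => x xl; apply: sl; rewrite mem_cat xl.
    by apply: h2 => x xl; apply: sl; rewrite mem_cat xl orbT.
  - by move=> A B AB [l0 h]; exists l0 => l /h /AB.
have [|l0 Hl0] := cK (seq T) F (fun l y => exists2 x, x \in l & K x /\ U x y) FF.
  move=> x Kx; exists (U x, [set l : seq T | x \in l]) => /=.
    split; first exact: KU.
    by exists [:: x] => l; apply; rewrite inE.
  by move=> [y l] [/= Uy xl]; exists x.
exists [seq x <- l0 | `[< K x >]]; split.
  by move=> x; rewrite mem_filter => /andP[/asboolP].
move=> y Ky; have [//|x xl [Kx Ux]] := Hl0 l0 _ y Ky.
by exists x => //; rewrite mem_filter xl andbT; apply/asboolP.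
Qed.

Lemma chain_nonempty (T : topologicalType) (F : set (set T)) :
  compact [set: T] -> F !=set0 -> (forall K, F K -> closed K /\ K !=set0) ->
  (forall K L, F K -> F L -> K `<=` L \/ L `<=` K) ->
  \bigcap_(K in F) K !=set0.
Proof.
move=> cT [K0 FK0] FK Ftot.
pose G : set_system T := [set A | exists2 K, F K & K `<=` A].
have GG : ProperFilter G.
  split; last first.
    split; first by exists K0.
    - move=> A B [K FK' KA] [L FL LB]; case: (Ftot K L FK' FL) => h.
        by exists K => // x Kx; split; [exact: KA | exact/LB/h].
      by exists L => // x Lx; split; [exact/KA/h | exact: LB].
    - by move=> A B AB [K FK' KA]; exists K => //; exact: subset_trans KA AB.
  by move=> [K /FK [_ [x Kx]] /(_ x Kx)].
have [x [_ cx]] := cT G GG (ex_intro2 _ _ K0 FK0 (fun _ _ => I)).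
exists x => K FK'; have [clK _] := FK K FK'.
by apply: clK => B Bx; apply: cx => //; exists K.
Qed.

(** A Urysohn function separates two pieces of the intersection. Its level set at 1/2 meets every
    member of the chain by connectedness, hence the intersection by compactness. *)
Lemma connected_bigcap (T : topologicalType) (F : set (set T)) :
  hausdorff_space T -> compact [set: T] -> F !=set0 ->
  (forall K, F K -> closed K /\ connected K) ->
  (forall K L, F K -> F L -> K `<=` L \/ L `<=` K) ->
  connected (\bigcap_(K in F) K).
Proof.
move=> hT cT F0 FK Ftot; set M := \bigcap_(K in F) K.
have clM : closed M by apply: closed_bigI => K /FK [].
apply: connected_bool => u lu x y Mx My; apply/eqP; apply: contraPT isT => uxy _.
pose C b := M `&` [set z | u z = b].
have clC b : closed (C b).
  have -> : C b = M `&` ~` interior [set z | M z -> u z <> b].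
    apply/seteqP; split => z [Mz h]; split => //.
      by move=> /interior_subset /(_ Mz).
    apply: contrapT => h'; apply: h.
    by apply: filterS (lu z Mz) => q hq Mq; rewrite hq.
  by apply: closedI => //; apply: open_closedC; exact: open_interior.
have dj : C (u x) `&` C (u y) = set0.
  by apply/seteqP; split => // z [[_ /= h1] [_ /= h2]]; rewrite -h1 h2 eqxx in uxy.
have [f [cf f01 fA fB]] := urysohn_points hT cT (clC (u x)) (clC (u y)) dj.
pose H := f @^-1` [set 2^-1 : RR].
have clH : closed H.
  have /continuous_closedP := cf; apply; apply: compact_closed; last exact: compact_set1.
  exact: Rhausdorff.
have [K0 FK0] := F0.
have [z Fz] : \bigcap_(K in [set K `&` H | K in F]) K !=set0.
  apply: chain_nonempty => //; first by exists (K0 `&` H), K0.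
    move=> _ [K FK' <-]; have [clK cK] := FK K FK'; split; first exact: closedI.
    have /connected_intervalP := image_connected cf cK.
    move=> /(_ 0 1 _ _ 2^-1) [].
    - by exists x; [exact: Mx | apply: fA].
    - by exists y; [exact: My | apply: fB].
    - by apply/andP; split; lra.
    - by move=> q Kq fq; exists q.
  move=> _ _ [K FK' <-] [L FL <-]; case: (Ftot K L FK' FL) => h; [left | right];
    by move=> q [/h ? ?].
have Mz : M z by move=> K FK'; have [] := Fz (K `&` H) (ex_intro2 _ _ K FK' erefl).
have [_ Hz] := Fz (K0 `&` H) (ex_intro2 _ _ K0 FK0 erefl).
have [uz|uz] := eqVneq (u z) (u x).
  by have := fA z (conj Mz uz); rewrite Hz; lra.
have : f z = 1 by apply: fB; split => //=; move: uz uxy; case: (u x); case: (u y); case: (u z).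
by rewrite Hz; lra.
Qed.

(** * The order of a section *)

Definition oitv (T : Type) (V : set T) (lt : T -> T -> Prop) (a b : T) : set T :=
  [set y | [/\ V y, lt a y & lt y b]].

(** Models an open interval of the line through its order alone; compactness and connectedness of
    closed intervals stand in for a parametrisation. *)
Record ordered (T : topologicalType) (V : set T) (lt : T -> T -> Prop) : Prop := Ordered {
  od_conn : connected V;
  od_irr : forall x, ~ lt x x;
  od_trans : forall x y z, V x -> V y -> V z -> lt x y -> lt y z -> lt x z;
  od_total : forall x y, V x -> V y -> x <> y -> lt x y \/ lt y x;
  od_ub : forall x, V x -> exists2 y, V y & lt x y;
  od_lb : forall x, V x -> exists2 y, V y & lt y x;
  od_gt : forall x y, V x -> V y -> lt x y -> \forall z \near y, V z -> lt x z;
  od_lt : forall x y, V x -> V y -> lt y x -> \forall z \near y, V z -> lt z x;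
  od_compact : forall a b, V a -> V b -> lt a b ->
    compact (a |` (b |` oitv V lt a b)) /\ connected (a |` (b |` oitv V lt a b)) }.

Section order.
Variables (T : topologicalType) (V : set T) (s : T -> T -> bool).
Hypothesis hT : hausdorff_space T.
Hypothesis cT : compact [set: T].
Hypothesis cs : cut_space V s.
Hypothesis V_lcc : forall x G, V x -> nbhs x G ->
  exists K, [/\ compact K, connected K, K `<=` V `&` G, K x &
    \forall y \near x, V y -> K y].
(** The countable chain condition for relatively open subsets of [V]. *)
Hypothesis V_countable : forall (Z : set T) (F : T -> set T),
  (forall z, Z z -> [/\ F z !=set0, F z `<=` V &
     forall y, F z y -> \forall q \near y, V q -> F z q]) ->
  (forall z z' y, Z z -> Z z' -> F z y -> F z' y -> z = z') ->
  countable Z.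

Lemma closed1 (x : T) : closed [set x].
Proof. by apply: compact_closed => //; exact: compact_set1. Qed.

Lemma near_neq (x y : T) : x <> y -> \forall z \near x, z <> y.
Proof.
move=> xy; have o : open (~` [set y]) by apply: closed_openC; exact: closed1.
exact: open_nbhs_nbhs (conj o xy).
Qed.

Lemma side_near x b y : V x -> side V s x b y -> \forall q \near y, V q -> side V s x b q.
Proof.
move=> Vx [[Vy yx] sy]; apply: filterS2 (near_neq yx) (cs_lc cs Vx (conj Vy yx)).
by move=> q qx h Vq; split => //=; rewrite h.
Qed.

(** The side of [x] containing [z] is connected, avoids [y] and has [x] in its closure, so it lies
    with [x] on one side of [y]. *)
Lemma side_nested x y z : V x -> V y -> V z -> x <> y -> z <> x ->
  s x z <> s x y -> s y z = s y x.
Proof.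
move=> Vx Vy Vz xy zx sxz.
have zy : z <> y by move=> zy; apply: sxz; rewrite zy.
have [q [[Vq qx] /= sq] hq] := cs_acc cs Vx (s x z) (cs_lc cs Vy (conj Vx xy)).
have qy : q <> y by move=> qy; apply: sxz; rewrite -sq qy.
rewrite -(hq (conj Vq qy)).
apply: (@locally_constant_connected T (side V s x (s x z)) (s y) (cs_side cs Vx)).
- move=> r [[Vr rx] /= sr].
  have ry : r <> y by move=> ry; apply: sxz; rewrite -sr ry.
  apply: filterS (cs_lc cs Vy (conj Vr ry)) => r' h [[Vr' _] /= sr'].
  by apply: h; split => // r'y; apply: sxz; rewrite -sr' r'y.
- by split.
- by split.
Qed.

(** The points that a continuum inside [A] joins to [x] form an open and closed part of [A], because
    small continua are neighbourhoods. *)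
Lemma join_in (A : set T) x y : A `<=` V -> connected A ->
  (forall q, A q -> \forall r \near q, V r -> A r) -> A x -> A y ->
  exists K, [/\ compact K, connected K, K `<=` A, K x & K y].
Proof.
move=> AV cA oA Ax Ay.
pose J z := exists K, [/\ compact K, connected K, K `<=` A, K x & K z].
suff : `[< J x >] = `[< J y >].
  rewrite asboolT; first by move=> /esym /asboolP.
  exists [set x]; split => //; [exact: compact_set1 | exact: connected1 | by move=> _ ->].
apply: (locally_constant_connected (b := fun z => `[< J z >]) cA) => // z Az.
have [K [cK conK KA Kz nK]] := V_lcc (AV _ Az) (oA z Az).
apply: filterS nK => q hq Aq; have Kq := hq (AV _ Aq).
have KA' : K `<=` A by move=> r /KA [Vr]; apply.
apply/asbool_equiv_eq; split => -[L [cL conL LA Lx Lq]].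
  exists (L `|` K); split.
  - exact: compactU.
  - by apply: connectedU => //; exists q.
  - by move=> r [/LA|/KA'].
  - by left.
  - by right.
exists (L `|` K); split.
- exact: compactU.
- by apply: connectedU => //; exists z.
- by move=> r [/LA|/KA'].
- by left.
- by right.
Qed.

(** A continuum joins [x] to [y] without passing through [z]; it also avoids all points near [z],
    and these cannot separate its points. *)
Lemma unseparated_near z x y : V z -> V x -> V y -> z <> x -> z <> y ->
  s z x = s z y -> \forall q \near z, V q -> s q x = s q y.
Proof.
move=> Vz Vx Vy zx zy sxy.
have [|||||K [cK conK KA Kx Ky]] := @join_in (side V s z (s z x)) x y.
- by move=> q [[]].
- exact: (cs_side cs).
- by move=> q; exact: side_near.
- by split => //; split => // h; apply: zx.
- by split => //; split => // h; apply: zy.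
have nKz : (~` K) z by move=> /KA [[_ h] _]; exact: h.
have oK : open (~` K) by apply: closed_openC; exact: compact_closed.
apply: filterS (open_nbhs_nbhs (conj oK nKz)) => q nKq Vq.
apply: (locally_constant_connected (b := s q) conK) => // r Kr.
have rq : r <> q by move=> rq; apply: nKq; rewrite -rq.
have Vr : V r by have [[]] := KA _ Kr.
apply: filterS (cs_lc cs Vq (conj Vr rq)) => r' h Kr'; apply: h; split.
  by have [[]] := KA _ Kr'.
by move=> r'q; apply: nKq; rewrite -r'q.
Qed.

(* In a continuum irreducible between [x] and [p], the points that do not
   separate [x] from [p] carry pairwise disjoint open dead ends, so they form
   a countable relatively open set, which must be empty. *)
Lemma separating_continuum x p : V x -> V p -> x <> p ->
  exists K, [/\ compact K, connected K, K `<=` V, K x /\ K p &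
    forall z, K z -> z <> x -> z <> p -> s z x <> s z p].
Proof.
move=> Vx Vp xp.
have [K0 [cK0 conK0 K0V K0x K0p]] : exists K, [/\ compact K, connected K, K `<=` V, K x & K p].
  apply: join_in => //; first exact: cs_conn cs.
  by move=> q _; apply: filterS filterT => r _.
have clK0 : closed K0 by exact: compact_closed.
pose P K := [/\ closed K, connected K, K x & K p].
have [|F F0 FK Ftot|K [[clK conK Kx Kp] KK0 Kmin]] := @zorn_minimal T P K0.
- by split.
- split.
  + by apply: closed_bigI => K /FK [[]].
  + by apply: connected_bigcap => // K /FK [[]].
  + by move=> K /FK [[]].
  + by move=> K /FK [[]].
have cK : compact K by apply: subclosed_compact clK cK0 KK0.
have KV : K `<=` V by exact: subset_trans KK0 K0V.
exists K; split => //.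
pose Z := K `&` [set z | [/\ z <> x, z <> p & s z x = s z p]].
suff Z0 : ~ (Z !=set0).
  by move=> z Kz zx zp szx; apply: Z0; exists z.
(* The part of [V] behind [z] as seen from both [x] and [p]; minimality of [K] keeps [K] out of
   it. *)
pose F z := side V s z (~~ s z x).
have FV z : F z `<=` V by move=> q [[]].
have KF z : Z z -> K `&` F z = set0.
  move=> [Kz [zx zp szx]]; have Vz := KV _ Kz.
  pose L := K `&` ~` F z.
  suff LK : L = K.
    by apply/seteqP; split => // q [Kq Fq]; have [] : L q by rewrite LK.
  apply: Kmin; last by move=> q [].
  split.
  + have -> : L = K `&` ~` interior [set q | V q -> F z q].
      apply/seteqP; split => q [Kq h]; split => // h'.
        by apply: h; move/interior_subset: h'; apply; exact: KV.
      by apply: h; exact: side_near Vz h'.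
    by apply: closedI => //; apply: open_closedC; exact: open_interior.
  + apply: connected_bool => u lu.
    have Lz : L z by split => // -[[_ h] _]; apply: h.
    (* Extending [u] over the dead end by its value at the exit [z] transfers connectedness from [K]
       to [L]. *)
    pose u' q := if `[< F z q >] then u z else u q.
    have H : forall q r, K q -> K r -> u' q = u' r.
      apply: locally_constant_connected conK _ => q Kq.
      have [Fq|nFq] := pselect (F z q).
        apply: filterS (side_near Vz Fq) => r h Kr.
        by rewrite /u' !asboolT //; exact/h/KV.
      have [->|/eqP qz] := eqVneq q z.
        apply: filterS (lu z Lz) => r h Kr; rewrite /u' (asboolF (proj2 Lz)).
        by case: asboolP => // nFr; apply: h; split.
      have Oq : side V s z (s z x) q.
        split; first by split => //; exact: KV.
        have [//|/eqP h] := eqVneq (s z q) (s z x).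
        case: nFq; split; first by split => //; exact: KV.
        by move: h => /=; case: (s z q); case: (s z x).
      apply: filterS2 (side_near Vz Oq) (lu q (conj Kq nFq)) => r h1 h2 Kr.
      have nFr : ~ F z r.
        move=> [_ /= Fr]; have [_ /= h3] := h1 (KV _ Kr).
        by move: Fr; rewrite h3; case: (s z x).
      by rewrite /u' (asboolF nFq) (asboolF nFr); apply: h2; split.
    move=> q r [Kq nFq] [Kr nFr]; have := H q r Kq Kr.
    by rewrite /u' !asboolF.
  + by split => // -[_ /=]; case: (s z x).
  + by split => // -[_ /=]; rewrite -szx; case: (s z x).
have cZ : countable Z.
  apply: (@V_countable Z F).
    move=> z [Kz _]; have Vz := KV _ Kz; split => //.
      by have [q Fq _] := cs_acc cs Vz (~~ s z x) filterT; exists q.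
    by move=> y; exact: side_near.
  move=> z z' y Zz Zz' [[Vy yz] /= Fy] [[_ yz'] /= Fy'].
  have [//|/eqP zz'] := eqVneq z z'; exfalso.
  have [Kz [zx zp _]] := Zz; have [Kz' [z'x z'p _]] := Zz'.
  have Vz := KV _ Kz; have Vz' := KV _ Kz'.
  have e1 : s z z' = s z x.
    have [//|/eqP h] := eqVneq (s z z') (s z x).
    have : (K `&` F z) z'; last by rewrite KF.
    split => //; split; first by split => // h'; apply: zz'.
    by move: h => /=; case: (s z z'); case: (s z x).
  have e2 : s z' z = s z' x.
    have [//|/eqP h] := eqVneq (s z' z) (s z' x).
    have : (K `&` F z') z; last by rewrite KF.
    split => //; split; first by split => // h'; apply: zz'.
    by move: h => /=; case: (s z' z); case: (s z' x).
  have : s z' y = s z' z.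
    by apply: side_nested => //; rewrite Fy e1; case: (s z x).
  by rewrite Fy' e2; case: (s z' x).
(* A Urysohn function that vanishes on [K] off [Z] and is 1 at [z0] takes all values of []0, 1]] on
   the countable set [Z]. *)
move=> [z0 Zz0].
have clKZ : closed (K `&` ~` Z).
  have -> : K `&` ~` Z = K `&` ~` interior [set q | K q -> Z q].
    apply/seteqP; split => q [Kq h]; split => // h'.
      by apply: h; move/interior_subset: h'; apply.
    apply: h; case: h' => _ [qx qp sq]; have Vq := KV _ Kq.
    apply: filterS3 (near_neq qx) (near_neq qp)
      (unseparated_near Vq Vx Vp qx qp sq) => r rx rp sr Kr.
    by split => //; split => //; exact/sr/KV.
  by apply: closedI => //; apply: open_closedC; exact: open_interior.
have dj : (K `&` ~` Z) `&` [set z0] = set0.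
  by apply/seteqP; split => // q [[_ nZq] /= qz]; apply: nZq; rewrite qz.
have [f [cf f01 fA fB]] := urysohn_points hT cT clKZ (@closed1 z0) dj.
apply: (@uncountable_itv RR).
apply: (@sub_countable _ _ _ (f @` Z)); last first.
  exact: sub_countable (card_image_le _ _) cZ.
apply: subset_card_le => t; rewrite /= in_itv /= => /andP[t0 t1].
have fx : f x = 0 by apply: fA; split => // -[_ [h _ _]]; exact: h.
have /connected_intervalP := image_connected cf conK.
move=> /(_ 0 1 _ _ t) [].
- by exists x.
- by exists z0; [case: Zz0 | exact: fB].
- by rewrite (ltW t0).
move=> q Kq fq; exists q => //; apply: contrapT => nZq.
by move: t0; rewrite -fq fA ?ltxx.
Qed.

(** There is no triod. On the continuum between [x] and [p] each inner point [z] separates these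
    two, so it has [y] either on the side of [p] or on the side of [x]. Both cases are stable under
    small changes of [z]; the first holds near [x] and the second near [p], against
    connectedness. *)
Lemma three_points x y p : V x -> V y -> V p -> x <> y -> x <> p -> y <> p ->
  s x y = s x p -> s y x = s y p -> s p x = s p y -> False.
Proof.
move=> Vx Vy Vp xy xp yp ex ey ep.
have [K [cK conK KV [Kx Kp] sepK]] := separating_continuum Vx Vp xp.
have yx : y <> x by move=> h; apply: xy.
have px : p <> x by move=> h; apply: xp.
have py : p <> y by move=> h; apply: yp.
pose u z := `[< z = x \/ z <> p /\ s z y = s z p >].
suff : u x = u p.
  rewrite /u asboolT; last by left.
  by move=> /esym /asboolP [/px|[pp _]] //; exfalso; apply: pp.
have tri (a b c : bool) : a <> c -> b <> c -> a = b by case: a; case: b; case: c.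
apply: (locally_constant_connected conK) => // z Kz; have Vz := KV _ Kz.
have [->|/eqP zx] := eqVneq z x.
  apply: filterS2 (near_neq xp) (unseparated_near Vx Vy Vp xy xp ex) => q qp h Kq.
  have e q' : K q' -> q' <> p -> s q' y = s q' p -> u q' = true.
    by move=> _ h1 h2; apply/asboolP; right.
  rewrite (e q) //; last exact/h/KV.
  by apply/esym/asboolP; left.
have [->|/eqP zp] := eqVneq z p.
  apply: filterS2 (near_neq px) (unseparated_near Vp Vx Vy px py ep) => q qx h Kq.
  have -> : u p = false by apply/asboolF => -[] // -[].
  apply/asboolF => -[] // -[qp hq]; apply: (sepK q Kq qx qp).
  by rewrite h //; exact: KV.
have zy : z <> y by move=> zy; apply: (sepK z Kz zx zp); rewrite zy.
have [h|/eqP h] := eqVneq (s z y) (s z p).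
  have -> : u z = true by apply/asboolP; right.
  apply: filterS2 (near_neq zp) (unseparated_near Vz Vy Vp zy zp h) => q qp hq Kq.
  by apply/asboolP; right; split => //; exact/hq/KV.
have hx : s z x = s z y by apply: tri h; exact: sepK.
have -> : u z = false by apply/asboolF => -[] // -[].
apply: filterS3 (near_neq zp) (near_neq zx) (unseparated_near Vz Vx Vy zx zy hx) => q qp qx hq Kq.
apply/asboolF => -[] // -[_ hq']; apply: (sepK q Kq qx qp).
by rewrite hq //; exact: KV.
Qed.

Variable o : T.
Hypothesis Vo : V o.

(** Corrects the side labels at each point against the reference point [o], so that
    [t z o = ~~ t o z] whenever [z <> o]. *)
Let c z := if `[< z = o >] then false else s z o (+) ~~ s o z.
Let t z q := s z q (+) c z.

Let t_eq z q r : t z q = t z r <-> s z q = s z r.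
Proof. by rewrite /t; case: (c z); case: (s z q); case: (s z r); split. Qed.

Let t_o z : z <> o -> t z o = ~~ t o z.
Proof.
move=> zo; rewrite /t /c (asboolF zo) (asboolT (erefl o)).
by case: (s z o); case: (s o z).
Qed.

Let t_neq z q r : t z q <> t z r <-> s z q <> s z r.
Proof. by split => h h'; apply: h; apply/t_eq. Qed.

Let t_nested x y z : V x -> V y -> V z -> x <> y -> z <> x ->
  t x z <> t x y -> t y z = t y x.
Proof. by move=> Vx Vy Vz xy zx /t_neq h; apply/t_eq; exact: side_nested. Qed.

(** If one of [x], [y] separates the other from [o], nestedness carries antisymmetry over from [o].
    If neither does, a failure would mean that [o] does not separate [x] from [y] either, and
    [three_points] applies. *)
Let t_anti x y : V x -> V y -> x <> y -> t x y = ~~ t y x.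
Proof.
move=> Vx Vy xy; have yx : y <> x by move=> h; apply: xy.
have [yo|/eqP yo] := eqVneq y o; first by rewrite yo t_o // -yo.
have [xo|/eqP xo] := eqVneq x o; first by rewrite xo t_o // negbK.
have ox : o <> x by move=> h; apply: xo.
have oy : o <> y by move=> h; apply: yo.
have nb (a b : bool) : a <> b -> a = ~~ b by case: a; case: b.
have [h1|/eqP h1] := eqVneq (t x o) (t x y).
  have [h2|/eqP h2] := eqVneq (t y o) (t y x).
    rewrite -h1 -h2 !t_o // negbK; apply/esym/nb => /t_eq h3.
    apply: (@three_points x y o) => //; first by apply/t_eq.
    by apply/t_eq.
  have e1 := t_nested Vy Vx Vo yx oy h2.
  have e2 := t_nested Vy Vo Vx yo xy (fun h => h2 (esym h)).
  by rewrite -e1 t_o // e2 -t_o // (nb _ _ h2).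
have e1 := t_nested Vx Vy Vo xy ox h1.
have e2 := t_nested Vx Vo Vy xo yx (fun h => h1 (esym h)).
by rewrite -e1 t_o // e2 -t_o // (nb _ _ h1) negbK.
Qed.

Let lt x y := x <> y /\ t x y = true.

Let lt_as x y : V x -> V y -> lt x y -> ~ lt y x.
Proof. by move=> Vx Vy [xy txy] [_ tyx]; move: (t_anti Vx Vy xy); rewrite txy tyx. Qed.

Let t_lc x y : V x -> V y -> x <> y -> \forall z \near y, V z -> x <> z /\ t x z = t x y.
Proof.
move=> Vx Vy xy; have yx : y <> x by move=> h; apply: xy.
apply: filterS2 (near_neq yx) (cs_lc cs Vx (conj Vy yx)) => z zx h Vz.
by split; [move=> h'; apply: zx | apply/t_eq; exact: h].
Qed.

Lemma cut_space_ordered : exists lt, ordered V lt.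
Proof.
exists lt.
have tr x y z : V x -> V y -> V z -> lt x y -> lt y z -> lt x z.
  move=> Vx Vy Vz ltxy [yz tyz]; have [xy txy] := ltxy.
  have yx : y <> x by move=> h; apply: xy.
  have zy : z <> y by move=> h; apply: yz.
  have xz : x <> z by move=> xz; apply: (lt_as Vx Vy ltxy); rewrite xz.
  split => //; rewrite -txy; apply: t_nested => //.
  by rewrite tyz (t_anti Vy Vx yx) txy.
split => //.
- exact: cs_conn cs.
- by move=> x [].
- move=> x y Vx Vy xy; case E : (t x y); [by left | right; split].
    by move=> h; apply: xy.
  by move: (t_anti Vx Vy xy); rewrite E; case: (t y x).
- move=> x Vx; have [y [[Vy yx] /= sy] _] := cs_acc cs Vx (true (+) c x) filterT.
  exists y => //; split; first by move=> h; apply: yx.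
  by rewrite /t sy; case: (c x).
- move=> x Vx; have [y [[Vy yx] /= sy] _] := cs_acc cs Vx (false (+) c x) filterT.
  exists y => //; split => //.
  by rewrite (t_anti Vy Vx yx) /t sy; case: (c x).
- move=> x y Vx Vy [xy txy]; apply: filterS (t_lc Vx Vy xy) => z h Vz.
  by have [xz e] := h Vz; split => //; rewrite e.
- move=> x y Vx Vy [yx tyx]; have xy : x <> y by move=> h; apply: yx.
  apply: filterS (t_lc Vx Vy xy) => z h Vz; have [xz e] := h Vz; split.
    by move=> h'; apply: xz.
  move: e; rewrite (t_anti Vx Vz xz) (t_anti Vx Vy xy) tyx.
  by case: (t z x).
move=> a b Va Vb ltab; have [ab tab] := ltab.
(* The closed interval is this continuum: a point strictly between [a] and [b] separates them and so
   lies on [K], and the inner points of [K] separate its ends. *)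
have [K [cK conK KV [Ka Kb] sepK]] := separating_continuum Va Vb ab.
suff -> : a |` (b |` oitv V lt a b) = K by [].
apply/seteqP; split => [y [->|[->|]]//|y Ky].
  move=> [Vy [ay tay] [yb tyb]]; apply: contrapT => nKy.
  have : s y a = s y b.
    apply: (locally_constant_connected conK) => // r Kr.
    have ry : r <> y by move=> ry; apply: nKy; rewrite -ry.
    apply: filterS (cs_lc cs Vy (conj (KV _ Kr) ry)) => r' h Kr'; apply: h; split.
      exact: KV.
    by move=> r'y; apply: nKy; rewrite -r'y.
  move=> /t_eq; rewrite tyb => tya.
  by move: (t_anti Va Vy ay); rewrite tay tya.
have Vy := KV _ Ky.
have [->|/eqP ya] := eqVneq y a; first by left.
have [->|/eqP yb] := eqVneq y b; first by right; left.
have /t_neq h := sepK y Ky ya yb.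
have ay : a <> y by move=> h'; apply: ya.
have by' : b <> y by move=> h'; apply: yb.
right; right; case E : (t y a).
  have E' : t y b = false by move: h; rewrite E; case: (t y b).
  exfalso; apply: (lt_as Va Vb ltab).
  apply: (tr b y a) => //; split => //.
  by rewrite (t_anti Vb Vy by') E'.
have E' : t y b = true by move: h; rewrite E; case: (t y b).
by split => //; split => //; rewrite (t_anti Va Vy ay) E.
Qed.

End order.

Lemma closed_nbhs (T : topologicalType) (x : T) (G : set T) :
  hausdorff_space T -> compact [set: T] -> nbhs x G ->
  exists U, [/\ nbhs x U, closed U & U `<=` G].
Proof.
move=> hT cT Gx.
have clG : closed (~` interior G) by apply: open_closedC; exact: open_interior.
have dj : [set x] `&` ~` interior G = set0.
  by apply/seteqP; split => // y [/= -> h]; apply: h.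
have [f [cf f01 fA fB]] := urysohn_points hT cT (@closed1 _ hT x) clG dj.
exists [set y | f y <= 2^-1]; split.
- have fx : f x = 0 by exact: fA.
  have h : nbhs (f x) [set q : RR | q < 2^-1] by apply: lt_nbhsl; rewrite fx; lra.
  have N : \forall y \near x, f y < 2^-1 by exact: cf x _ h.
  by apply: filterS N => y /ltW.
- have -> : [set y | f y <= 2^-1] = ~` [set y | 2^-1 < f y].
    apply/seteqP; split => y /=; first by rewrite leNgt => /negP.
    by move/negP; rewrite -leNgt.
  apply: open_closedC; rewrite openE => y hy.
  have h : nbhs (f y) [set q : RR | 2^-1 < q] by exact: lt_nbhsr.
  exact: cf y _ h.
- move=> y /= fy; apply: contrapT => nGy.
  by move: fy; rewrite fB; [lra | move=> /interior_subset].
Qed.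

Section ordered_sections.
Variables (T : topologicalType) (v : RR -> T -> T).
Hypothesis flv : is_flow v.
Hypothesis hT : hausdorff_space T.
Hypothesis cT : compact [set: T].
Hypothesis lT : locally_half_euclidean2 T.

Lemma ropen_lcc theta W e V x G : fbox v theta W e -> ropen v theta W e V ->
  V x -> nbhs x G ->
  exists K, [/\ compact K, connected K, K `<=` V `&` G, K x &
    \forall y \near x, V y -> K y].
Proof.
move=> fb rV Vx Gx.
have bx := box_id flv fb rV.1 Vx.
have [U [Ux clU UG]] := closed_nbhs hT cT (nbhsI Gx (open_nbhs_nbhs (conj rV.2 bx))).
have [V' [rV' V'x cV' V'V V'U]] := ropen_component flv lT fb rV Vx Ux.
have clN : closed [set y | theta y = 0].
  have -> : [set y | theta y = 0] = ~` [set y | theta y != 0].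
    apply/seteqP; split => y /=; first by move=> ->; rewrite eqxx.
    by move/negP; rewrite negbK => /eqP.
  apply: open_closedC; rewrite openE => y /= hy.
  have h : nbhs (theta y) [set q : RR | q != 0] by apply: open_nbhs_nbhs; split => //; exact: open_neq.
  exact: fb_cont fb y _ h.
have clV' : closure V' `<=` V `&` G.
  move=> y cy.
  have Uy : U y by apply: clU; exact: closureS cy.
  have [Gy [_ Vy]] := UG _ Uy.
  have ty : theta y = 0.
    by apply: clN; apply: closureS cy => z /rV'.1 [].
  by split => //; move: Vy; rewrite /fproj ty oppr0 flow0.
exists (closure V'); split => //.
- by apply: subclosed_compact cT _ => //; exact: closed_closure.
- exact: connected_closure.
- exact: subset_closure.
- apply: filterS (ropen_near flv fb rV' V'x) => y h Vy.
  by apply: subset_closure; apply: h; exact: rV.1.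
Qed.

(** Each of the disjoint pieces contains the projection of a point with rational chart
    coordinates. *)
Lemma ropen_countable theta W e V C f g (a b c d : RR) : a < b -> c < d ->
  fbox v theta W e -> ropen v theta W e V ->
  rect_chart C f g a b c d -> V `<=` interior C ->
  forall (Z : set T) (F : T -> set T),
  (forall z, Z z -> [/\ F z !=set0, F z `<=` V &
     forall y, F z y -> \forall q \near y, V q -> F z q]) ->
  (forall z z' y, Z z -> Z z' -> F z y -> F z' y -> z = z') ->
  countable Z.
Proof.
move=> ab cd fb rV rc VC Z F HF Finj.
have dense (l u x r : RR) : l < u -> l <= x <= u -> 0 < r ->
    exists q : rat, l <= ratr q <= u /\ x - r <= ratr q <= x + r.
  move=> lu /andP[lx xu] r0.
  have h : Num.max l (x - r) < Num.min u (x + r).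
    by rewrite gt_max !lt_min; apply/andP; split; apply/andP; split; lra.
  have [q] := rat_in_itvoo h; rewrite in_itv /= gt_max lt_min.
  move=> /andP[/andP[q1 q2] /andP[q3 q4]]; exists q; split; apply/andP; split; exact: ltW.
have ex z : exists q : rat * rat, Z z ->
    F z (fproj v theta (g (ratr q.1, ratr q.2))).
  have [Zz|] := pselect (Z z); last by exists (0, 0).
  have [[y Fy] FV Fo] := HF z Zz.
  have rF : ropen v theta W e (F z) by exact: (ropenP flv fb rV FV Fo).
  have bF := box_id flv fb rF.1 Fy.
  have iy := VC _ (FV _ Fy); have Cy : C y := interior_subset iy.
  have Ry := rc_f rc Cy.
  have N : nbhs (g (f y)) (box v theta e (F z)).
    by rewrite (rc_fK rc Cy); apply: open_nbhs_nbhs; split; [exact: rF.2|].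
  have [r r0 /(_ r)] := near_rect (rc_cg rc Ry N).
  rewrite (ltW r0) lexx => /(_ isT) H.
  have [q1 [h1 h2]] := dense a b (f y).1 r ab Ry.1 r0.
  have [q2 [h3 h4]] := dense c d (f y).2 r cd Ry.2 r0.
  by exists (q1, q2) => _; have [_] := H (ratr q1, ratr q2) (conj h2 h4) (conj h1 h3).
have [i Hi] := choice ex.
apply/countable_injP; exists (fun z => pickle (i z)).
move=> z z' /set_mem Zz /set_mem Zz' /(pcan_inj pickleK) ii.
by apply: (Finj z z' _ Zz Zz' (Hi z Zz)); rewrite ii; exact: Hi.
Qed.

Lemma ordered_section (p : T) (G : set T) : interior_pt p -> ~ singular_point v p ->
  nbhs p G -> exists theta W e V lt,
  [/\ fbox v theta W e, ropen v theta W e V, V p, V `<=` G & ordered V lt].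
Proof.
move=> ip nsp Gp.
have [theta [W [e [cth oW Wp tp [e0 he]]]]] := local_section flv hT cT nsp.
have fb : fbox v theta W e by [].
have [C [f [g [a0 [b0 [r [r0 Cp CG _ rc]]]]]]] := interior_chart ip Gp.
have Np : xsect theta W p by [].
have [V [s [rV Vp VC _ cs]]] :=
  cut_space_exists flv hT lT fb ip Np (nbhs_interior Cp).
have ab : a0 - r < a0 + r by lra.
have cd : b0 - r < b0 + r by lra.
have [lt olt] := cut_space_ordered hT cT cs
  (fun x G => @ropen_lcc theta W e V x G fb rV)
  (ropen_countable ab cd fb rV rc VC) Vp.
exists theta, W, e, V, lt; split => //.
by move=> x /VC /interior_subset /CG.
Qed.

End ordered_sections.

(** * Poisson stable flows *)

Section recurrence.
Variables (T : topologicalType) (v : RR -> T -> T).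
Hypothesis flv : is_flow v.

Definition returns (x : T) : Prop :=
  forall G, nbhs x G -> forall n : RR, exists2 t, n < t & G (v t x).

Lemma omega_returns x : omega_limit v x x -> returns x.
Proof.
move=> ox G Gx n; have [_ [[t nt <-] Gt]] := ox n I G Gx.
by exists t.
Qed.

Lemma alpha_returns x : alpha_limit v x x ->
  forall G, nbhs x G -> forall n : RR, exists2 t, t < n & G (v t x).
Proof.
move=> ox G Gx n; have [_ [[t nt <-] Gt]] := ox n I G Gx.
by exists t.
Qed.

Lemma returns_flow s x : returns x -> returns (v s x).
Proof.
move=> rx G Gx n.
have Gx' : nbhs x (v s @^-1` G) by exact: (flow_continuous flv (t := s)) _ Gx.
by have [t nt Gt] := rx _ Gx' n; exists t => //; rewrite flowC.
Qed.

(* Along the boundary circle of the surface an injective orbit arc fills a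
   neighbourhood, so an orbit that comes back must close up. *)
Lemma recurrent_interior x : locally_half_euclidean2 T -> ~ closed_point v x ->
  (forall G, nbhs x G -> exists2 t : RR, 1 < `|t| & G (v t x)) ->
  exists s, interior_pt (v s x).
Proof.
move=> lT ncl rx; apply: contrapT => nint.
have inj := nonclosed_inj flv ncl.
have [U [V [f [g [oU Ux oV h1 h2]]]]] := lT x.
have ch : is_chart U V f g by [].
have f2 t : U (v t x) -> (f (v t x)).2 = 0.
  move=> Ut; have f0 : 0 <= (f (v t x)).2.
    have : V (f (v t x)) by case: h1 => fU _ _ _; apply: fU; exists (v t x).
    by case: oV => W [_ ->] [].
  apply/eqP; rewrite eq_le f0 andbT leNgt; apply/negP => h.
  by apply: nint; exists t; exists U, V, f, g.
pose k t := (f (v t x)).1.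
have finj t s : U (v t x) -> U (v s x) -> k t = k s -> t = s.
  move=> Ut Us kts; apply: inj; case: h1 => _ _ gf _.
  rewrite -(gf _ Ut) -(gf _ Us); congr g.
  by rewrite [f (v t x)]surjective_pairing [f (v s x)]surjective_pairing !f2 // -/(k t) kts.
have cvx : continuous (fun t : RR => v t x).
  by move=> t; apply: (contV flv); cont.
(* With [d < 1] the arc over [[- d, d]] is disjoint in time from the returns, which happen at times
   of modulus above 1. *)
have [d d0 [d1 Ud]] : exists2 d : RR, 0 < d & d < 1 /\ forall t, `|t| <= d -> U (v t x).
  have N : nbhs (v 0 x) U by rewrite flow0 //; exact: open_nbhs_nbhs.
  have := cvx 0 _ N => /nbhs_ballP [d /= d0 Hd].
  exists (Num.min (d / 2) (1 / 2)); first by rewrite lt_min; apply/andP; split; lra.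
  have m1 : Num.min (d / 2) (1 / 2) <= d / 2 by rewrite ge_min lexx.
  have m2 : Num.min (d / 2) (1 / 2) <= 1 / 2 by rewrite ge_min lexx orbT.
  split; first lra.
  by move=> t td; apply: Hd; rewrite /ball /= sub0r normrN; lra.
have ck t : `|t| <= d -> {for t, continuous k}.
  move=> td G Gt.
  have N := near_fst (x := f (v t x)) Gt.
  have N2 := chart_continuous ch (Ud t td) N.
  exact: cvx t _ N2.
have ivt (a b c : RR) : - d <= a -> b <= d -> a <= b ->
    (k a <= c <= k b \/ k b <= c <= k a) -> exists2 t, a <= t <= b & k t = c.
  move=> da bd ab hc.
  have cI : connected (k @` seg a b).
    apply: image_connected_cwithin; last exact: connected_segment.
    move=> z /andP[z1 z2]; apply: cwithin_continuous; apply: ck.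
    by rewrite ler_norml; apply/andP; split; lra.
  have ka : (k @` seg a b) (k a) by exists a => //=; rewrite /seg /= lexx.
  have kb : (k @` seg a b) (k b) by exists b => //=; rewrite /seg /= lexx ab.
  move/connected_intervalP: cI => H.
  have [t ts <-] : (k @` seg a b) c.
    by case: hc => hc; [exact: H ka kb _ hc | exact: H kb ka _ hc].
  by exists t.
have d' : `|d| <= d by rewrite gtr0_norm.
have nd' : `|- d| <= d by rewrite normrN.
have z' : `|0 : RR| <= d by rewrite normr0 ltW.
have n1 : k d != k 0.
  by apply/eqP => /(finj _ _ (Ud _ d') (Ud _ z')); lra.
have n2 : k (- d) != k 0.
  by apply/eqP => /(finj _ _ (Ud _ nd') (Ud _ z')); lra.
(* As [k] is injective on [[- d, d]], it takes values on opposite sides of [k 0] at [d] and [- d];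
   hence it fills a neighbourhood of [k 0]. *)
have same c : (k 0 < c /\ c <= k d /\ c <= k (- d)) \/
    (c < k 0 /\ k d <= c /\ k (- d) <= c) -> False.
  move=> hc.
  have i1 : - d <= 0 by lra.
  have i2 : 0 <= d by lra.
  have j1 : k 0 <= c <= k d \/ k d <= c <= k 0.
    by case: hc => -[c1 [c2 c3]]; [left | right]; apply/andP; split => //; exact: ltW.
  have j2 : k (- d) <= c <= k 0 \/ k 0 <= c <= k (- d).
    by case: hc => -[c1 [c2 c3]]; [right | left]; apply/andP; split => //; exact: ltW.
  have [t /andP[t1 t2] kt] := ivt 0 d c i1 (lexx d) i2 j1.
  have [s /andP[s1 s2] ks] := ivt (- d) 0 c (lexx _) i2 i1 j2.
  have ts : t = s.
    apply: finj; try (apply: Ud; rewrite ler_norml; apply/andP; split; lra).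
    by rewrite kt ks.
  have t0 : t = 0 by lra.
  by move: kt; rewrite t0; case: hc => -[]; lra.
pose m := Num.min `|k d - k 0| `|k (- d) - k 0|.
have m0 : 0 < m by rewrite lt_min !normr_gt0 !subr_eq0 n1.
have fill c : `|c - k 0| < m -> exists2 t, `|t| <= d & k t = c.
  rewrite lt_min => /andP[].
  have sol a b : - d <= a -> b <= d -> a <= b -> (k a <= c <= k b \/ k b <= c <= k a) ->
      exists2 t, `|t| <= d & k t = c.
    move=> da bd ab hc; have [t /andP[t1 t2] kt] := ivt a b c da bd ab hc.
    by exists t => //; rewrite ler_norml; apply/andP; split; lra.
  have [h|h|h] := ltgtP (k d) (k 0); last by rewrite h eqxx in n1.
  - have [h'|h'|h'] := ltgtP (k (- d)) (k 0); last by rewrite h' eqxx in n2.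
      exfalso; apply: (same (Num.max (k d) (k (- d)))); right.
      by rewrite gt_max h h' !le_max !lexx orbT.
    rewrite (ltr0_norm (_ : k d - k 0 < 0)); last by lra.
    rewrite (gtr0_norm (_ : 0 < k (- d) - k 0)); last by lra.
    rewrite !ltr_norml => /andP[c1 c2] /andP[c3 c4].
    by apply: (sol (- d) d); try lra; right; apply/andP; split; lra.
  - have [h'|h'|h'] := ltgtP (k (- d)) (k 0); last by rewrite h' eqxx in n2.
      rewrite (gtr0_norm (_ : 0 < k d - k 0)); last by lra.
      rewrite (ltr0_norm (_ : k (- d) - k 0 < 0)); last by lra.
      rewrite !ltr_norml => /andP[c1 c2] /andP[c3 c4].
      by apply: (sol (- d) d); try lra; left; apply/andP; split; lra.
    exfalso; apply: (same (Num.min (k d) (k (- d)))); left.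
    by rewrite lt_min h h' !ge_min !lexx orbT.
have NG : nbhs x [set y | U y /\ `|(f y).1 - k 0| < m].
  have cfx := chart_continuous ch Ux.
  have h : nbhs (f x).1 [set q : RR | `|q - k 0| < m].
    have -> : (f x).1 = k 0 by rewrite /k flow0.
    by apply/nbhs_ballP; exists m => //= y; rewrite /ball /= distrC.
  have N : \forall y \near x, `|(f y).1 - k 0| < m by exact: cfx _ (near_fst h).
  by apply: filterS2 (open_nbhs_nbhs (conj oU Ux)) N.
have [t t1 [Ut kt]] := rx _ NG.
have [s sd ks] := fill (k t) kt.
have := finj _ _ (Ud s sd) Ut ks => st.
by move: t1; rewrite -st; lra.
Qed.

Lemma hit theta W e V x G : fbox v theta W e -> ropen v theta W e V -> V x ->
  returns x -> nbhs x G -> forall n : RR, exists2 t, n < t & V (v t x) /\ G (v t x).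
Proof.
move=> fb rV Vx rx Gx n.
have rU := ropenI flv fb rV (open_interior G).
have Ux : (V `&` interior G) x by split.
have bx := box_id flv fb rU.1 Ux.
(* Sliding from the box to the section changes the time by less than [e], whence [n + e]. *)
have [t nt [te [Vt Gt]]] := rx _ (open_nbhs_nbhs (conj rU.2 bx)) (n + e).
exists (t - theta (v t x)); first by move: te; rewrite ltr_norml => /andP[]; lra.
rewrite addrC flowD //; split => //; exact: interior_subset Gt.
Qed.

End recurrence.

Lemma sort3 (T : topologicalType) (V : set T) lt (P : T -> Prop) x y z :
  ordered V lt -> V x -> V y -> V z -> x <> y -> x <> z -> y <> z ->
  P x -> P y -> P z ->
  exists a m b, [/\ V a /\ P a, V m /\ P m, V b /\ P b, lt a m & lt m b].
Proof.
move=> od Vx Vy Vz xy xz yz Px Py Pz.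
have [h1|h1] := od_total od Vx Vy xy; have [h2|h2] := od_total od Vy Vz yz;
  have [h3|h3] := od_total od Vx Vz xz.
- by exists x, y, z.
- by exists x, y, z.
- by exists x, z, y.
- by exists z, x, y.
- by exists y, x, z.
- by exists y, z, x.
- by exists z, y, x.
- by exists z, y, x.
Qed.

Lemma oitv_ropen (T : topologicalType) (v : RR -> T -> T) theta W e V lt a b :
  is_flow v -> fbox v theta W e -> ropen v theta W e V -> ordered V lt ->
  V a -> V b -> ropen v theta W e (oitv V lt a b).
Proof.
move=> flv fb rV od Va Vb; apply: (ropenP flv fb rV) => [y []//|y [Vy ay yb]].
apply: filterS2 (od_gt od Va Vy ay) (od_lt od Vb Vy yb) => z h1 h2 Vz.
by split => //; [exact: h1 | exact: h2].
Qed.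

Section poisson.
Variables (T : topologicalType) (v : RR -> T -> T).
Hypothesis flv : is_flow v.
Hypothesis hT : hausdorff_space T.
Hypothesis cT : compact [set: T].
Hypothesis lT : locally_half_euclidean2 T.
Hypothesis conT : connected [set: T].

(* An interval of the section bounded by two points of a recurrent orbit that
   also passes inside is met by every forward orbit within bounded time; so
   its saturation is both open and compact. *)
Lemma all_orbits_meet x (G : set T) : (forall y, returns v y) -> interior_pt x ->
  ~ closed_point v x -> nbhs x G -> forall y, exists t, G (v t y).
Proof.
move=> ret ix ncl Gx.
have nsg : ~ singular_point v x by move=> h; apply: ncl; left.
have [theta [W [e [V [lt [fb rV Vx VG od]]]]]] := ordered_section flv hT cT lT ix nsg Gx.
have e0 := fb_gt0 fb.
have inj := nonclosed_inj flv ncl.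
have [t1 t10 [V1 _]] := hit flv fb rV Vx (ret x) filterT 0.
have [t2 t21 [V2 _]] := hit flv fb rV Vx (ret x) filterT t1.
have neq s t : s < t -> v s x <> v t x by move=> st /inj; lra.
have x0 : v 0 x = x by exact: flow0.
have [||||||a [m [b [[Va [ta eta]] [Vm [tm etm]] [Vb [tb etb]] am mb]]]] :=
  @sort3 T V lt (fun q => exists t, q = v t x) x (v t1 x) (v t2 x) od Vx V1 V2.
- by rewrite -{1}x0; exact: neq.
- by rewrite -{1}x0; apply: neq; lra.
- exact: neq.
- by exists 0.
- by exists t1.
- by exists t2.
have ab : lt a b by exact: (od_trans od Va Vm Vb).
pose J := oitv V lt a b.
have rJ : ropen v theta W e J by exact: oitv_ropen.
have Jm : J m by split.
pose K := a |` (b |` J).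
have [cK _] : compact K /\ connected K by exact: od_compact.
have KV : K `<=` V by move=> q [->|[->|[]]].
have clK : closed K by exact: compact_closed.
have Kret z : K z -> exists2 t, 1 + e < t & box v theta e J (v t z).
  (* The two ends of [K] are not in [J], but they lie on the orbit of [x], which passes through [m]
     in [J], and [m] returns to [J] at arbitrarily late times. *)
  have orb tz : z = v tz x -> exists2 t, 1 + e < t & box v theta e J (v t z).
    move=> ez.
    have bm := box_id flv fb rJ.1 Jm.
    have [t ht bt] := ret m _ (open_nbhs_nbhs (conj rJ.2 bm)) (1 + e + `|tm - tz|).
    exists (t + (tm - tz)).
      have : - (tm - tz) <= `|tm - tz| by rewrite -normrN ler_norm.
      by lra.
    by rewrite ez -flowD // -addrA subrK flowD // -etm.
  move=> [zE|[zE|Jz]].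
  - exact: (orb ta (etrans zE eta)).
  - exact: (orb tb (etrans zE etb)).
  - have bz := box_id flv fb rJ.1 Jz.
    exact: ret z _ (open_nbhs_nbhs (conj rJ.2 bz)) (1 + e).
have hitJ t z : box v theta e J (v t z) ->
    J (v (t - theta (v t z)) z) /\ `|theta (v t z)| < e.
  by move=> [h1 h2]; split => //; rewrite addrC flowD.
have [M HM] : exists M, forall z, K z -> exists2 t, 1 < t < M & J (v t z).
  have ex z : exists t, K z -> 1 + e < t /\ box v theta e J (v t z).
    have [Kz|] := pselect (K z); last by exists 0.
    by have [t h1 h2] := Kret z Kz; exists t.
  have [tau Htau] := choice ex.
  have [z Kz|l [lK lcov]] := @finite_cover T K (fun z => [set q | box v theta e J (v (tau z) q)]) cK.
    have [_ h2] := Htau z Kz.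
    exact: (flow_continuous flv (t := tau z)) _ (open_nbhs_nbhs (conj rJ.2 h2)).
  exists (\sum_(z <- l) `|tau z| + e + 1) => z Kz.
  have [q ql bq] := lcov z Kz; have [h1 h2] := hitJ _ _ bq.
  exists (tau q - theta (v (tau q) z)) => //.
  move: h2; rewrite ltr_norml => /andP[h2 h3].
  have [h4 _] := Htau q (lK q ql).
  have h5 : tau q <= \sum_(z <- l) `|tau z|.
    rewrite (big_rem q) //=; apply: le_trans (ler_norm _) _.
    by rewrite lerDl; apply: sumr_ge0 => ? _; exact: normr_ge0.
  by apply/andP; split; lra.
have M1 : 1 < M by have [t /andP[h1 h2] _] := HM m (or_intror (or_intror Jm)); lra.
(* The points reached from [K] within time [M]; closed, as the times range over a compact
   interval. *)
pose D := [set y | exists2 r, seg 0 M r & K (v (- r) y)].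
have clD : closed D.
  rewrite -openC openE => y nDy.
  have : \forall y' \near y, forall r, seg 0 M r -> ~ K (v (- r) y').
    apply: tube; first exact: seg_compact.
    move=> r rs.
    have nK : (~` K) (v (- r) y) by move=> Kr; apply: nDy; exists r.
    have oK : open (~` K) by exact: closed_openC.
    have c : {for (y, r), continuous (fun z : T * RR => v (- z.2) z.1)}.
      by apply: (contV flv); cont.
    exact: c _ (open_nbhs_nbhs (conj oK nK)).
  by apply: filterS => y' h [r /h].
(* Return times exceed 1, so passing to the next return lowers the bound [n] by one. *)
have fwd (n : nat) : forall z t, K z -> 0 <= t <= n%:R -> D (v t z).
  elim: n => [|n IH] z t Kz /andP[t0 tn].
    exists 0; first by apply/andP; split; lra.
    have -> : t = 0 by apply/eqP; rewrite eq_le t0 andbT.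
    by rewrite oppr0 !flow0.
  have [tM|tM] := leP t M; first by exists t; [apply/andP | rewrite flowK].
  have [s /andP[s1 s2] Js] := HM z Kz.
  have -> : v t z = v (t - s) (v s z) by rewrite -flowD // subrK.
  apply: IH; first by right; right.
  by move: tn; rewrite -natr1 => tn; apply/andP; split; lra.
pose Z := [set y | exists t, J (v t y)].
have oZ y : Z y -> \forall y' \near y, Z y'.
  move=> [t Jt]; have bt := box_id flv fb rJ.1 Jt.
  have N : \forall y' \near y, box v theta e J (v t y').
    exact: (flow_continuous flv (t := t)) _ (open_nbhs_nbhs (conj rJ.2 bt)).
  by apply: filterS N => y' /hitJ [h _]; exists (t - theta (v t y')).
(* After its visit to [J] at time [t] the orbit of [y] stays in [D]; by recurrence it comes back
   near [y] later than [t], and [D] is closed. *)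
have ZD : Z `<=` D.
  move=> y [t Jt]; apply: clD => G' Gy.
  have [s hs Gs] := ret y G' Gy t.
  exists (v s y); split => //.
  have -> : v s y = v (s - t) (v t y) by rewrite -flowD // subrK.
  apply: (fwd (Num.truncn (s - t)).+1); first by right; right.
  have st : 0 <= s - t by lra.
  by rewrite st /=; apply: ltW; exact: truncnS_gt.
have DZ : D `<=` Z.
  move=> y [r _ Kr].
  have orb tz : v (- r) y = v tz x -> Z y.
    move=> ez; exists (tm - tz - r).
    by rewrite flowD // ez -flowD // subrK -etm.
  case: Kr => [zE|[zE|Jz]].
  - exact: (orb ta (etrans zE eta)).
  - exact: (orb tb (etrans zE etb)).
  - by exists (- r).
move=> y; suff : Z y by move=> [t [Vt _ _]]; exists t; exact: VG.
suff : `[< Z m >] = `[< Z y >].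
  rewrite asboolT; first by move=> /esym /asboolP.
  by exists 0; rewrite flow0.
apply: (locally_constant_connected (b := fun q => `[< Z q >]) conT) => // q _.
have [Zq|nZq] := pselect (Z q).
  by apply: filterS (oZ q Zq) => r Zr _; rewrite !asboolT.
have nDq : (~` D) q by move=> /DZ.
have oD : open (~` D) by exact: closed_openC.
by apply: filterS (open_nbhs_nbhs (conj oD nDq)) => r nDr _; rewrite !asboolF // => /ZD.
Qed.

Lemma orbit_closed y : closed_point v y -> closed (Defs.orbit v y).
Proof.
move=> cy; have [per [p0 vp]] : exists per : RR, 0 < per /\ v per y = y.
  case: cy => [h|[_ //]]; exists 1; split => //; exact: h.
have vpn (n : nat) : v (per * n%:R) y = y.
  elim: n => [|n IH]; first by rewrite mulr0 flow0.
  by rewrite -natr1 mulrDr mulr1 flowD // vp.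
suff -> : Defs.orbit v y = [set v t y | t in seg 0 per].
  apply: compact_closed => //; apply: continuous_compact; last exact: seg_compact.
  apply: continuous_subspaceT => t; apply: (contV flv); cont.
apply/seteqP; split => [_ [t _ <-]|_ [t _ <-]]; last by exists t.
wlog t0 : t / 0 <= t.
  move=> H; pose n := (Num.truncn (`|t| / per)).+1.
  have [] := H (t + per * n%:R).
    have : `|t| / per < n%:R by exact: truncnS_gt.
    rewrite ltr_pdivrMr // mulrC => h.
    have : - t <= `|t| by rewrite -normrN ler_norm.
    by lra.
  by move=> r rs vr; exists r => //; rewrite vr flowD // vpn.
pose n := Num.truncn (t / per).
have tp : 0 <= t / per by rewrite divr_ge0 // ltW.
have n1 : n%:R <= t / per by rewrite truncn_le.
have n2 : t / per < n.+1%:R by exact: truncnS_gt.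
move: n1 n2; rewrite ler_pdivlMr // ltr_pdivrMr // -natr1 mulrDl mul1r => n1 n2.
exists (t - per * n%:R); first by apply/andP; split; lra.
by rewrite -{1}(vpn n) -flowD // subrK.
Qed.

Lemma poisson_stable_dichotomy : Poisson_stable_flow v -> LD v = set0 \/ Cl v = set0.
Proof.
move=> Ps; have ret y : returns v y by apply: omega_returns; have [] := Ps y.
have [[x ncl]|all] := pselect (exists x, ~ closed_point v x); last first.
  left; apply/seteqP; split => // y [x [ncl _] _].
  by apply: all; exists x.
right; apply/seteqP; split => // y cy.
have [|s ints] := recurrent_interior flv lT ncl.
  move=> G Gx; have [t h1 h2] := ret x G Gx 1; exists t => //.
  by apply: lt_le_trans h1 (ler_norm _).
have nys : ~ Defs.orbit v y (v s x).
  move=> [t _ h]; apply: ncl; apply: (closed_point_flow flv (t := s)).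
  rewrite -h; apply: (closed_point_flow flv (t := - t)).
  by rewrite flowK.
have oO : open (~` Defs.orbit v y) by apply: closed_openC; exact: orbit_closed.
have ncs : ~ closed_point v (v s x) by move=> /(closed_point_flow flv).
have [t Gt] := all_orbits_meet ret ints ncs (open_nbhs_nbhs (conj oO nys)) y.
by apply: Gt; exists t.
Qed.

End poisson.

(** * Classes of systems and crossings *)

Lemma nbhs_seq (T : topologicalType) (z : T) (I : eqType) (l : seq I) (A : I -> set T) :
  (forall i, i \in l -> nbhs z (A i)) ->
  \forall y \near z, forall i, i \in l -> A i y.
Proof.
elim: l => [|i l IH] H; first by apply: filterS filterT => y _ i.
have H1 := H i (mem_head _ _).
have H2 := IH (fun j jl => H j (mem_behead (s := i :: l) jl)).
apply: filterS2 H1 H2 => y h1 h2 j; rewrite inE => /orP[/eqP ->//|].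
exact: h2.
Qed.

Section classes.
Variable T : topologicalType.
Hypothesis hT : hausdorff_space T.
Hypothesis cT : compact [set: T].
Hypothesis lT : locally_half_euclidean2 T.

(* Finiteness of the first cohomology with coefficients in Z/2. *)
Lemma class_map : exists (B : finType) (cls : sys T -> B),
  forall D D', good D setT -> good D' setT -> cls D = cls D' ->
  triv (sumsys D D') setT.
Proof.
have exC (x : T) : exists CU : set T * set T,
    [/\ simply CU.1, closed CU.2, nbhs x CU.2 & CU.2 `<=` interior CU.1].
  have [C [Cx _ sC]] := simply_nbhs lT (filterT : nbhs x setT).
  have [U [Ux clU UC]] := closed_nbhs hT cT (nbhs_interior Cx).
  by exists (C, U).
have [CU HCU] := choice exC.
pose C x := (CU x).1; pose U x := (CU x).2.
have sC x : simply (C x) by have [] := HCU x.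
have clU x : closed (U x) by have [] := HCU x.
have UC x : U x `<=` interior (C x) by have [] := HCU x.
have [x _|l1 [_ cov1]] := @finite_cover T setT (fun x => interior (U x)) cT.
  by apply: nbhs_interior; have [] := HCU x.
(* A connected set [E z] that meets [U x] lies in [C x], so on it local sections over different sets
   [C x] can be compared at the single sample point [z]. *)
have exE (z : T) : exists E : set T, [/\ connected E, nbhs z E &
    forall x, x \in l1 -> (U x z -> E `<=` C x) /\ (~ U x z -> E `&` U x = set0)].
  have N : \forall y \near z, forall x, x \in l1 ->
      (if `[< U x z >] then interior (C x) else ~` U x) y.
    apply: nbhs_seq => x _; case: asboolP => h.
      apply: open_nbhs_nbhs; split; [exact: open_interior | exact: UC].
    apply: open_nbhs_nbhs; split => //; exact: closed_openC.
  have [E [Ez EN [cE _]]] := simply_nbhs lT N.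
  exists E; split => // x xl; split => h.
    by move=> y /EN /(_ x xl); rewrite asboolT // => /interior_subset.
  by apply/seteqP; split => // y [/EN /(_ x xl)]; rewrite asboolF.
have [E HE] := choice exE.
have [z _|l2 [_ cov2]] := @finite_cover T setT E cT; first by have [] := HE z.
have exw (Dx : sys T * T) : exists w : T -> bool, good Dx.1 setT -> compat Dx.1 id (C Dx.2) w.
  have [gD|] := pselect (good Dx.1 setT); last by exists (fun=> true).
  have [_ h] := sC Dx.2; have [w cw] := h _ (goodS (fun _ _ => I) gD).
  by exists w.
have [w Hw] := choice exw.
(* The class records the values of the chosen sections at finitely many sample points. Equal records
   force the sums of the sections for [D] and [D'] to agree on overlaps, hence to glue. *)
pose cls D : {ffun (seq_sub l1 * seq_sub l2)%type -> bool} :=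
  [ffun p => w (D, ssval p.1) (ssval p.2)].
exists _, cls => D D' gD gD' eqc.
pose sg x y := w (D, x) y (+) w (D', x) y.
have eqw x z : x \in l1 -> z \in l2 -> w (D, x) z = w (D', x) z.
  move=> xl zl; move/ffunP: eqc => /(_ (SeqSub xl, SeqSub zl)).
  by rewrite !ffunE.
have agree x x' y : x \in l1 -> x' \in l1 -> U x y -> U x' y -> sg x y = sg x' y.
  move=> xl x'l Uy U'y.
  have [z zl Ey] := cov2 y I; have [cE Ez HEx] := HE z.
  have [h1 h2] := HEx x xl; have [h1' h2'] := HEx x' x'l.
  have Uz : U x z.
    by apply: contrapT => /h2 h; have : (E z `&` U x) y by []; rewrite h.
  have U'z : U x' z.
    by apply: contrapT => /h2' h; have : (E z `&` U x') y by []; rewrite h.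
  have ezz : E z z by exact: nbhs_singleton Ez.
  have q D0 (g0 : good D0 setT) :
      w (D0, x) y (+) w (D0, x') y = w (D0, x) z (+) w (D0, x') z.
    apply: (@compat_eq _ D0 setT g0 _ id (E z)) => //.
    - exact: compatS (h1 Uz) (Hw (D0, x) g0).
    - exact: compatS (h1' U'z) (Hw (D0, x') g0).
  have e1 := q D gD; have e2 := q D' gD'; rewrite (eqw x z) // (eqw x' z) // -e2 in e1.
  move: e1; rewrite /sg.
  by case: (w (D, x) y); case: (w (D, x') y); case: (w (D', x) y); case: (w (D', x') y).
have exk y : exists x, x \in l1 /\ interior (U x) y.
  by have [x xl Uy] := cov1 y I; exists x.
have [k Hk] := choice exk.
exists (fun y => sg (k y) y) => y _ i iy.
have [kl ky] := Hk y; have Uy : U (k y) y := interior_subset ky.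
have Cy : C (k y) y := interior_subset (UC _ _ Uy).
have cs := compat_sum (Hw (D, k y) gD) (Hw (D', k y) gD').
have NC : nbhs y (C (k y)) by exact: UC.
apply: filterS3 (cs y Cy i iy) NC ky => y' h Cy' Uy' _ /=.
have [kl' ky'] := Hk y'.
by rewrite -(agree (k y) (k y') y') //; [exact: h | exact: interior_subset ky'].
Qed.

End classes.

Section crossing.
Variables (T : topologicalType) (v : RR -> T -> T).
Hypothesis flv : is_flow v.
Variables (theta : T -> RR) (W : set T) (e : RR).
Hypothesis fb : fbox v theta W e.

(* [D] jumps across the closed curve [gam] and is described near the
   transverse part [J] of [gam] by the sign of [theta]. *)
Definition curve_sys (D : sys T) (gam J : set T) : Prop :=
  [/\ good D setT, closed gam, J `<=` gam,
    exists i0 : sidx D, sdom i0 = ~` gam /\ forall y, slab i0 y = false &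
    exists i1 : sidx D, sdom i1 = box v theta e J /\ forall y, slab i1 y = (0 < theta y)].

(** A section [w] of the sum changes only across the two curves, which the orbit of [y] meets only
    in [J1] and [J2]. It flips as the orbit leaves [J1], and at the first return to [J1] it arrives
    with the common value that [w] has on the connected set [J1]; so it must have changed on [J2]
    meanwhile. *)
Lemma crossing D1 D2 gam1 gam2 J1 J2 y (t1 : RR) :
  curve_sys D1 gam1 J1 -> curve_sys D2 gam2 J2 ->
  ropen v theta W e J1 -> connected J1 -> J1 `&` gam2 = set0 ->
  triv (sumsys D1 D2) setT ->
  (forall t, gam1 (v t y) -> J1 (v t y)) -> (forall t, gam2 (v t y) -> J2 (v t y)) ->
  J1 y -> J1 (v t1 y) -> 0 < t1 -> exists2 t, 0 < t < t1 & J2 (v t y).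
Proof.
move=> [g1 cl1 Jg1 [i0 [di0 li0]] [i1 [di1 li1]]] [g2 cl2 Jg2 [j0 [dj0 lj0]] _].
move=> rJ cJ d12 [w cw] H1 H2 Jy Jt1 t10; apply: contrapT => nJ2.
have e0 := fb_gt0 fb.
have J1n2 z : J1 z -> (~` gam2) z.
  by move=> h1 h2; have : (J1 `&` gam2) z by []; rewrite d12.
have J1N := rJ.1.
have atJ z : J1 z -> \forall q \near z, w q (+) (0 < theta q) = w z.
  move=> Jz; have dz : sdom (s := sumsys D1 D2) (i1, j0) z.
    by split; rewrite /= ?di1 ?dj0; [exact: (box_id flv fb) | exact: J1n2].
  have := cw z I (i1, j0) dz; apply: filterS => q /(_ I) /=.
  rewrite !li1 !lj0 !addbF; have [_ ->] := J1N _ Jz.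
  by rewrite ltxx addbF.
have off z : ~ gam1 z -> ~ gam2 z -> \forall q \near z, w q = w z.
  move=> n1 n2; have dz : sdom (s := sumsys D1 D2) (i0, j0) z.
    by split; rewrite /= ?di0 ?dj0.
  by have := cw z I (i0, j0) dz; apply: filterS => q /(_ I) /=; rewrite !li0 !lj0 !addbF.
have wJ a b : J1 a -> J1 b -> w a = w b.
  apply: (locally_constant_connected cJ) => z Jz.
  apply: filterS (atJ z Jz) => q h Jq; rewrite -h.
  by have [_ ->] := J1N _ Jq; rewrite ltxx addbF.
have cvy : continuous (fun t : RR => v t y).
  by move=> t; apply: (contV flv); cont.
pose f t := w (v t y).
have fJ t : J1 (v t y) -> \forall r \near t, f r = f t (+) (t < r).
  move=> Jt; have N1 : \forall r \near t, w (v r y) (+) (0 < theta (v r y)) = f t.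
    exact: cvy t _ (atJ _ Jt).
  apply: filterS2 (near_dist t e0) N1 => r re h.
  have tr : theta (v r y) = r - t.
    have -> : v r y = v (r - t) (v t y) by rewrite -flowD // subrK.
    by apply: (theta_flow fb); [exact: J1N | exact: ltW].
  by rewrite -h tr subr_gt0 -addbA addbb addbF.
have fo t : ~ J1 (v t y) -> ~ J2 (v t y) -> \forall r \near t, f r = f t /\ ~ J1 (v r y).
  move=> n1 n2.
  have m1 : ~ gam1 (v t y) by move=> /H1.
  have m2 : ~ gam2 (v t y) by move=> /H2.
  have N1 : \forall r \near t, w (v r y) = w (v t y) by exact: cvy t _ (off _ m1 m2).
  have o1 : open (~` gam1) by exact: closed_openC.
  have N2 : \forall r \near t, (~` gam1) (v r y).
    exact: cvy t _ (open_nbhs_nbhs (conj o1 m1)).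
  by apply: filterS2 N1 N2 => r h1 h2; split => // /Jg1.
have sepJ t : J1 (v t y) -> `|t| <= e -> t = 0.
  by move=> Jt te; exact: (xsect_inj fb (J1N _ Jy) (J1N _ Jt) te erefl).
(* [sup S] is the time of the first return to [J1]; it is at least [e], since a short orbit arc
   meets the section only once. *)
pose S := [set t | 0 <= t <= t1 /\ forall r, 0 < r < t -> ~ J1 (v r y)].
have S0 : S 0 by split; [rewrite lexx ltW | move=> r; rlra].
have hS : has_sup S by split; [exists 0 | exists t1 => t [/andP[]]].
have et1 : e < t1.
  by rewrite ltNge; apply/negP => h; have := sepJ _ Jt1; rewrite gtr0_norm // => /(_ h); rlra.
have Se : S e.
  split; first by apply/andP; split; rlra.
  move=> r /andP[r0 re] Jr; have := sepJ _ Jr; rewrite gtr0_norm // => /(_ (ltW re)); rlra.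
set s := sup S.
have es : e <= s by exact: sup_upper_bound.
have st1 : s <= t1 by apply: ge_sup; [exists 0 | move=> t [/andP[]]].
have free r : 0 < r < s -> ~ J1 (v r y).
  move=> /andP[r0 rs].
  have sr : 0 < s - r by rlra.
  have [t [_ ht] rt] := sup_adherent sr hS.
  by apply: ht; rewrite r0 /=; move: rt; rewrite subKr.
have free2 r : 0 < r < t1 -> ~ J2 (v r y) by move=> h Jr; apply: nJ2; exists r.
have Js : J1 (v s y).
  apply: contrapT => nJs.
  have [E|st] := eqVneq s t1; first by apply: nJs; rewrite E.
  have {}st : s < t1 by rewrite lt_neqAle st.
  have nJ2s : ~ J2 (v s y) by apply: free2; apply/andP; split; rlra.
  have := fo s nJs nJ2s => /nbhs_ballP [d /= d0 Hd].
  pose m := Num.min (s + d) t1.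
  have sm : s < m by rewrite lt_min st; rlra.
  have Sm : S m.
    have m1 : m <= t1 by rewrite ge_min lexx orbT.
    have m2 : m <= s + d by rewrite ge_min lexx.
    split; first by apply/andP; split; rlra.
    move=> r /andP[r0 rm]; have [h|h] := ltP r s; first by apply: free; rewrite r0.
    have [|_ //] := Hd r; rewrite /ball /= ltr_norml; apply/andP; split; rlra.
  have : m <= s by exact: sup_upper_bound.
  rlra.
have cI : connected [set r : RR | 0 < r < s].
  apply/connected_intervalP => a b /andP[a1 a2] /andP[b1 b2] c /andP[ac cb].
  by rewrite /= (lt_le_trans a1 ac) (le_lt_trans cb b2).
have fc a b : 0 < a < s -> 0 < b < s -> f a = f b.
  apply: (locally_constant_connected cI) => r /andP[r0 rs].
  have n1 : ~ J1 (v r y) by apply: free; rewrite r0.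
  have n2 : ~ J2 (v r y) by apply: free2; apply/andP; split; rlra.
  by apply: filterS (fo r n1 n2) => q [].
have J0 : J1 (v 0 y) by rewrite flow0.
have := fJ 0 J0 => /nbhs_ballP [d /= d0 Hd].
have := fJ s Js => /nbhs_ballP [d' /= d'0 Hd'].
pose a := Num.min (d / 2) (s / 2).
have s0 : 0 < s by rlra.
have a0 : 0 < a by rewrite lt_min; apply/andP; split; rlra.
have a1 : a <= d / 2 by rewrite ge_min lexx.
have a2 : a <= s / 2 by rewrite ge_min lexx orbT.
pose b := Num.min (d' / 2) (s / 2).
have b0 : 0 < b by rewrite lt_min; apply/andP; split; rlra.
have b1 : b <= d' / 2 by rewrite ge_min lexx.
have b2 : b <= s / 2 by rewrite ge_min lexx orbT.
have fa : f a = f 0 (+) true.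
  by rewrite Hd ?a0 // /ball /= sub0r normrN gtr0_norm //; rlra.
have fsb : f (s - b) = f s.
  rewrite Hd'; last by rewrite /ball /= subKr gtr0_norm //; rlra.
  by rewrite ltNge (_ : s - b <= s) ?addbF //; rlra.
have : f a = f (s - b) by apply: fc; apply/andP; split; rlra.
rewrite fa fsb /f (wJ (v s y) (v 0 y)) //.
by case: (w _).
Qed.

End crossing.

Lemma oitv_rev (T : Type) (V : set T) lt a b :
  oitv V (fun x y => lt y x) b a = oitv V lt a b.
Proof. by apply/seteqP; split => y []. Qed.

Lemma ordered_rev (T : topologicalType) (V : set T) lt :
  ordered V lt -> ordered V (fun x y => lt y x).
Proof.
move=> od; split.
- exact: od_conn od.
- exact: od_irr od.
- by move=> x y z Vx Vy Vz h1 h2; exact: (od_trans od Vz Vy Vx).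
- by move=> x y Vx Vy xy; have [] := od_total od Vx Vy xy; [right | left].
- exact: od_lb od.
- exact: od_ub od.
- exact: od_lt od.
- exact: od_gt od.
- by move=> a b Va Vb ab; rewrite oitv_rev setUCA; exact: od_compact.
Qed.

Section endpoints.
Variables (T : topologicalType) (v : RR -> T -> T).
Hypothesis flv : is_flow v.
Hypothesis hT : hausdorff_space T.
Hypothesis lT : locally_half_euclidean2 T.
Variables (theta : T -> RR) (W : set T) (e : RR).
Hypothesis fb : fbox v theta W e.
Variable V : set T.
Hypothesis rV : ropen v theta W e V.

Section one_order.
Variable lt : T -> T -> Prop.
Hypothesis od : ordered V lt.

Lemma od_asym x y : V x -> V y -> lt x y -> ~ lt y x.
Proof. by move=> Vx Vy h1 h2; exact: (od_irr od (od_trans od Vx Vy Vx h1 h2)). Qed.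

Lemma od_neq x y : lt x y -> x <> y.
Proof. by move=> h xy; rewrite xy in h; exact: (od_irr od h). Qed.

Lemma connected_convex A x y z : A `<=` V -> connected A -> A x -> A y -> V z ->
  lt x z -> lt z y -> A z.
Proof.
move=> AV cA Ax Ay Vz xz zy; apply: contrapT => nAz.
suff : `[< lt z x >] = `[< lt z y >].
  by rewrite (asboolT zy) asboolF // => /(od_asym Vz (AV _ Ax)); apply.
apply: (locally_constant_connected (b := fun q => `[< lt z q >]) cA) => // q Aq.
have Vq := AV _ Aq.
have zq : z <> q by move=> zq; apply: nAz; rewrite zq.
have [h|h] := od_total od Vz Vq zq.
  apply: filterS (od_gt od Vz Vq h) => r hr /AV /hr h2.
  by rewrite !asboolT.
apply: filterS (od_lt od Vz Vq h) => r hr /AV Vr; have h2 := hr Vr.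
by rewrite !asboolF //; exact: od_asym.
Qed.

Lemma convex_connected A : A `<=` V ->
  (forall x y z, A x -> A y -> V z -> lt x z -> lt z y -> A z) -> connected A.
Proof.
move=> AV convA; apply: connected_bool => u lu.
have main x y : A x -> A y -> lt x y -> u x = u y.
  move=> Ax Ay xy; have [_ cI] := od_compact od (AV _ Ax) (AV _ Ay) xy.
  have IA : (x |` (y |` oitv V lt x y)) `<=` A.
    by move=> q [->|[->|[Vq xq qy]]] //; exact: (convA x y).
  apply: (locally_constant_connected cI); last by right; left.
    by move=> q /IA /lu; apply: filterS => r h /IA; exact: h.
  by left.
move=> x y Ax Ay; have [->//|/eqP xy] := eqVneq x y.
by have [h|h] := od_total od (AV _ Ax) (AV _ Ay) xy; [|symmetry]; exact: main.
Qed.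

Lemma oitv_connected a b : V a -> V b -> connected (oitv V lt a b).
Proof.
move=> Va Vb; apply: convex_connected => [x []//|x y z [Vx ax xb] [Vy ay yb] Vz xz zy].
by split => //; [exact: (od_trans od Va Vx) | exact: (od_trans od Vz Vy)].
Qed.

Lemma upper_adherent c G : V c -> nbhs c G -> exists2 x, V x /\ lt c x & G x.
Proof.
move=> Vc Gc; have [y Vy cy] := od_ub od Vc.
have [_ cI] := od_compact od Vc Vy cy.
apply: contrapT => nG.
suff : `[< c = c >] = `[< y = c >].
  rewrite asboolT // => /esym /asboolP yc; apply: (od_neq cy); exact: esym.
apply: (locally_constant_connected (b := fun q => `[< q = c >]) cI); last by right; left.
  move=> q Iq; have [->|/eqP qc] := eqVneq q c.
    apply: filterS Gc => r Gr [->//|h]; exfalso; apply: nG; exists r => //.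
    by case: h => [->//|[]].
  apply: filterS (near_neq hT qc) => r rc _.
  by rewrite !asboolF.
by left.
Qed.

Lemma oitv_nonempty a b : V a -> V b -> lt a b -> oitv V lt a b !=set0.
Proof.
move=> Va Vb ab; have N := od_lt od Vb Va ab.
have [x [Vx ax] hx] := upper_adherent Va N.
by exists x; split => //; exact: hx.
Qed.

(* A neighbourhood of an end of an interval: [V' `&` J] and [Q] are its two
   sides. *)
Lemma endpoint c d G : V c -> V d -> lt c d -> nbhs c G ->
  let J := oitv V lt c d in
  exists V', let Q := (V' `\ c) `\` J in
    [/\ [/\ ropen v theta W e V', V' c, V' `<=` V & V' `<=` G],
        connected (V' `&` J), connected Q, ropen v theta W e Q &
        (forall G', nbhs c G' -> exists2 x, (V' `&` J) x & G' x)].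
Proof.
move=> Vc Vd cd Gc J.
have Gc' := nbhsI Gc (od_lt od Vd Vc cd).
have [V' [rV' V'c cV' V'V V'G]] := ropen_component flv lT fb rV Vc Gc'.
have V'd q : V' q -> lt q d by move=> V'q; have [_] := V'G _ V'q; apply; exact: V'V.
have conv := connected_convex V'V cV'.
have VJ : V' `&` J = V' `&` [set q | lt c q].
  apply/seteqP; split => q [V'q h]; split => //; first by case: h.
  by split => //; [exact: V'V | exact: V'd].
have QE : (V' `\ c) `\` J = V' `&` [set q | lt q c].
  apply/seteqP; split => [q [[V'q qc] nJ]|q [V'q /= qc]].
    split => //; have [//|h] := od_total od (V'V _ V'q) Vc qc.
    by exfalso; apply: nJ; split => //; [exact: V'V | exact: V'd].
  split; first by split => //; exact: od_neq.
  by move=> [_ h _]; exact: (od_asym Vc (V'V _ V'q) h).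
exists V'; rewrite QE VJ; split.
- by split => // q /V'G [].
- apply: convex_connected => [q []/V'V//|x y z [V'x /= h1] [V'y /= h2] Vz xz zy].
  by split; [exact: conv xz zy | exact: (od_trans od Vc (V'V _ V'x) Vz)].
- apply: convex_connected => [q []/V'V//|x y z [V'x /= h1] [V'y /= h2] Vz xz zy].
  by split; [exact: conv xz zy | exact: (od_trans od Vz (V'V _ V'y) Vc)].
- apply: (ropenP flv fb rV') => [q []//|q [V'q /= qc]].
  apply: filterS (od_lt od Vc (V'V _ V'q) qc) => r h V'r; split => //.
  by apply: h; exact: V'V.
- move=> G' Gc2.
  have [x [Vx cx] [Gx V'x]] := upper_adherent Vc (nbhsI Gc2 (ropen_near flv fb rV' V'c)).
  by exists x => //; split => //; apply: V'x; exact: rV.1.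
Qed.

End one_order.

End endpoints.

(** * The closed curve over a gap *)

Lemma near_neq2 (T : topologicalType) (a b : T) : hausdorff_space T -> a <> b ->
  \forall z \near (a, b), z.1 <> z.2.
Proof.
move=> hT ab; move: hT; rewrite open_hausdorff => /(_ a b) H.
have [|[A B] /= [Aa Bb] [oA oB AB]] := H; first exact/eqP.
exists (A, B) => /=.
  by split; apply: open_nbhs_nbhs; split => //; exact/set_mem.
move=> [x y] [/= Ax By] xy; have : (A `&` B) x by split => //; rewrite xy.
by move/eqP: AB => ->.
Qed.

Section gap_system.
Variables (T : topologicalType) (v : RR -> T -> T).
Hypothesis flv : is_flow v.
Hypothesis hT : hausdorff_space T.
Hypothesis cT : compact [set: T].
Hypothesis lT : locally_half_euclidean2 T.
Variables (theta : T -> RR) (W : set T) (e : RR).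
Hypothesis fb : fbox v theta W e.
Variables (V : set T) (lt : T -> T -> Prop).
Hypothesis rV : ropen v theta W e V.
Hypothesis od : ordered V lt.
Variables (c d : T) (L : RR).
Hypothesis Vc : V c.
Hypothesis Vd : V d.
Hypothesis cd : lt c d.
Hypothesis L0 : 0 < L.
Hypothesis dE : d = v L c.
Hypothesis ncl : ~ closed_point v c.

Local Notation N := (xsect theta W).
Local Notation fp := (fproj v theta).
Local Notation box := (box v theta e).
Local Notation ropen := (ropen v theta W e).
Local Notation J := (oitv V lt c d).

Hypothesis arcJ : forall t, 0 <= t <= L -> ~ J (v t c).

Let Nc : N c. Proof. exact: rV.1. Qed.
Let Nd : N d. Proof. exact: rV.1. Qed.
Let rJ : ropen J. Proof. exact: oitv_ropen. Qed.
Let JN : J `<=` N. Proof. exact: rJ.1. Qed.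
Let inj := nonclosed_inj flv ncl.
Let cJ : ~ J c. Proof. by move=> [_ h _]; exact: (od_irr od h). Qed.
Let dJ : ~ J d. Proof. by move=> [_ _ h]; exact: (od_irr od h). Qed.

Let eL : e < L.
Proof.
rewrite ltNge; apply/negP => h.
have Le : `|L| <= e by rewrite gtr0_norm.
by have := xsect_inj fb Nc Nd Le (esym dE); have := L0; lra.
Qed.

(** The tube around the arc overshoots both ends by [delta], small enough to stay within the flow
    boxes at [c] and [d]. *)
Let delta : RR := e / 4.
Let psi x := fp (v L x).
Let ts x := L - theta (v L x).

Let psiE x : psi x = v (ts x) x.
Proof. by rewrite /psi /fproj -flowD // addrC. Qed.

(** Times up to [e] are settled by the section. At all times between [e] and [M] in modulus the
    non-closed point [c] is moved off itself, so by compactness no point near [c] is carried to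
    another one near [c]. *)
Lemma no_short_return (M : RR) : exists G, nbhs c G /\
  forall x x' t, G x -> G x' -> N x -> N x' -> `|t| <= M -> v t x = x' -> t = 0.
Proof.
have far (a b : RR) : (forall t, seg a b t -> t != 0) ->
    \forall z \near (c, c), forall t, seg a b t -> v t z.1 <> z.2.
  move=> hab; apply: (@tube _ RR _ (fun (z : T * T) t => v t z.1 <> z.2)).
    exact: seg_compact.
  move=> t /hab t0.
  have nt : v t c <> c.
    by move=> h; move/eqP: t0; apply; apply: inj; rewrite h flow0.
  have cc : {for ((c, c), t), continuous (fun q : T * T * RR => (v q.2 q.1.1, q.1.2))}.
    apply: contP.
      apply: (contV flv (f := fun q : T * T * RR => q.2) (k := fun q : T * T * RR => q.1.1)).
        by cont.
      move=> G /= Gc; exact: (near_fst (x := ((c, c), t)) (near_fst (x := (c, c)) Gc)).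
    move=> G /= Gc; exact: (near_fst (x := ((c, c), t)) (near_snd (x := (c, c)) Gc)).
  exact: cc _ (near_neq2 hT nt).
have e0 := fb_gt0 fb.
have F1 := far e M; have F2 := far (- M) (- e).
have [|[A1 B1] /= [A1c B1c] s1] := F1.
  by move=> t /andP[h _]; rewrite gt_eqF //; lra.
have [|[A2 B2] /= [A2c B2c] s2] := F2.
  by move=> t /andP[_ h]; rewrite lt_eqF //; lra.
exists ((A1 `&` B1) `&` (A2 `&` B2)); split.
  by apply: nbhsI; apply: nbhsI.
move=> x x' t [[A1x _] [A2x _]] [[_ B1x] [_ B2x]] Nx Nx' tM vt.
have [te|te] := leP `|t| e; first exact: (xsect_inj fb Nx Nx' te vt).
exfalso; have [t0|t0] := leP 0 t.
  have [] := s1 (x, x') (conj A1x B1x) t _ vt.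
  by move: tM te; rewrite ger0_norm // => ? ?; apply/andP; split; lra.
have [] := s2 (x, x') (conj A2x B2x) t _ vt.
by move: tM te; rewrite ltr0_norm // => ? ?; apply/andP; split; lra.
Qed.

Let K := c |` (d |` J).
Let clK : closed K.
Proof. by apply: compact_closed => //; have [] := od_compact od Vc Vd cd. Qed.
Let KN : K `<=` N. Proof. by move=> x [->|[->|/JN]]. Qed.

Let arcK t : 0 < t < L -> ~ K (v t c).
Proof.
move=> /andP[t0 tL] [h|[h|h]].
- have t00 : t = 0 by apply: inj; rewrite h flow0.
  by rewrite t00 ltxx in t0.
- have tL' : t = L by apply: inj; rewrite h dE.
  by rewrite tL' ltxx in tL.
- by apply: (arcJ (t := t)) => //; rewrite !ltW.
Qed.

Let gam := K `|` [set v t c | t in seg 0 L].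

Let clgam : closed gam.
Proof.
apply: closedU => //; apply: compact_closed => //.
apply: continuous_compact; last exact: seg_compact.
by apply: continuous_subspaceT => t; apply: (contV flv); cont.
Qed.

(** Three charts: the complement of [gam]; the box over [J], labelled by the sign of [theta]; and a
    thin tube around the arc with injective coordinates [(x, t)] for the point [v t x]. The
    difficulty is a tube label that jumps exactly across [gam], also at the corners [c] and [d]
    where arc and gap meet. *)
Lemma gap_system : exists D, curve_sys v theta e D gam J.
Proof.
have e0 := fb_gt0 fb; have L0' := L0; have eL' := eL.
have dl0 : 0 < delta by rewrite /delta; lra.
have dle : delta + delta < e by rewrite /delta; lra.
have cL := flow_continuous flv (t := L).
have cNL := flow_continuous flv (t := - L).
have odr := ordered_rev od.
have [Vd0] := endpoint flv hT lT fb rV odr Vd Vc cd filterT.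
rewrite oitv_rev => -[[rVd Vdd VdV _] _ _ rQd Jacc].
have Qacc G : nbhs d G -> exists2 x, ((Vd0 `\ d) `\` J) x & G x.
  move=> Gd; have [x [Vx dx] [Gx Vdx]] :=
    upper_adherent hT od Vd (nbhsI Gd (ropen_near flv fb rVd Vdd)).
  exists x => //; split; last by move=> [_ _ xd]; exact: (od_asym od Vd Vx dx xd).
  by split; [exact/Vdx/rV.1 | move=> /= xd; exact: (od_neq od dx (esym xd))].
have bd := box_id flv fb rVd.1 Vdd.
(* Two times in the tube differ by less than [L + delta + delta], which is below [L + e]. *)
have [G1 [G1c G1H]] := no_short_return (L + e).
have NG2 : nbhs c [set x | box Vd0 (v L x) /\ `|theta (v L x)| < delta].
  have h1 : nbhs (v L c) (box Vd0) by rewrite -dE; apply: open_nbhs_nbhs; split; [exact: rVd.2|].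
  have h2 : nbhs (v L c) [set y | `|theta y| < delta].
    have h : nbhs (theta (v L c)) [set q : RR | `|q| < delta].
      rewrite -dE; have [_ ->] := Nd.
      by apply: filterS (near_dist 0 dl0) => q; rewrite subr0.
    exact: fb_cont fb _ _ h.
  exact: cL c _ (nbhsI h1 h2).
have NG3 : \forall x \near c, forall t, seg delta (L - delta) t -> ~ K (v t x).
  apply: tube; first exact: seg_compact.
  move=> t /andP[t1 t2].
  have nK : (~` K) (v t c) by apply: arcK; apply/andP; split; lra.
  have oK : open (~` K) by exact: closed_openC.
  exact: (flow_near2 flv (open_nbhs_nbhs (conj oK nK))).
have [V' [[rV' V'c V'V V'G] cA cQ rQ _]] :=
  endpoint flv hT lT fb rV od Vc Vd cd (nbhsI G1c (nbhsI NG2 NG3)).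
set Q := (V' `\ c) `\` J in cQ rQ.
have V'N : V' `<=` N := rV'.1.
have uniq x x' t t' : V' x -> V' x' -> - delta < t < L + delta ->
    - delta < t' < L + delta -> v t x = v t' x' -> t = t' /\ x = x'.
  move=> Vx Vx' /andP[t1 t2] /andP[t3 t4] vt.
  have [G1x _] := V'G _ Vx; have [G1x' _] := V'G _ Vx'.
  have h : t - t' = 0.
    apply: (G1H x x') => //; try exact: V'N.
      by rewrite ler_norml; apply/andP; split; lra.
    by rewrite addrC flowD // vt flowK.
  have tt' : t = t' by lra.
  by split => //; rewrite tt' in vt; exact: flow_inj flv _ _ _ vt.
have psi_in x : V' x -> Vd0 (psi x) by move=> /V'G [_ [[[]]]].
have th_small x : V' x -> `|theta (v L x)| < delta by move=> /V'G [_ [[]]].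
have ts_in x : V' x -> L - delta < ts x < L + delta.
  by move=> /th_small; rewrite ltr_norml /ts => /andP[? ?]; apply/andP; split; lra.
have psiN x : V' x -> N (psi x) by move=> /psi_in /rVd.1.
have mid x t : V' x -> seg delta (L - delta) t -> ~ K (v t x).
  by move=> /V'G [_ [_ h]]; exact: h.
have psi_neq x : V' x -> x <> c -> psi x <> d.
  move=> Vx xc h.
  have [h1 h2] : ts x = L /\ x = c.
    have := ts_in x Vx => /andP[? ?].
    apply: uniq => //; try (apply/andP; split; lra).
    by rewrite -psiE h dE.
  exact: xc.
have psi_lc x : V' x -> x <> c -> \forall x' \near x, `[< J (psi x') >] = `[< J (psi x) >].
  move=> Vx xc; have px := psi_in x Vx; have pn := psi_neq x Vx xc.
  have th := ltW (lt_trans (th_small x Vx) (_ : delta < e)).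
  have bx : box (J `|` ((Vd0 `\ d) `\` J)) (v L x).
    split; first by apply: lt_trans (th_small x Vx) _; lra.
    have [Jp|nJp] := pselect (J (psi x)); [by left | by right].
  have dj : J `&` ((Vd0 `\ d) `\` J) = set0 by apply/seteqP; split => // y [? []].
  exact: cL x _ (box_label rJ rQd dj bx).
have V'split x : V' x -> x <> c -> (V' `&` J) x \/ Q x.
  by move=> Vx xc; have [Jx|nJx] := pselect (J x); [left | right].
have constA x y : (V' `&` J) x -> (V' `&` J) y -> `[< J (psi x) >] = `[< J (psi y) >].
  apply: (locally_constant_connected (b := fun q => `[< J (psi q) >]) cA) => q [Vq Jq].
  have qc : q <> c by move=> qc; rewrite qc in Jq.
  by apply: filterS (psi_lc q Vq qc) => r h _.
have constQ x y : Q x -> Q y -> `[< J (psi x) >] = `[< J (psi y) >].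
  apply: (locally_constant_connected (b := fun q => `[< J (psi q) >]) cQ) => q [[Vq qc] _].
  by apply: filterS (psi_lc q Vq qc) => r h _.
have back (z : T) : N z -> z <> d -> box V' (v (- L) z) ->
    exists x, [/\ V' x, x <> c & psi x = z].
  move=> Nz zd [h1 h2]; exists (fp (v (- L) z)); split => //.
    move=> xc; apply: zd.
    have : v L (v (theta (v (- L) z)) (fp (v (- L) z))) = z by rewrite fprojK // flowNK.
    rewrite xc flowC // -dE => vz.
    by have := xsect_inj fb Nd Nz (ltW h1) vz => t0; rewrite -vz t0 flow0.
  have vE : v L (fp (v (- L) z)) = v (- theta (v (- L) z)) z.
    by rewrite /fproj -!flowD //; congr (v _ z); lra.
  rewrite /psi vE.
  by rewrite (fproj_flow flv fb) // normrN ltW.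
have NB : nbhs d [set z | box V' (v (- L) z)].
  have bc := box_id flv fb V'N V'c.
  have h : nbhs (v (- L) d) (box V').
    by rewrite dE flowK //; apply: open_nbhs_nbhs; split => //; exact: rV'.2.
  exact: cNL d _ h.
(* Both sides of [d] are reached by [psi] from near [c], and each of the two connected sides of [c]
   goes to a single side of [d]; so [psi] either preserves or exchanges them. *)
have [kap Hkap] : exists kap : bool, forall x, V' x -> x <> c ->
    `[< J (psi x) >] = `[< J x >] (+) kap.
  have [zJ [_ JzJ] BzJ] := Jacc _ NB.
  have [zQ [[VzQ zQd] nJzQ] BzQ] := Qacc _ NB.
  have [x1 [V1 x1c p1]] := back zJ (JN JzJ) (fun h => dJ (eq_ind _ J JzJ _ h)) BzJ.
  have [x2 [V2 x2c p2]] := back zQ (rVd.1 _ VzQ) zQd BzQ.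
  have b1 : `[< J (psi x1) >] = true by rewrite p1 asboolT.
  have b2 : `[< J (psi x2) >] = false by rewrite p2 asboolF.
  have [A1|Q1] := V'split x1 V1 x1c; have [A2|Q2] := V'split x2 V2 x2c.
  - by have := constA _ _ A1 A2; rewrite b1 b2.
  - exists false => x Vx xc; have [Ax|Qx] := V'split x Vx xc.
      by rewrite (constA _ _ Ax A1) b1 asboolT //; case: Ax.
    by rewrite (constQ _ _ Qx Q2) b2 asboolF //; case: Qx.
  - exists true => x Vx xc; have [Ax|Qx] := V'split x Vx xc.
      by rewrite (constA _ _ Ax A2) b2 asboolT //; case: Ax.
    by rewrite (constQ _ _ Qx Q1) b1 asboolF //; case: Qx.
  - by have := constQ _ _ Q1 Q2; rewrite b1 b2.
(* [kap] records whether the return map [psi] along the arc exchanges the two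
   sides of the gap.  A label equal to [kap] before the section at [c] and to
   [J (psi x)] up to the section at [d] then jumps exactly across [gam]. *)
pose S x t := (t <= 0 /\ kap) \/ [/\ 0 < t, t <= ts x & J (psi x)].
pose inT x t := V' x /\ - delta < t < L + delta.
pose u y := `[< exists x t, [/\ inT x t, y = v t x & S x t] >].
have uE x t : inT x t -> u (v t x) = `[< S x t >].
  move=> [Vx tr]; apply/asbool_equiv_eq; split.
    move=> [x' [t' [[Vx' tr'] vt Sx]]].
    by have [-> ->] := uniq _ _ _ _ Vx Vx' tr tr' vt.
  by move=> Sx; exists x, t.
(* Tube coordinates vary continuously, so local constancy of the label can be checked in terms of
   [(x, t)]. *)
have coord x0 t0 A (eta : RR) : inT x0 t0 -> nbhs x0 A -> 0 < eta ->
    \forall y \near v t0 x0, exists x t, [/\ inT x t, A x, `|t - t0| < eta & y = v t x].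
  move=> [Vx0 /andP[tr1 tr2]] Ax0 eta0.
  pose r := Num.min (Num.min eta (e / 2)) (Num.min (t0 + delta) (L + delta - t0)).
  have r0 : 0 < r by rewrite !lt_min eta0 /=; apply/and3P; split; lra.
  have [r1 r2 r3 r4] : [/\ r <= eta, r <= e / 2, r <= t0 + delta & r <= L + delta - t0].
    by split; rewrite !ge_min lexx ?orbT.
  have rA := ropenI flv fb rV' (open_interior A).
  have Ax : (V' `&` interior A) x0 by split.
  have bx := box_id flv fb rA.1 Ax.
  have h2 : nbhs x0 [set y | `|theta y| < r].
    have [_ tx] := V'N _ Vx0.
    have h : nbhs (theta x0) [set q : RR | `|q| < r].
      by rewrite tx; apply: filterS (near_dist 0 r0) => q; rewrite subr0.
    exact: fb_cont fb _ _ h.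
  have h3 := nbhsI (open_nbhs_nbhs (conj rA.2 bx)) h2.
  have h4 : nbhs (v (- t0) (v t0 x0)) (box (V' `&` interior A) `&` [set y | `|theta y| < r]).
    by rewrite flowK.
  have N5 : \forall y \near v t0 x0, (box (V' `&` interior A) `&` [set y | `|theta y| < r]) (v (- t0) y).
    exact: (flow_continuous flv (t := - t0) h4).
  apply: filterS N5 => y [[_ [Vy Ay]] /= ty].
  exists (fp (v (- t0) y)), (t0 + theta (v (- t0) y)).
  move: (ty); rewrite ltr_norml => /andP[ty1 ty2].
  split.
  - by split => //; apply/andP; split; lra.
  - exact: interior_subset Ay.
  - by rewrite addrAC subrr add0r; lra.
  - by rewrite flowD // fprojK // flowNK.
have c_lt (f : T -> RR) (x : T) (a : RR) : {for x, continuous f} -> f x < a ->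
    \forall y \near x, f y < a.
  move=> cf h; have h' : nbhs (f x) [set q : RR | q < a] by exact: lt_nbhsl.
  exact: cf _ h'.
have c_gt (f : T -> RR) (x : T) (a : RR) : {for x, continuous f} -> a < f x ->
    \forall y \near x, a < f y.
  move=> cf h; have h' : nbhs (f x) [set q : RR | a < q] by exact: lt_nbhsr.
  exact: cf _ h'.
have cts : continuous ts.
  move=> x; have c1 : {for x, continuous (fun x => theta (v L x))}.
    move=> G Gx; exact: cL x _ (fb_cont fb Gx).
  exact: (contD (@contC _ _ L x) (contN c1)).
have tsc : ts c = L by rewrite /ts -dE; have [_ ->] := Nd; rewrite subr0.
have JpsiT x : V' x -> x <> c -> J (psi x) ->
    \forall x' \near x, J (psi x').
  move=> Vx xc Jp; apply: filterS (psi_lc x Vx xc) => x' h.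
  by apply/asboolP; rewrite h; apply/asboolP.
have JpsiF x : V' x -> x <> c -> ~ J (psi x) ->
    \forall x' \near x, ~ J (psi x').
  move=> Vx xc Jp; apply: filterS (psi_lc x Vx xc) => x' h.
  by move=> j; apply: Jp; apply/asboolP; rewrite -h; apply/asboolP.
have off_lc y : (exists x t, inT x t /\ y = v t x) -> ~ gam y ->
    \forall q \near y, u q = u y.
  move=> [x0 [t0 [in0 ->]]] ng; have [Vx0 /andP[tr1 tr2]] := in0.
  suff [A [eta [Ax0 eta0 HS]]] : exists A eta, [/\ nbhs x0 A, 0 < eta &
      forall x t, inT x t -> A x -> `|t - t0| < eta -> (S x t <-> S x0 t0)].
    apply: filterS (coord x0 t0 A eta in0 Ax0 eta0) => q [x [t [inx Ax te ->]]].
    by rewrite !uE //; apply/asbool_equiv_eq; exact: HS.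
  have [t0n|t0p|t00] := ltgtP t0 0.
  - exists setT, (- t0); split; [exact: filterT | lra |].
    move=> x t [Vx _] _; rewrite ltr_norml => /andP[h1 h2].
    have tn : t <= 0 by lra.
    split => -[[_ ka]|[h _ _]]; try (exfalso; lra); left; split => //; exact: ltW.
  - have [lt_ts|gt_ts|eq_ts] := ltgtP t0 (ts x0).
    + have xc : x0 <> c.
        move=> xc; apply: ng; right; exists t0; last by rewrite xc.
        by rewrite xc tsc in lt_ts; apply/andP; split; exact: ltW.
      pose m := (t0 + ts x0) / 2.
      have N1 : \forall x \near x0, m < ts x by apply: c_gt; [exact: cts | rewrite /m; lra].
      exists [set x | m < ts x /\ `[< J (psi x) >] = `[< J (psi x0) >]], (Num.min t0 (m - t0)).
      split; first by apply: filterS2 N1 (psi_lc x0 Vx0 xc).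
        by rewrite lt_min t0p /m; lra.
      move=> x t [Vx _] [mts jx]; rewrite lt_min => /andP[]; rewrite !ltr_norml => /andP[h1 h2] /andP[h3 h4].
      have jx' : J (psi x) <-> J (psi x0) by split => h; apply/asboolP; [rewrite -jx|rewrite jx]; apply/asboolP.
      split => -[[h _]|[_ _ /jx' j]]; try (exfalso; lra); right; split => //; lra.
    + pose m := (t0 + ts x0) / 2.
      have N1 : \forall x \near x0, ts x < m by apply: c_lt; [exact: cts | rewrite /m; lra].
      exists [set x | ts x < m], (Num.min t0 (t0 - m)); split => //.
        by rewrite lt_min t0p /m; lra.
      move=> x t [Vx _] mts; rewrite lt_min => /andP[]; rewrite !ltr_norml => /andP[h1 h2] /andP[h3 h4].
      by move: mts => /= mts; split => -[[h _]|[_ h _]]; exfalso; lra.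
    + have nJ0 : ~ J (psi x0).
        by move=> Jp; apply: ng; left; right; right; rewrite eq_ts -psiE.
      have xc : x0 <> c.
        move=> xc; apply: ng; right; exists L; first by apply/andP; split; lra.
        by rewrite eq_ts xc tsc.
      exists [set x | ~ J (psi x)], t0; split => //; first exact: JpsiF.
      move=> x t [Vx _] nJ; rewrite ltr_norml => /andP[h1 h2].
      by split => -[[h _]|[_ _ h]] //; exfalso; lra.
  - rewrite t00 flow0 // in ng *.
    have xc : x0 <> c by move=> xc; apply: ng; left; left.
    have nJ0 : ~ J x0 by move=> Jx; apply: ng; left; right; right.
    have Q0 : Q x0 by [].
    exists [set x | N x -> Q x], (L - delta); split; [exact: (ropen_near flv fb rQ) | lra |].
    move=> x t [Vx _] Qx; rewrite subr0 ltr_norml => /andP[h1 h2].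
    have [[_ xc'] nJx] := Qx (V'N _ Vx).
    have kx := Hkap x Vx xc'; rewrite (asboolF nJx) addFb in kx.
    have kx' : J (psi x) <-> kap by rewrite -kx; split => /asboolP.
    have /andP[tsx _] := ts_in x Vx.
    split.
      move=> [[_ ka]|[_ _ /kx' ka]]; left; split => //; lra.
    move=> [[_ ka]|[h _ _]]; last by exfalso; lra.
    have [h|h] := leP t 0; [by left | right; split => //; [lra | exact/kx']].
have arc_off y : box J y -> theta y != 0 -> ~ gam y.
  move=> [ty Jp] t0 [/KN [_ h]|[r /andP[r0 rL] ry]]; first by rewrite h eqxx in t0.
  have pE : fp y = v (r - theta y) c by rewrite /fproj -ry -flowD // addrC.
  rewrite pE in Jp.
  move: ty; rewrite ltr_norml => /andP[ty1 ty2].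
  have [h1|h1] := leP 0 (r - theta y); last first.
    have h2 : `|r - theta y| <= e by rewrite ler_norml; apply/andP; split; lra.
    by have := xsect_inj fb Nc (JN Jp) h2 erefl; lra.
  have [h2|h2] := leP (r - theta y) L; first by apply: (arcJ _ Jp); rewrite h1.
  have h3 : `|r - theta y - L| <= e by rewrite ler_norml; apply/andP; split; lra.
  have := xsect_inj fb Nd (JN Jp) h3; rewrite {1}dE -flowD // subrK => /(_ erefl); lra.
have th_lc y : theta y != 0 -> \forall q \near y, (0 < theta q) = (0 < theta y).
  move=> t0; have [h|h|h] := ltgtP (theta y) 0; last by rewrite h eqxx in t0.
    by apply: filterS (c_lt _ _ _ (@fb_cont _ _ _ _ _ fb y) h) => q hq; rewrite ltNge ltW.
  by apply: filterS (c_gt _ _ _ (@fb_cont _ _ _ _ _ fb y) h) => q hq; rewrite hq.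
(* In tube coordinates a point of [J] has time 0 or [ts x0], that is, it lies at the [c] end or at
   the [d] end: [mid] excludes the times in the middle, and near the ends the section is met only
   once. *)
have JT_lc y : box J y -> (exists x t, inT x t /\ y = v t x) ->
    \forall q \near y, (0 < theta q) (+) u q = (0 < theta y) (+) u y.
  move=> by' yT; have [t0|t0] := eqVneq (theta y) 0; last first.
    by apply: filterS2 (th_lc y t0) (off_lc y yT (arc_off y by' t0)) => q -> ->.
  have Jy : J y by case: by'; rewrite /fproj t0 oppr0 flow0.
  case: yT => x0 [s0 [in0 yE]]; have [Vx0 /andP[tr1 tr2]] := in0.
  have Ny := JN Jy; have Nx0 := V'N _ Vx0.
  have eE : e = 4 * delta by rewrite /delta; lra.
  have [s0n|s0p] := leP s0 0.
    have s00 : s0 = 0.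
      apply: (xsect_inj fb Nx0 Ny _ (esym yE)).
      by rewrite ler_norml; apply/andP; split; lra.
    have Jx0 : J x0 by move: Jy; rewrite yE s00 flow0.
    have Sk x t : inT x t -> J x -> `|t| < delta -> (0 < theta (v t x)) (+) u (v t x) = kap.
      move=> inx Jx te; have [Vx _] := inx.
      have Nx := V'N _ Vx.
      have te' : `|t| <= e by lra.
      rewrite uE // (theta_flow fb Nx te').
      have xc : x <> c by move=> xc; rewrite xc in Jx.
      have kx := Hkap x Vx xc; rewrite (asboolT Jx) addTb in kx.
      have /andP[tsx _] := ts_in x Vx.
      move: te; rewrite ltr_norml => /andP[te1 te2].
      have [h|h] := leP t 0.
        rewrite addFb; apply/idP/idP => [/asboolP [[_ //]|[h' _ _]]|ka].
          by exfalso; lra.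
        by apply/asboolP; left.
      have -> : `[< S x t >] = `[< J (psi x) >].
        apply/asbool_equiv_eq; split => [[[h' _]|[_ _ //]]|j]; first by exfalso; lra.
        by right; split => //; lra.
      by rewrite kx addTb negbK.
    rewrite yE; apply: filterS (coord x0 s0 [set x | N x -> J x] delta in0 _ dl0); last first.
      exact: (ropen_near flv fb rJ).
    move=> q [x [t [inx /= Ax te ->]]]; have [Vx _] := inx.
    rewrite !Sk //; [by rewrite s00 normr0 | exact/Ax/V'N | by rewrite s00 subr0 in te].
  have /andP[tsx1 tsx2] := ts_in x0 Vx0.
  have s0ts : s0 = ts x0.
    have [h1|h1] := ltP s0 delta.
      have := xsect_inj fb Nx0 Ny _ (esym yE); rewrite gtr0_norm // => h.
      have : s0 = 0 by apply: h; lra.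
      lra.
    have [h2|h2] := leP s0 (L - delta).
      exfalso; apply: (mid x0 s0 Vx0); first by apply/andP.
      by rewrite -yE; right; right.
    have : ts x0 - s0 = 0; last by lra.
    apply: (xsect_inj fb Ny (psiN x0 Vx0)).
      by rewrite ler_norml; apply/andP; split; lra.
    by rewrite yE -flowD // subrK psiE.
  have Jp : J (psi x0) by rewrite psiE -s0ts -yE.
  have xc : x0 <> c.
    move=> xc; apply: (arcJ (t := L)); first by apply/andP; split; lra.
    by move: Jp; rewrite xc psiE tsc.
  rewrite yE; apply: filterS (coord x0 s0 [set x | J (psi x)] delta in0 (JpsiT x0 Vx0 xc Jp) dl0).
  have St x t : inT x t -> J (psi x) -> `|t - s0| < delta -> (0 < theta (v t x)) (+) u (v t x) = true.
    move=> inx Jx; rewrite ltr_norml => /andP[h1 h2]; have [Vx _] := inx.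
    rewrite uE //.
    have /andP[h3 h4] := ts_in x Vx.
    have -> : theta (v t x) = t - ts x.
      have -> : v t x = v (t - ts x) (psi x) by rewrite psiE -flowD // subrK.
      apply: (theta_flow fb); first exact: psiN.
      by rewrite ler_norml; apply/andP; split; lra.
    have -> : `[< S x t >] = (t <= ts x).
      apply/idP/idP => [/asboolP [[h' _]|[_ //]]|h]; first by exfalso; lra.
      by apply/asboolP; right; split => //; lra.
    by rewrite subr_gt0; case: leP.
  move=> q [x [t [inx /= Ax te ->]]].
  by rewrite !St // subrr normr0.
pose tb := [set y | exists x t, inT x t /\ y = v t x].
have otb : open tb.
  rewrite openE => y [x [t [inx ->]]].
  apply: filterS (coord x t setT 1 inx filterT ltr01) => q [x' [t' [inx' _ _ ->]]].
  by exists x', t'.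
have Jg y : J y -> gam y by move=> Jy; left; right; right.
have JN0 y : box J y -> ~ gam y -> theta y != 0.
  move=> [_ h] ng; apply/eqP => t0; apply/ng/Jg.
  by move: h; rewrite /fproj t0 oppr0 flow0.
pose D := @Sys T (option bool)
  (fun i => if i is Some b then (if b then box J else tb) else ~` gam)
  (fun i y => if i is Some b then (if b then 0 < theta y else u y) else false).
exists D; split => //.
- split.
  + move=> [[]|] //=; [exact: rJ.2 | exact: closed_openC].
  + move=> [[]|] [[]|] y //=; rewrite ?addbF ?addFb => h1 h2.
    * by apply: filterS filterT => q _; rewrite !addbb.
    * exact: JT_lc.
    * by apply: filterS (th_lc y (JN0 _ h1 h2)) => q ->; rewrite addbF.
    * by apply: filterS (JT_lc y h2 h1) => q; rewrite [_ (+) u q]addbC [_ (+) u y]addbC.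
    * by apply: filterS filterT => q _; rewrite !addbb.
    * by apply: filterS (off_lc y h1 h2) => q; rewrite !addbF.
    * by apply: filterS (th_lc y (JN0 _ h2 h1)) => q ->.
    * exact: off_lc.
    * by apply: filterS filterT => q _.
  + move=> y _; have [gy|ng] := pselect (gam y); last by exists None.
    have [Jy|nJ] := pselect (J y); first by exists (Some true); exact: (box_id flv fb JN).
    exists (Some false) => /=.
    have [t [tr ->]] : exists t, 0 <= t <= L /\ y = v t c.
      case: gy => [[->|[->|//]]|[t tr <-]]; last by exists t.
        by exists 0; rewrite flow0 // lexx ltW.
      by exists L; rewrite -dE lexx ltW.
    exists c, t; split => //; split => //.
    by move: tr => /andP[? ?]; apply/andP; split; lra.
- by exists None.
- by exists (Some true).
Qed.

End gap_system.

(** * Gaps between returns *)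

Lemma infinite_pigeonhole (B : finType) (S : nat -> Prop) (f : nat -> B) :
  (forall m, exists2 k, (m <= k)%N & S k) ->
  exists b, forall m, exists k, [/\ (m <= k)%N, S k & f k = b].
Proof.
move=> infS; apply: contrapT => H.
have ex b : exists m, forall k, (m <= k)%N -> S k -> f k <> b.
  apply: contrapT => Hb; apply: H; exists b => m; apply: contrapT => Hm.
  by apply: Hb; exists m => k mk Sk fk; apply: Hm; exists k.
have [M HM] := choice ex.
have [k mk Sk] := infS (\max_b M b)%N.
by apply: (HM (f k) k) => //; apply: leq_trans mk; exact: leq_bigmax.
Qed.

Lemma ultra_finite_value (U : set_system nat) (B : finType) (f : nat -> B) :
  UltraFilter U -> exists b, U [set n | f n = b].
Proof.
move=> UU; apply: contrapT => H.
have HC b : U [set n | f n <> b].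
  have [h|//] := in_ultra_setVsetC [set n | f n = b] UU.
  by exfalso; apply: H; exists b.
have /filter_ex [n] : U [set n | forall b, f n <> b].
  exact: (@filter_forall _ _ (fun b n => f n <> b) U _ HC).
by move/(_ (f n)).
Qed.

Lemma seq_eventually (I : eqType) (l : seq I) (P : nat -> I -> Prop) :
  (forall i, i \in l -> exists m, forall n, (m <= n)%N -> P n i) ->
  exists m, forall n, (m <= n)%N -> forall i, i \in l -> P n i.
Proof.
elim: l => [|a l IH] H; first by exists 0%N.
have [m1 H1] := H a (mem_head _ _).
have [|m2 H2] := IH; first by move=> i il; apply: H; rewrite inE il orbT.
exists (maxn m1 m2) => n; rewrite geq_max => /andP[h1 h2] i; rewrite inE.
by move=> /orP[/eqP ->|]; [exact: H1 | exact: H2].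
Qed.

Lemma greatest (T : topologicalType) (V : set T) lt (l : seq T) (P : set T) :
  ordered V lt -> P `<=` V -> (forall x, P x -> x \in l) -> P !=set0 ->
  exists2 c, P c & forall x, P x -> x = c \/ lt x c.
Proof.
move=> od; elim: l P => [|a l IH] P PV Pl [x Px]; first by have := Pl x Px.
have [[x' [Px' x'a]]|no] := pselect (exists x, P x /\ x <> a); last first.
  have e z : P z -> z = a by move=> Pz; apply: contrapT => za; apply: no; exists z.
  by exists x => // z Pz; left; rewrite (e z) // (e x).
have [|||c [Pc ca] Hc] := IH (P `\ a).
- by move=> z [/PV].
- by move=> z [Pz za]; have := Pl z Pz; rewrite inE => /orP[/eqP|].
- by exists x'.
have [Pa|nPa] := pselect (P a); last first.
  by exists c => // z Pz; apply: Hc; split => // za; apply: nPa; rewrite -za.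
have [h|h] := od_total od (PV _ Pa) (PV _ Pc) (fun h => ca (esym h)).
  by exists c => // z Pz; have [->|/eqP za] := eqVneq z a; [right | exact: Hc].
exists a => // z Pz; have [->|/eqP za] := eqVneq z a; [by left | right].
have [->//|h'] := Hc z (conj Pz za).
exact: (od_trans od (PV _ Pz) (PV _ Pc) (PV _ Pa) h' h).
Qed.

Lemma closure_invariant (T : topologicalType) (v : RR -> T -> T) (A : set T) t z :
  is_flow v -> (forall x, A x -> A (v t x)) -> closure A z -> closure A (v t z).
Proof.
move=> flv At cz G Gz.
have N : nbhs z (v t @^-1` G) by exact: (flow_continuous flv (t := t) Gz).
by have [a [Aa Ga]] := cz _ N; exists (v t a); split => //; exact: At.
Qed.

Lemma orbit_flow (T : topologicalType) (v : RR -> T -> T) (x y : T) t :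
  is_flow v -> Defs.orbit v x y -> Defs.orbit v x (v t y).
Proof. by move=> flv [s _ <-]; exists (t + s) => //; rewrite flowD. Qed.

Section gaps.
Variables (T : topologicalType) (v : RR -> T -> T).
Hypothesis flv : is_flow v.
Hypothesis hT : hausdorff_space T.
Hypothesis cT : compact [set: T].
Hypothesis lT : locally_half_euclidean2 T.
Variables (theta : T -> RR) (W : set T) (e : RR).
Hypothesis fb : fbox v theta W e.
Variables (V : set T) (lt : T -> T -> Prop).
Hypothesis rV : ropen v theta W e V.
Hypothesis od : ordered V lt.
Variable x0 : T.
Hypothesis ncl : ~ closed_point v x0.

Local Notation ropen := (ropen v theta W e).

(** An interval of times of length [e] contains at most one passage through the section, hence the
    induction over multiples of [e]. *)
Lemma hits_finite y (M : RR) : exists l : seq T,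
  forall t, 0 <= t <= M -> V (v t y) -> v t y \in l.
Proof.
have e0 := fb_gt0 fb.
suff H (k : nat) : exists l : seq T,
    forall t, 0 <= t <= k%:R * e -> V (v t y) -> v t y \in l.
  have [l Hl] := H (Num.truncn (M / e)).+1; exists l => t /andP[t0 tM].
  apply: Hl; rewrite t0 /=; apply: le_trans tM _.
  by rewrite -ler_pdivrMr //; apply/ltW; exact: truncnS_gt.
elim: k => [|k [l Hl]].
  exists [:: y] => t; rewrite mul0r => /andP[h1 h2] _.
  have -> : t = 0 by lra.
  by rewrite flow0 // inE.
have E : k.+1%:R * e = k%:R * e + e by rewrite -natr1 mulrDl mul1r.
have [[s [/andP[s1 s2] Vs]]|no] :=
  pselect (exists s, k%:R * e <= s <= k.+1%:R * e /\ V (v s y)).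
  exists (v s y :: l) => t /andP[t0 t1] Vt; rewrite inE.
  have [h|h] := leP t (k%:R * e); first by rewrite (Hl t) ?orbT // t0.
  have : t - s = 0.
    apply: (xsect_inj fb (rV.1 _ Vs) (rV.1 _ Vt)).
      by rewrite ler_norml; apply/andP; split; lra.
    by rewrite -flowD // subrK.
  by move=> /subr0_eq ->; rewrite eqxx.
exists l => t /andP[t0 t1] Vt; have [h|h] := leP t (k%:R * e).
  by apply: Hl => //; rewrite t0.
by exfalso; apply: no; exists t; split => //; rewrite t1 ltW.
Qed.

Definition hits (n : nat) : set T :=
  [set x | V x /\ exists2 t, 0 <= t <= n%:R & x = v t x0].

(** The points making the same cut as [y] among the hits up to time [n]. In this form the gap
    visibly decreases in [n], although its ends change. *)
Definition gap (n : nat) (y : T) : set T :=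
  [set z | [/\ V z, ~ hits n z & forall h, hits n h -> (lt h z <-> lt h y)]].

Lemma hits_mono m n : (m <= n)%N -> hits m `<=` hits n.
Proof.
move=> mn x [Vx [t /andP[t0 tm] xE]]; split => //; exists t => //.
by rewrite t0 /=; apply: le_trans tm _; rewrite ler_nat.
Qed.

Lemma gap_anti m n y : (m <= n)%N -> gap n y `<=` gap m y.
Proof.
move=> mn z [Vz nz Hz]; split => //; first by move=> /(hits_mono mn).
by move=> h /(hits_mono mn); exact: Hz.
Qed.

Lemma gap_system_exists n y c0 d0 : V y -> ~ hits n y -> hits n c0 -> hits n d0 ->
  lt c0 y -> lt y d0 -> exists D gam, [/\ curve_sys v theta e D gam (gap n y),
    gam `<=` gap n y `|` [set v t x0 | t in [set t | 0 <= t <= n%:R]],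
    ropen (gap n y) & connected (gap n y)].
Proof.
move=> Vy ny hc0 hd0 c0y yd0.
have [l Hl] := hits_finite x0 n%:R.
have hl h : hits n h -> h \in l by move=> [Vh [t tn hE]]; rewrite hE in Vh *; exact: Hl.
have [|||c [hc cy] Hc] := @greatest T V lt l [set h | hits n h /\ lt h y] od.
- by move=> h [[]].
- by move=> h [/hl].
- by exists c0.
have [|||d [hd yd] Hd] := @greatest T V _ l [set h | hits n h /\ lt y h] (ordered_rev od).
- by move=> h [[]].
- by move=> h [/hl].
- by exists d0.
have [Vc [s /andP[s0 sn] cE]] := hc; have [Vd [t /andP[t0 tn] dE]] := hd.
have cd : lt c d by exact: (od_trans od Vc Vy Vd).
have nhy h : hits n h -> ~ lt h y -> lt y h.
  move=> hh nhy; have [Vh _] := hh.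
  have [hy|//] := od_total od Vh Vy (fun h' => ny (eq_ind _ (hits n) hh _ h')).
  by [].
have TE : gap n y = oitv V lt c d.
  apply/seteqP; split => z.
    move=> [Vz nz Hz]; split => //; first exact/(Hz c hc).
    have zd : z <> d by move=> zd; apply: nz; rewrite zd.
    have [//|/(Hz d hd) dy] := od_total od Vz Vd zd.
    by exfalso; exact: (od_asym od Vy Vd yd dy).
  move=> [Vz cz zd].
  have Hz h : hits n h -> (lt h z <-> lt h y).
    move=> hh; have [Vh _] := hh; split => hz.
      apply: contrapT => /(nhy h hh) yh.
      have [hE|dh] := Hd h (conj hh yh); first by rewrite hE in hz; exact: (od_asym od Vz Vd zd hz).
      exact: (od_asym od Vz Vd zd (od_trans od Vd Vh Vz dh hz)).
    have [->//|hc'] := Hc h (conj hh hz).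
    exact: (od_trans od Vh Vc Vz).
  split => // hz; have [zy|/(nhy z hz) yz] := pselect (lt z y).
    by have /(Hz z hz) := zy; exact: (od_irr od).
  have [zE|dz] := Hd z (conj hz yz); first by rewrite zE in zd; exact: (od_irr od zd).
  exact: (od_asym od Vz Vd zd dz).
have noJ r : 0 <= r <= n%:R -> ~ oitv V lt c d (v r x0).
  by move=> rn; rewrite -TE => -[Vr nr _]; apply: nr; split => //; exists r.
have rT : ropen (gap n y) by rewrite TE; exact: oitv_ropen.
have cT' : connected (gap n y) by rewrite TE; exact: oitv_connected.
have st : s <> t by move=> st; apply: (od_neq od cd); rewrite cE dE st.
(* [gap_system] takes an arc from the lower to the upper end; if the upper end is hit first, it is
   applied to the reversed order. *)
have [h|h|//] := ltgtP s t.
  have [|||r /andP[r0 r1]|D HD] :=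
    gap_system flv hT lT fb rV od Vc Vd cd (L := t - s).
  - by rewrite subr_gt0.
  - by rewrite cE -flowD // subrK.
  - by rewrite cE => /(closed_point_flow flv).
  - by rewrite {2}cE -flowD //; apply: noJ; apply/andP; split; lra.
  exists D, (c |` (d |` oitv V lt c d) `|` [set v r c | r in seg 0 (t - s)]).
  split => //; first by rewrite TE; exact: HD.
  rewrite TE => z [[->|[->|Jz]]|[r /andP[r0 r1] <-]]; [right|right|by left|right].
  - by exists s => //; apply/andP.
  - by exists t => //; apply/andP.
  - by exists (r + s); [apply/andP; split; lra | rewrite cE flowD].
have [|||r /andP[r0 r1]|D HD] :=
  gap_system flv hT lT fb rV (ordered_rev od) Vd Vc cd (L := s - t).
- by rewrite subr_gt0.
- by rewrite dE -flowD // subrK.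
- by rewrite dE => /(closed_point_flow flv).
- by rewrite oitv_rev {2}dE -flowD //; apply: noJ; apply/andP; split; lra.
rewrite oitv_rev in HD.
exists D, (d |` (c |` oitv V lt c d) `|` [set v r d | r in seg 0 (s - t)]).
split => //; first by rewrite TE; exact: HD.
rewrite TE => z [[->|[->|Jz]]|[r /andP[r0 r1] <-]]; [right|right|by left|right].
- by exists t => //; apply/andP.
- by exists s => //; apply/andP.
- by exists (r + t); [apply/andP; split; lra | rewrite dE flowD].
Qed.

End gaps.

(** * Local density of non-closed orbits *)

(** The point may be recurrent in one time direction only, so the sign of the return time is left
    open. *)
Lemma two_sided_hit (T : topologicalType) (v : RR -> T -> T) theta W e V y :
  is_flow v -> fbox v theta W e -> ropen v theta W e V -> recurrent_point v y ->
  V y -> exists2 t, t <> 0 & V (v t y).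
Proof.
move=> flv fb rV rec Vy; have e0 := fb_gt0 fb.
have by' := box_id flv fb rV.1 Vy.
have N := open_nbhs_nbhs (conj rV.2 by').
have proj t : box v theta e V (v t y) -> V (v (t - theta (v t y)) y).
  by move=> [_]; rewrite /fproj addrC flowD.
case: rec => [/omega_returns rx|/alpha_returns rx].
  have [t te bt] := rx _ N e; have [ht _] := bt.
  exists (t - theta (v t y)); last exact: proj.
  by move: ht; rewrite ltr_norml => /andP[h1 h2] h; lra.
have [t te bt] := rx _ N (- e); have [ht _] := bt.
exists (t - theta (v t y)); last exact: proj.
by move: ht; rewrite ltr_norml => /andP[h1 h2] h; lra.
Qed.

Section density.
Variables (T : topologicalType) (v : RR -> T -> T).
Hypothesis flv : is_flow v.
Hypothesis hT : hausdorff_space T.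
Hypothesis cT : compact [set: T].
Hypothesis lT : locally_half_euclidean2 T.
Hypothesis recv : recurrent_flow v.

Lemma dense_from_above theta W e V lt x0 :
  fbox v theta W e -> ropen v theta W e V -> ordered V lt ->
  ~ closed_point v x0 -> V x0 ->
  (forall G, nbhs x0 G -> exists t,
     [/\ 0 <= t, V (v t x0), lt x0 (v t x0) & G (v t x0)]) ->
  locally_dense_orbit v x0.
Proof.
move=> fb rV od ncl Vx0 above; apply: contrapT => nld.
pose Q := closure (Defs.orbit v x0).
have Qv t z : Q z -> Q (v t z).
  by apply: closure_invariant => // x; exact: orbit_flow.
have orbQ t : Q (v t x0) by apply: subset_closure; exists t.
have clQ : closed Q by exact: closed_closure.
(* Forward hits accumulate at [x0] from above, so a strictly decreasing sequence [pp] of them can be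
   chosen. *)
pose P p := [/\ V p, lt x0 p & exists2 t, 0 <= t & p = v t x0].
have exnext p : exists p', P p -> P p' /\ lt p' p.
  have [[Vp xp _]|nP] := pselect (P p); last by exists p.
  have [t [t0 Vt xt /(_ Vt) h]] := above _ (od_lt od Vp Vx0 xp).
  by exists (v t x0) => _; split => //; split => //; exists t.
have [next Hnext] := choice exnext.
have [s0 [s00 Vs0 xs0 _]] := above _ filterT.
pose pp k := iter k next (v s0 x0).
have HP k : P (pp k).
  by elim: k => [|k IH]; [split => //; exists s0 | have [] := Hnext _ IH].
have VP k : V (pp k) by have [] := HP k.
have HL k : lt (pp k.+1) (pp k) by have [] := Hnext _ (HP k).
have HLm j k : (j <= k)%N -> pp k = pp j \/ lt (pp k) (pp j).
  elim: k => [|k IH]; first by rewrite leqn0 => /eqP ->; left.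
  rewrite leq_eqVlt => /orP[/eqP ->|]; first by left.
  rewrite ltnS => /IH [<-|h]; right => //.
  exact: (od_trans od (VP k.+1) (VP k) (VP j) (HL k) h).
have exN k : exists N, forall n, (N <= n)%N -> hits v V x0 n (pp k).
  have [Vp _ [t t0 pE]] := HP k; exists (Num.truncn t).+1 => n tn.
  split => //; exists t => //; rewrite t0 /=.
  by apply: (@le_trans _ _ (Num.truncn t).+1%:R); [apply/ltW; exact: truncnS_gt | rewrite ler_nat].
have [N HN] := choice exN.
(* If the orbit closure contained the whole interval between two hits, it would contain the flow box
   over it and have interior. *)
have exy k : exists y, [/\ V y, lt (pp k.+1) y, lt y (pp k) & ~ Q y].
  apply: contrapT => nex; apply: nld.
  have [z Jz] := oitv_nonempty hT od (VP k.+1) (VP k) (HL k).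
  have rJ := oitv_ropen flv fb rV od (VP k.+1) (VP k).
  have bz := box_id flv fb rJ.1 Jz.
  exists z; apply: filterS (open_nbhs_nbhs (conj rJ.2 bz)) => q [_ [Vq h1 h2]].
  rewrite -(fprojK flv theta q); apply: Qv.
  by apply: contrapT => nQ; apply: nex; exists (fproj v theta q).
have [y Hy] := choice exy.
have Vy k : V (y k) by have [] := Hy k.
pose gp n k := gap v V lt x0 n (y k).
have sep n j k z : (j < k)%N -> (N j.+1 <= n)%N -> gp n j z -> gp n k z -> False.
  move=> jk Nn [_ _ /(_ _ (HN _ _ Nn)) h1] [_ _ /(_ _ (HN _ _ Nn)) h2].
  have [_ /h1/h2 h3 _ _] := Hy j; have [_ _ h4 _] := Hy k.
  have h5 : lt (y k) (pp j.+1).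
    have [<-//|h] := HLm j.+1 k jk; exact: (od_trans od (Vy k) (VP k) (VP j.+1) h4 h).
  exact: (od_asym od (Vy k) (VP _) h5 h3).
have hitQ n z : hits v V x0 n z -> Q z by move=> [_ [t _ ->]]; exact: orbQ.
(* A connected piece of the section around [y k] that misses the orbit closure contains no hit at
   all, so it lies in [gp n k] for every [n]. Recurrence of [y k] to this piece gives an arc
   independent of [n]; for a negative return time its ends are exchanged. *)
have exseg k : exists yt : T * RR, [/\ 0 < yt.2, ~ Q yt.1,
    forall n, gp n k yt.1 & forall n, gp n k (v yt.2 yt.1)].
  have [_ _ _ nQy] := Hy k.
  have oQ : open (~` Q) by exact: closed_openC.
  have [V' [rV' V'y cV' V'V V'Q]] :=
    ropen_component flv lT fb rV (Vy k) (open_nbhs_nbhs (conj oQ nQy)).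
  have V'g z n : V' z -> gp n k z.
    move=> V'z; split; [exact: V'V | by move=> /hitQ; exact: V'Q |].
    have conv a b h : V' a -> V' b -> hits v V x0 n h -> lt h a -> lt h b.
      move=> V'a V'b hh ha; have [Vh _] := hh.
      have hb : h <> b by move=> hb; apply: (V'Q _ V'b); rewrite -hb; exact: hitQ hh.
      have [//|bh] := od_total od Vh (V'V _ V'b) hb.
      have V'h := connected_convex od V'V cV' V'b V'a Vh bh ha.
      by exfalso; apply: (V'Q _ V'h); exact: hitQ hh.
    by move=> h hh; split; exact: conv.
  have [t t0 V't] := two_sided_hit flv fb rV' (recv (y k)) V'y.
  have [tp|tn|//] := ltgtP t 0.
    exists (v t (y k), - t) => /=; split; [by rewrite oppr_gt0 | exact: V'Q | |] => n.
      exact: V'g.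
    by rewrite flowK //; exact: V'g.
  by exists (y k, t); split => // n; exact: V'g.
have [seg Hseg] := choice exseg.
have exD (nk : nat * nat) : exists Dg : sys T * set T,
    (N nk.2 <= nk.1)%N -> (N nk.2.+1 <= nk.1)%N ->
    [/\ curve_sys v theta e Dg.1 Dg.2 (gp nk.1 nk.2),
      Dg.2 `<=` gp nk.1 nk.2 `|` [set v t x0 | t in [set t | 0 <= t <= nk.1%:R]],
      ropen v theta W e (gp nk.1 nk.2) & connected (gp nk.1 nk.2)].
  case: nk => n k /=; have [Nn|nN] := boolP ((N k <= n)%N && (N k.+1 <= n)%N); last first.
    (* A dummy value for those [n] at which the ends of gap [k] have not both been hit. *)
    by exists (@Sys T unit (fun=> setT) (fun _ _ => true), setT) => h1 h2; rewrite h1 h2 in nN.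
  have /andP[N1 N2] := Nn; have [_ h1 h2 nQ] := Hy k.
  have [|D [gam HD]] := gap_system_exists flv hT lT fb rV od ncl (Vy k) _ (HN _ _ N2) (HN _ _ N1) h1 h2.
    by move=> /hitQ.
  by exists (D, gam) => _ _.
have [Dg HDg] := choice exD.
have [B [cls Hcls]] := class_map hT cT lT.
(* The class of the curve over gap [k] may vary with [n]; along the ultrafilter it is equal to one
   value [f k]. *)
have [U [UU subU]] := ultraFilterLemma (_ : ProperFilter (@nbhs nat (set_system nat) \oo)).
have exf k := @ultra_finite_value U B (fun n => cls (Dg (n, k)).1) UU.
have [f Hf] := choice exf.
have [b Hb] := @infinite_pigeonhole B (fun=> True) f (fun m => ex_intro2 _ _ m (leqnn m) I).
have [i [_ _ fi]] := Hb 0%N.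
have [ti0 nQi gi gti] := Hseg i.
set yi := (seg i).1 in nQi gi gti; set ti := (seg i).2 in ti0 gti.
have [l Hl] := hits_finite flv fb rV yi ti.
pose S j := (i < j)%N /\ f j = b.
(* For suitable large [n] the curves over gaps [i] and [j] have equal class, so the arc of [yi]
   crosses gap [j] at one of the finitely many points of [l]. As gaps decrease with [n], one of
   these points lies in gap [j] for all [n]. *)
have key j : S j -> exists2 z, z \in l & forall n, gp n j z.
  move=> [ij fj]; apply: contrapT => nz.
  have [z zl|m Hm] := @seq_eventually _ l (fun n z => ~ gp n j z).
    have [m Hm] : exists m, ~ gp m j z.
      apply: contrapT => h; apply: nz; exists z => // n.
      by apply: contrapT => h'; apply: h; exists n.
    by exists m => n mn h; apply: Hm; exact: gap_anti mn _ h.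
  pose M := maxn m (maxn (maxn (N i) (N i.+1)) (maxn (N j) (N j.+1))).
  have UM : U [set n | (M <= n)%N] by apply: subU; exists M.
  have UF : Filter U by exact: ultra_proper.
  have [n [[/= Mn ci] cj]] := filter_ex (filterI (filterI UM (Hf i)) (Hf j)).
  move: Mn; rewrite !geq_max => /and3P[mn /andP[i1 i2] /andP[j1 j2]].
  have [/= c1 g1 r1 co1] := HDg (n, i) i1 i2.
  have [/= c2 g2 r2 co2] := HDg (n, j) j1 j2.
  have tr : triv (sumsys (Dg (n, i)).1 (Dg (n, j)).1) setT.
    have [gd1 _ _ _ _] := c1; have [gd2 _ _ _ _] := c2.
    by apply: Hcls => //; rewrite ci cj fi fj.
  have dj : gp n i `&` (Dg (n, j)).2 = set0.
    apply/seteqP; split => // z [gz /g2 [gz'|[t tn zE]]]; first exact: (sep n i j z).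
    by case: gz => Vz nhz _; apply: nhz; split => //; exists t.
  have nQt t r : v t yi <> v r x0.
    by move=> h; apply: nQi; rewrite -(flowK flv t yi) h; exact/Qv/orbQ.
  have [||t /andP[t0 t1] gpt] := crossing flv fb c1 c2 r1 co1 dj tr _ _ (gi n) (gti n) ti0.
  - by move=> t /g1 [//|[r _ h]]; exfalso; exact: (nQt t r).
  - by move=> t /g2 [//|[r _ h]]; exfalso; exact: (nQt t r).
  have [Vt _ _] := gpt; apply: (Hm n mn (v t yi)) gpt; apply: Hl; last exact: Vt.
  by rewrite (ltW t0) ltW.
have exz j : exists z, S j -> z \in l /\ forall n, gp n j z.
  have [/key [z zl h]|] := pselect (S j); [by exists z | by exists yi].
have [z Hz] := choice exz.
have infS m : exists2 k, (m <= k)%N & S k.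
  have [k [mk _ fk]] := Hb (maxn m i.+1); move: mk; rewrite geq_max => /andP[mk ik].
  by exists k.
(* Infinitely many gaps share the finitely many points of [l], yet two different gaps are disjoint
   once a hit between them is counted. *)
have [b' Hb'] := @infinite_pigeonhole _ S (fun j => inord (index (z j) l) : 'I_(size l).+1) infS.
have [j [_ Sj fj]] := Hb' 0%N; have [k [jk Sk fk]] := Hb' j.+1.
have [zj gj] := Hz j Sj; have [zk gk] := Hz k Sk.
have zz : z j = z k.
  rewrite -(nth_index yi zj) -(nth_index yi zk).
  move: (congr1 val (etrans fj (esym fk))).
  by rewrite /= !inordK ?ltnS ?index_size // => ->.
apply: (sep (N j.+1) j k (z j)) => //.
by rewrite zz; exact: gk.
Qed.

(** The claim depends only on the orbit, so [x] may be replaced by an interior point of it. Its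
    forward hits accumulate from above or from below, and the second case is the first for the
    reversed order. *)
Lemma returning_dense x : ~ closed_point v x -> returns v x -> locally_dense_orbit v x.
Proof.
move=> ncl rx.
have [|s ints] := recurrent_interior flv lT ncl.
  move=> G Gx; have [t h1 h2] := rx G Gx 1; exists t => //.
  by apply: lt_le_trans h1 (ler_norm _).
suff : locally_dense_orbit v (v s x).
  rewrite /locally_dense_orbit; suff -> : Defs.orbit v (v s x) = Defs.orbit v x by [].
  apply/seteqP; split => _ [t _ <-]; first by exists (t + s) => //; rewrite flowD.
  by exists (t - s) => //; rewrite -flowD // subrK.
have {}ncl : ~ closed_point v (v s x) by move=> /(closed_point_flow flv).
have {}rx := returns_flow flv (s := s) rx.
move: (v s x) ints ncl rx => p ip ncl rp.
have nsg : ~ singular_point v p by move=> h; apply: ncl; left.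
have [theta [W [e [V [lt [fb rV Vp _ od]]]]]] :=
  ordered_section flv hT cT lT ip nsg filterT.
pose near lt := forall G, nbhs p G -> exists t,
  [/\ 0 <= t, V (v t p), lt p (v t p) & G (v t p)].
suff [h|h] : near lt \/ near (fun a b => lt b a).
- exact: (dense_from_above fb rV od ncl Vp h).
- exact: (dense_from_above fb rV (ordered_rev od) ncl Vp h).
apply: contrapT => /not_orP [/existsNP [G1 /not_implyP [G1p n1]]
  /existsNP [G2 /not_implyP [G2p n2]]].
have [t t0 [Vt [G1t G2t]]] := hit flv fb rV Vp rp (nbhsI G1p G2p) 0.
have tp : p <> v t p.
  move=> h; have : 0 = t by apply: (nonclosed_inj flv ncl); rewrite flow0.
  by lra.
have [h|h] := od_total od Vp Vt tp.
  by apply: n1; exists t; split => //; exact: ltW.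
by apply: n2; exists t; split => //; exact: ltW.
Qed.

End density.

(** * Recurrent flows *)

Definition rev_flow (T : topologicalType) (v : RR -> T -> T) (t : RR) (x : T) : T :=
  v (- t) x.

Section reversal.
Variables (T : topologicalType) (v : RR -> T -> T).
Hypothesis flv : is_flow v.

Lemma rev_is_flow : is_flow (rev_flow v).
Proof.
split; rewrite /rev_flow.
- by move=> x; rewrite oppr0 flow0.
- by move=> s t x; rewrite opprD flowD.
- move=> p; apply: (contV flv (f := fun p : RR * T => - p.1) (k := fun p : RR * T => p.2)).
    by apply: contN; exact: cvg_fst.
  exact: cvg_snd.
Qed.

Lemma rev_omega x : omega_limit (rev_flow v) x = alpha_limit v x.
Proof.
apply/seteqP; split => z hz n _; apply: closureS (hz (- n) I).
  by move=> _ [t /= nt <-]; exists (- t) => //=; lra.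
by move=> _ [t /= nt <-]; exists (- t); [rewrite /=; lra | rewrite /rev_flow opprK].
Qed.

Lemma rev_alpha x : alpha_limit (rev_flow v) x = omega_limit v x.
Proof.
apply/seteqP; split => z hz n _; apply: closureS (hz (- n) I).
  by move=> _ [t /= nt <-]; exists (- t) => //=; lra.
by move=> _ [t /= nt <-]; exists (- t); [rewrite /=; lra | rewrite /rev_flow opprK].
Qed.

Lemma rev_orbit x : Defs.orbit (rev_flow v) x = Defs.orbit v x.
Proof.
by apply/seteqP; split => _ [t _ <-]; exists (- t); rewrite /rev_flow ?opprK.
Qed.

Lemma rev_closed_point x : closed_point (rev_flow v) x -> closed_point v x.
Proof.
have sg : singular_point (rev_flow v) x <-> singular_point v x.
  by split => h t; [rewrite -(opprK t) | rewrite /rev_flow]; exact: h.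
case=> [/sg|[nsg [p [p0 vp]]]]; [by left | right; split; first by move/sg].
by exists p; split => //; rewrite -{1}vp /rev_flow flowNK.
Qed.

End reversal.

Section converse.
Variables (T : topologicalType) (v : RR -> T -> T).
Hypothesis flv : is_flow v.
Hypothesis hT : hausdorff_space T.
Hypothesis cT : compact [set: T].
Hypothesis lT : locally_half_euclidean2 T.
Hypothesis conT : connected [set: T].
Hypothesis recv : recurrent_flow v.

Lemma recurrent_dense x : ~ closed_point v x -> locally_dense_orbit v x.
Proof.
move=> ncl; case: (recv x) => [/omega_returns|ax]; first exact: returning_dense.
rewrite /locally_dense_orbit -rev_orbit.
apply: (returning_dense (rev_is_flow flv)) => //.
- by move=> z; rewrite /recurrent_point rev_omega rev_alpha setUC; exact: recv.
- by move=> /(rev_closed_point flv).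
- by apply: omega_returns; rewrite rev_omega.
Qed.

Lemma closed_point_Poisson x : closed_point v x -> Poisson_stable_point v x.
Proof.
move=> cx; have [per [p0 vp]] : exists per : RR, 0 < per /\ v per x = x.
  by case: cx => [h|[_ //]]; exists 1; split => //; exact: h.
have vpn (n : nat) : v (per * n%:R) x = x.
  elim: n => [|n IH]; first by rewrite mulr0 flow0.
  by rewrite -natr1 mulrDr mulr1 flowD // vp.
have big (r : RR) : exists n : nat, r < per * n%:R.
  exists (Num.truncn (r / per)).+1.
  by rewrite mulrC -ltr_pdivrMr //; exact: truncnS_gt.
split => r _; apply: subset_closure.
  by have [n hn] := big r; exists (per * n%:R).
have [n hn] := big (- r); exists (- (per * n%:R)); first by rewrite /=; lra.
by rewrite -{1}(vpn n) flowK.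
Qed.

Let invariant (M : set T) := forall t z, M z -> M (v t z).

Lemma no_closed_minimal : Cl v = set0 -> forall M, closed M -> M !=set0 ->
  invariant M -> M = setT.
Proof.
move=> C0; have nc z : ~ closed_point v z by move=> cz; have : Cl v z by []; rewrite C0.
move=> M0 clM0 neM0 invM0.
pose P M := [/\ closed M, M !=set0 & invariant M].
have [|F [M FM] FP Ftot|M [[clM [x Mx] invM] MM0 minM]] := @zorn_minimal T P M0.
- by [].
- split.
  + by apply: closed_bigI => K /FP [[]].
  + apply: chain_nonempty => //; first by exists M.
    by move=> K /FP [[]].
  + by move=> t z Kz K FK; have [[_ _ invK] _] := FP K FK; apply: invK; exact: Kz.
suff MT : M = setT by apply/seteqP; split => // z _; apply: MM0; rewrite MT.
have MQ z : M z -> closure (Defs.orbit v z) = M.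
  move=> Mz; apply: minM; last first.
    by move=> q hq; apply: clM; apply: closureS hq => _ [t _ <-]; exact: invM.
  split; [exact: closed_closure | |].
    by exists z; apply: subset_closure; exists 0 => //; rewrite flow0.
  by move=> t q; apply: closure_invariant => // r; exact: orbit_flow.
have [y iy] := recurrent_dense (nc x); rewrite (MQ x Mx) in iy.
(* Each orbit in [M] is dense in [M], so it enters the interior of [M]; the flow carries that
   interior back to the starting point. *)
have oM : open M.
  rewrite openE => z Mz.
  have : closure (Defs.orbit v z) y by rewrite MQ //; exact: interior_subset.
  move=> /(_ _ (nbhs_interior iy)) [_ [[t _ <-] Mt]].
  have N : nbhs z (v t @^-1` M) by exact: (flow_continuous flv (t := t) Mt).
  apply: filterS N => q /= /(invM (- t)).
  by rewrite flowK.
apply: conT; first by exists x.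
  by exists M => //; rewrite setTI.
by exists M => //; rewrite setTI.
Qed.

(** With the times above [n], or below [n], as [S n], both limit sets are treated at once: they are
    closed, non-empty by compactness and invariant by shifting times, hence everything. *)
Lemma limit_set_full (S : RR -> set RR) x : Cl v = set0 ->
  (forall n, exists t, S n t) -> (forall m n, exists k, S k `<=` S m `&` S n) ->
  (forall s n, exists k, forall t, S k t -> S n (s + t)) ->
  \bigcap_(n in [set: RR]) closure [set v t x | t in S n] = setT.
Proof.
move=> C0 neS dirS shiftS; apply: no_closed_minimal => //.
- by apply: closed_bigI => n _; exact: closed_closure.
- pose F : set_system T := [set A | exists n, [set v t x | t in S n] `<=` A].
  have FF : ProperFilter F.
    split.
      by move=> [n Sn]; have [t St] := neS n; apply: (Sn (v t x)); exists t.
    split; first by exists 0.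
    - move=> A A' [m Am] [n An]; have [k Sk] := dirS m n; exists k.
      move=> _ [t /Sk [St1 St2] <-]; split; [apply: Am | apply: An]; exists t => //.
    - by move=> A A' AA' [n An]; exists n; exact: subset_trans An AA'.
  have [z [_ cz]] := cT FF (ex_intro _ 0 (fun _ _ => I)).
  exists z => n _ G Gz; have [_ [[t St <-] Gt]] := cz _ G (ex_intro _ n (fun _ h => h)) Gz.
  by exists (v t x); split => //; exists t.
- move=> s z hz n _; have [k Sk] := shiftS s n.
  move=> G Gz; have N : nbhs z (v s @^-1` G) by exact: (flow_continuous flv (t := s) Gz).
  have [_ [[t St <-] Gt]] := hz k I _ N.
  exists (v s (v t x)); split => //; exists (s + t); [exact: Sk | exact: flowD].
Qed.

Lemma recurrent_Poisson : LD v = set0 \/ Cl v = set0 -> Poisson_stable_flow v.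
Proof.
move=> [L0|C0] x.
  apply: closed_point_Poisson; apply: contrapT => ncl.
  have : LD v x; last by rewrite L0.
  exists x; last by exists 0 => //; rewrite flow0.
  by split => //; exact: recurrent_dense.
split.
  rewrite /omega_limit (limit_set_full (S := fun n => [set t | n < t])) //.
  - by move=> n; exists (n + 1) => /=; lra.
  - move=> m n; exists (Num.max m n) => t /=; rewrite gt_max => /andP[].
    by split.
  - by move=> s n; exists (n - s) => t /=; lra.
rewrite /alpha_limit (limit_set_full (S := fun n => [set t | t < n])) //.
- by move=> n; exists (n - 1) => /=; lra.
- move=> m n; exists (Num.min m n) => t /=; rewrite lt_min => /andP[].
  by split.
- by move=> s n; exists (n - s) => t /=; lra.
Qed.

End converse.

Theorem theorem5p3 (T : topologicalType) (v : RR -> T -> T) :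
  is_surface T -> connected [set: T] -> compact [set: T] -> is_flow v ->
  (Poisson_stable_flow v <->
     recurrent_flow v /\ (LD v = set0 \/ Cl v = set0)).
Proof.
move=> [hT _ lT] conT cT flv; split => [Ps|[recv]].
  split; last exact: poisson_stable_dichotomy.
  by move=> x; left; have [] := Ps x.
exact: recurrent_Poisson.
Qed.
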